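(* Let $n\ge 2$ and $1<p<p_0(n)$, and let $R>0$. Assume that $f\in H^1(\mathbf{R}^n)$ and $g\in L^2(\mathbf{R}^n)$ are both non-negative and have compact support, and that $g$ does not vanish identically. For $\varepsilon>0$, suppose that the initial value problem $$u_{tt}-\Delta u=|u|^p\ \text{ in }\mathbf{R}^n\times[0,\infty),\qquad u(x,0)=\varepsilon f(x),\quad u_t(x,0)=\varepsilon g(x)$$ has a solution $u$ on the time interval $[0,T(\varepsilon))$, where $T(\varepsilon)$ is the lifespan, with $(u,u_t)\in C([0,T(\varepsilon)),H^1(\mathbf{R}^n)\times L^2(\mathbf{R}^n))$ and $$\mathrm{supp}(u,u_t)\subset\{(x,t)\in\mathbf{R}^n\times[0,\infty): |x|\le t+R\}.$$ Then there exist a positive constant $\varepsilon_0=\varepsilon_0(f,g,n,p,R)$ and a positive constant $C$ independent of $\varepsilon$ such that $$T(\varepsilon)\le C\varepsilon^{-2p(p-1)/\gamma(p,n)}\quad\text{for all }0<\varepsilon\le\varepsilon_0.$$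
   Context: Notation: $\gamma(p,n):=2+(n+1)p-(n-1)p^2$, and for $n\ge2$ $$p_0(n)=\frac{n+1+\sqrt{n^2+10n-7}}{2(n-1)}$$ is the positive root (in $p$) of $\gamma(p,n)=0$; thus $\gamma(p,n)>0$ for $1<p<p_0(n)$. Lifespan: for fixed $(f,g)$, $T(\varepsilon)\in(0,\infty]$ is the supremum of all $t>0$ such that a solution $u(x,t)$ of the initial value problem exists up to time $t$. Here a solution in the class $(u,u_t)\in C([0,T),H^1\times L^2)$ is understood in the weak sense: $u(\cdot,0)=\varepsilon f$, $u_t(\cdot,0)=\varepsilon g$, and $u_{tt}-\Delta u=|u|^p$ holds in the sense of distributions on $\mathbf{R}^n\times(0,T)$. (The paper's general convention is that ''solution'' means a classical one when $p\ge2$ and a weak one, or one of the associated integral equation, when $1<p<2$.) *)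

(* Defs.v *)
From HB Require Import structures.
From mathcomp Require Import all_boot all_order all_algebra.
From mathcomp Require Import all_classical all_reals all_analysis.
Set Implicit Arguments.
Unset Strict Implicit.
Unset Printing Implicit Defensive.
Import Order.TTheory GRing.Theory Num.Theory.
Import numFieldNormedType.Exports.
Local Open Scope classical_set_scope.
Local Open Scope ring_scope.

Definition rV_display : measure_display.
Proof. exact: default_measure_display. Qed.

(* ['rV[R]_n] carries the product sigma-algebra of its coordinates. *)
Section measurable_rV.
Context (R : realType) (n : nat).

Let coord (i : 'I_n) (x : 'rV[R]_n) : R := x ord0 i.

Let rV_set0 : g_sigma_preimage coord set0.
Proof. exact: sigma_algebra0. Qed.

Let rV_setC A : g_sigma_preimage coord A -> g_sigma_preimage coord (~` A).
Proof. exact: sigma_algebraC. Qed.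

Let rV_bigcup (F : _^nat) : (forall i, g_sigma_preimage coord (F i)) ->
  g_sigma_preimage coord (\bigcup_i (F i)).
Proof. exact: sigma_algebra_bigcup. Qed.

HB.instance Definition _ := @isMeasurable.Build rV_display
  'rV[R]_n (g_sigma_preimage coord) rV_set0 rV_setC rV_bigcup.

End measurable_rV.

Lemma measurable_coord (R : realType) n (i : 'I_n) :
  measurable_fun [set: 'rV[R]_n] (fun x => x ord0 i).
Proof.
move=> _ Y mY; rewrite setTI; apply: sub_sigma_algebra => /=.
rewrite -bigcup_seq/=; exists i => /=; first by rewrite mem_index_enum.
by exists Y => //; rewrite setTI.
Qed.

Lemma measurable_fun_rVP d (T : measurableType d) (R : realType) n
    (f : T -> 'rV[R]_n) :
  (forall i, measurable_fun [set: T] (fun x => f x ord0 i)) ->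
  measurable_fun [set: T] f.
Proof.
move=> mf.
have key : g_sigma_preimage (fun i (x : 'rV[R]_n) => x ord0 i) `<=`
    [set A | measurable (f @^-1` A)].
  apply: smallest_sub.
    split => /=.
    - by rewrite preimage_set0.
    - by move=> A mA; rewrite setTD preimage_setC; exact: measurableC.
    - by move=> F mF; rewrite preimage_bigcup; exact: bigcup_measurable.
  rewrite -bigcup_seq => A [i _ [B mB <-]] /=.
  by rewrite setTI; have := mf i measurableT B mB; rewrite setTI.
by move=> _ A mA; rewrite setTI; exact: key.
Qed.

Definition rV_cons (R : realType) (n : nat) (z : R * 'rV[R]_n) : 'rV[R]_n.+1 :=
  row_mx (z.1)%:M z.2 : 'rV[R]_(1 + n).

Section lebesgue_rV_succ.
Local Open Scope ereal_scope.
Context (R : realType) (n : nat).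

Lemma rV_cons0 (z : R * 'rV[R]_n) : rV_cons z ord0 ord0 = z.1.
Proof.
have e : @ord0 n = lshift n (@ord0 0) by exact: val_inj.
by rewrite e [LHS](@row_mxEl _ 1 1 n) mxE eqxx mulr1n.
Qed.

Lemma rV_consS (z : R * 'rV[R]_n) i : rV_cons z ord0 (lift ord0 i) = z.2 ord0 i.
Proof.
have e : lift ord0 i = rshift 1 i by exact: val_inj.
by rewrite e [LHS](@row_mxEr _ 1 1 n).
Qed.

Lemma measurable_rV_cons :
  measurable_fun [set: R * 'rV[R]_n] (@rV_cons R n).
Proof.
apply: measurable_fun_rVP => i.
have [->|[j ->]] : i = ord0 \/ exists j, i = lift ord0 j.
  by case: (unliftP ord0 i) => [j|] ->; [right; exists j|left].
- by under eq_fun do rewrite rV_cons0; exact: measurable_fst.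
- under eq_fun do rewrite rV_consS.
  exact: (measurableT_comp (measurable_coord j) measurable_snd).
Qed.

Variable mu : {sigma_finite_measure set 'rV[R]_n -> \bar R}.

Definition lebesgue_rV_succ : set 'rV[R]_n.+1 -> \bar R :=
  pushforward (@lebesgue_measure R \x mu) (@rV_cons R n).

Let lebesgue0 : lebesgue_rV_succ set0 = 0.
Proof. by rewrite /lebesgue_rV_succ /pushforward preimage_set0 measure0. Qed.

Let lebesgue_ge0 A : 0 <= lebesgue_rV_succ A.
Proof. by rewrite /lebesgue_rV_succ /pushforward; exact: measure_ge0. Qed.

Let lebesgue_sigma_additive : semi_sigma_additive lebesgue_rV_succ.
Proof.
move=> F mF tF mUF; rewrite /lebesgue_rV_succ /pushforward preimage_bigcup.
have mcons A : measurable A -> measurable (@rV_cons R n @^-1` A).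
  by move=> mA; rewrite -[X in measurable X]setTI; exact: measurable_rV_cons.
apply: measure_semi_sigma_additive.
- by move=> k; exact: mcons.
- apply/trivIsetP => /= i j _ _ ij; rewrite -preimage_setI.
  by move/trivIsetP : tF => /(_ _ _ _ _ ij) ->//; rewrite preimage_set0.
- by rewrite -preimage_bigcup; exact: mcons.
Qed.

HB.instance Definition _ := isMeasure.Build _ _ _ lebesgue_rV_succ
  lebesgue0 lebesgue_ge0 lebesgue_sigma_additive.

Let tail (x : 'rV[R]_n.+1) : 'rV[R]_n := \row_i x ord0 (lift ord0 i).

Let rV_consK (z : R * 'rV[R]_n) : tail (rV_cons z) = z.2.
Proof. by apply/rowP => i; rewrite mxE rV_consS. Qed.

Let measurable_tail : measurable_fun setT tail.
Proof.
apply: measurable_fun_rVP => i; under eq_fun do rewrite mxE.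
exact: measurable_coord.
Qed.

Let lebesgue_sigma_finite : sigma_finite setT lebesgue_rV_succ.
Proof.
have /sigma_finiteP[F [TF ndF Ffin]] := sigma_finiteT (@lebesgue_measure R).
have /sigma_finiteP[G [TG ndG Gfin]] := sigma_finiteT mu.
pose H k := [set x : 'rV[R]_n.+1 | F k (x ord0 ord0) /\ G k (tail x)].
have HFG k : @rV_cons R n @^-1` (H k) = F k `*` G k.
  by apply/seteqP; split => [[a b]|[a b]] /=; rewrite /H /= rV_cons0 rV_consK.
exists H.
  apply/esym; rewrite -subTset => x _.
  have : [set: R] (x ord0 ord0) by [].
  have : [set: 'rV[R]_n] (tail x) by [].
  rewrite TF TG => -[i _ Gi] [j _ Fj]; exists (maxn i j) => //; split.
    by move: Fj; exact/subsetPset/ndF/leq_maxr.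
  by move: Gi; exact/subsetPset/ndG/leq_maxl.
move=> k; have [mF Foo] := Ffin k; have [mG Goo] := Gfin k; split; last first.
  rewrite /lebesgue_rV_succ /pushforward HFG product_measure1E//.
  by rewrite lte_mul_pinfty// ge0_fin_numE.
rewrite /H -[X in measurable X]setTI; apply: measurableI => //.
apply: measurableI.
  by rewrite -[X in measurable X]setTI; exact: measurable_coord.
by rewrite -[X in measurable X]setTI; exact: measurable_tail.
Qed.

HB.instance Definition _ := Measure_isSigmaFinite.Build _ _ _ lebesgue_rV_succ
  lebesgue_sigma_finite.

End lebesgue_rV_succ.

(* Lebesgue measure on [R^n], as an iterated product measure: [R^(n+1)] is the
   image of [R x R^n] under [rV_cons]. *)
Section lebesgue_rV.
Local Open Scope ereal_scope.
Context (R : realType).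

Fixpoint lebesgue_rV (n : nat) : {sigma_finite_measure set 'rV[R]_n -> \bar R} :=
  if n is m.+1 then lebesgue_rV_succ (lebesgue_rV m) else dirac (0%R : 'rV[R]_0).

Lemma lebesgue_rV_rect n (A : 'I_n -> set R) : (forall i, measurable (A i)) ->
  lebesgue_rV n [set x : 'rV[R]_n | forall i, A i (x ord0 i)] =
  \prod_(i < n) lebesgue_measure (A i).
Proof.
elim: n A => [A _|n IH A mA].
  rewrite big_ord0 /= diracE mem_set//=; by case.
have mrect : measurable [set x : 'rV[R]_n | forall i, A (lift ord0 i) (x ord0 i)].
  rewrite [X in measurable X](_ : _ = \bigcap_(i in [set: 'I_n])
      ((fun x : 'rV[R]_n => x ord0 i) @^-1` A (lift ord0 i))).
    apply: fin_bigcap_measurable => // i _; rewrite -[X in measurable X]setTI.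
    by apply: measurable_coord => //; exact: mA.
  by apply/seteqP; split => x /= Ax i; [move=> _|]; exact: Ax.
rewrite big_ord_recl -(IH (fun i => A (lift ord0 i)))//.
transitivity ((@lebesgue_measure R \x lebesgue_rV n)
    (A ord0 `*` [set x : 'rV[R]_n | forall i, A (lift ord0 i) (x ord0 i)])); last first.
  by rewrite product_measure1E//; exact: mA.
rewrite /= /lebesgue_rV_succ /pushforward; congr (product_measure1 _ _ _).
apply/seteqP; split => [z /= Az|z /= [Az0 Az] i].
  split; first by have := Az ord0; rewrite rV_cons0.
  by move=> i; have := Az (lift ord0 i); rewrite rV_consS.
by case: (unliftP ord0 i) => [j|] ->; rewrite ?rV_consS ?rV_cons0.
Qed.

End lebesgue_rV.

Section function_spaces.
Context (R : realType).

(* [C^oo]: all iterated directional derivatives exist and are continuous *)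
Definition smooth (V : normedModType R) (phi : V -> R) : Prop :=
  forall vs : seq V,
    let psi := foldr (fun v (h : V -> R) => 'D_v h) phi vs in
    (forall x v, derivable psi x v) /\ continuous psi.

(* [C_c^oo(Omega)] *)
Definition test_function (V : normedModType R) (Omega : set V) (phi : V -> R)
    : Prop :=
  [/\ smooth phi, compact (closure [set x | phi x != 0]) &
      closure [set x | phi x != 0] `<=` Omega].

Context (n : nat).
Implicit Types f g : 'rV[R]_n -> R.
Local Notation mu := (lebesgue_rV R n).

(* Elements of the spaces [L^2] and [H^1] are represented by Borel
   representatives; every pointwise condition below is stated almost
   everywhere, so that nothing depends on the choice of representative. *)
Definition L2 f : Prop := f \in Lfun mu 2%:E.

Definition L2norm f : R := fine ('N[mu]_2%:E[EFin \o f])%E.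

Definition is_weak_partial (i : 'I_n) f g : Prop :=
  forall phi : 'rV[R]_n -> R, test_function setT phi ->
    \int[mu]_x (f x * 'D_(delta_mx ord0 i) phi x) = - \int[mu]_x (g x * phi x).

Definition H1 f : Prop :=
  L2 f /\ forall i, exists2 g, L2 g & is_weak_partial i f g.

(* the [i]-th weak partial derivative of [f], when [H1 f] *)
Definition weak_partial (i : 'I_n) f : 'rV[R]_n -> R :=
  xget (cst 0) [set g | L2 g /\ is_weak_partial i f g].

Definition H1norm f : R :=
  Num.sqrt (L2norm f ^+ 2 + \sum_(i < n) L2norm (weak_partial i f) ^+ 2).

(* support of the class of [f] modulo almost everywhere equality *)
Definition ess_support f : set 'rV[R]_n :=
  ~` \bigcup_(O in [set O : set 'rV[R]_n |
        open O /\ {ae mu, forall x, O x -> f x = 0}]) O.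

(* the norm of ['rV[R]_n] in the library is the sup norm *)
Definition euclidean_norm (x : 'rV[R]_n) : R :=
  Num.sqrt (\sum_(i < n) x ord0 i ^+ 2).

Definition continuous_curve (N : ('rV[R]_n -> R) -> R) (I : set R)
    (u : R -> 'rV[R]_n -> R) : Prop :=
  forall t, I t -> N (u s \- u t) @[s --> within I (nbhs t)] --> 0.

(* [v] is the derivative of the curve [u] for the norm [N] *)
Definition derivative_curve (N : ('rV[R]_n -> R) -> R) (I : set R)
    (u v : R -> 'rV[R]_n -> R) : Prop :=
  forall t, I t ->
    N (fun x => (u s x - u t x) / (s - t) - v t x)
      @[s --> within I t^'] --> 0.

End function_spaces.

Section wave_equation.
Context (R : realType) (n : nat).
Implicit Types (p eps rho : R) (T : \bar R) (f g : 'rV[R]_n -> R).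
Implicit Types (u v : R -> 'rV[R]_n -> R) (phi : 'rV[R]_n * R -> R).

Definition spacetime_lebesgue : {measure set ('rV[R]_n * measurableTypeR R) -> \bar R} :=
  (lebesgue_rV R n \x @lebesgue_measure R)%E.

Definition slab T : set ('rV[R]_n * R) := [set z | 0 < z.2 /\ (z.2%:E < T)%E].

Definition time_interval T : set R := [set t | 0 <= t /\ (t%:E < T)%E].

Definition dt phi : 'rV[R]_n * R -> R := 'D_((0 : 'rV[R]_n), 1 : R) phi.

Definition dx (i : 'I_n) phi : 'rV[R]_n * R -> R :=
  'D_((delta_mx ord0 i : 'rV[R]_n), 0 : R) phi.

Definition wave_op phi : 'rV[R]_n * R -> R :=
  fun z => dt (dt phi) z - \sum_(i < n) dx i (dx i phi) z.

Definition locally_integrable_on (Omega : set ('rV[R]_n * R))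
    (w : 'rV[R]_n * R -> R) : Prop :=
  forall K, compact K -> K `<=` Omega ->
    spacetime_lebesgue.-integrable K (EFin \o w).

(* [u_tt - Laplacian u = |u|^p] in the sense of distributions on
   [R^n x (0, T)]; as [p >= 1], local integrability of [|u|^p] implies that of
   [u], so that both sides are distributions. *)
Definition distributional_wave p T u : Prop :=
  locally_integrable_on (slab T) (fun z => `|u z.2 z.1| `^ p) /\
  forall phi, test_function (slab T) phi ->
    \int[spacetime_lebesgue]_(z in slab T) (u z.2 z.1 * wave_op phi z) =
    \int[spacetime_lebesgue]_(z in slab T) (`|u z.2 z.1| `^ p * phi z).

(* [u] is a weak solution on [[0, T)] with data [(f, g)] and [v = u_t], in the
   class [(u, u_t) \in C([0, T), H^1 x L^2)]. *)
Record weak_solution p T f g u v : Prop := WeakSolution {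
  sol_time_gt0 : (0 < T)%E ;
  sol_measurable : measurable_fun (setT `*` time_interval T)
    (fun z : 'rV[R]_n * R => u z.2 z.1) ;
  sol_init : {ae lebesgue_rV R n, forall x, u 0 x = f x} ;
  sol_init_t : {ae lebesgue_rV R n, forall x, v 0 x = g x} ;
  sol_H1 : forall t, time_interval T t -> H1 (u t) ;
  sol_L2 : forall t, time_interval T t -> L2 (v t) ;
  sol_continuous : continuous_curve (@H1norm R n) (time_interval T) u ;
  sol_continuous_t : continuous_curve (@L2norm R n) (time_interval T) v ;
  sol_derivative : derivative_curve (@L2norm R n) (time_interval T) u v ;
  sol_equation : distributional_wave p T u }.

(* support of [(u, u_t)], as a subset of [R^n x [0, T)] *)
Definition support_curve T u v : set ('rV[R]_n * R) :=
  [set z | time_interval T z.2 /\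
           (ess_support (u z.2) `|` ess_support (v z.2)) z.1].

Definition light_cone rho : set ('rV[R]_n * R) :=
  [set z | 0 <= z.2 /\ euclidean_norm z.1 <= z.2 + rho].

Definition lifespan p f g eps : \bar R :=
  ereal_sup [set t%:E | t in [set t | 0 < t /\ exists u v,
    weak_solution p t%:E (fun x => eps * f x) (fun x => eps * g x) u v]].

End wave_equation.

Definition gamma_poly (R : realType) (p : R) (n : nat) : R :=
  2 + (n%:R + 1) * p - (n%:R - 1) * p ^+ 2.

Definition strauss_exponent (R : realType) (n : nat) : R :=
  (n%:R + 1 + Num.sqrt (n%:R ^+ 2 + 10 * n%:R - 7)) / (2 * (n%:R - 1)).

(* Main.v *)
(** The test-function method.  On the cone [|x| <= t + rho] put
    [tau = t + rho + 1] and [q = tau^2 - |x|^2 >= 1].  Two solutions of the free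
    wave equation are positive there: [Phi0 = 1] and
    [Phi1 = tau * q^(-(n+1)/2)].  Testing the equation with [Phi_i(x, t) psi(t)],
    where the cutoff [psi] falls from [1] to [0] on [[S/2, S]], gives
    [int |u|^p Phi_i psi + c_i I <= int u (psi'' Phi_i + 2 psi' dt Phi_i)]
    with [I = eps * int g]: the boundary terms at [t = 0] have the right sign as
    [dt Phi_i <= 0 <= f, g].  With [Phi0], Young's inequality bounds
    [Y = int |u|^p psi] by [C S^(n + 1 - 2 p')], [p' = p / (p - 1)].  With
    [Phi1], which decays like [tau^(1-m) (tau - |x|)^(-m)], [m = (n+1)/2], it
    gives [I <= C (lam^p Y + lam^(-p') S^(n - m p'))] for every [lam > 0].
    Choosing [lam] as a power of [S] to balance the two terms gives
    [eps <= C S^(- gamma(p, n) / (2 p (p - 1)))] for every [S] below the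
    lifespan. *)
Require Import Defs.
From HB Require Import structures.
From mathcomp Require Import all_boot all_order all_algebra.
From mathcomp Require Import all_classical all_reals all_analysis.
From mathcomp Require Import measurable_realfun.
From mathcomp Require Import ring lra.
Set Implicit Arguments.
Unset Strict Implicit.
Unset Printing Implicit Defensive.
Import Order.TTheory GRing.Theory Num.Theory.
Import numFieldNormedType.Exports.
Local Open Scope classical_set_scope.
Local Open Scope ring_scope.

(** * Smooth elementary functions *)

Section chain_rule.
Context {R : realType} {V : normedModType R}.

(** The obstacle is the initial time: the weak equation admits only test functions supported in
    [t > 0], so it does not see the data. A second cutoff [rise d], zero for [t <= 2 d], is
    inserted, and the data come back because [v] is the [L^2] derivative of [u] at 0, so that
    [u = u0 + t v0 + o(t)]. Since [rise''] has size [d^-2] and lives on a time window of length [d],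
    the term [o(t)] contributes [o(1)]. Half of the data term pays for it, and all later constants
    are independent of [d], so [d] is fixed small and no limit is taken.

    The multipliers solve the wave equation near the cone only. They are powers of [q] cut to zero
    for [q <= 1/2], which gives compact supports; the extra 1 in [tau] makes [q >= 1] on the cone,
    out of reach of that cut.

    Test functions must have all iterated derivatives, so every function used is built inside a
    class closed under differentiation.

    In the estimate with [Phi1], integrating the weight in time first costs [S^n] and not the full
    volume [S^(n + 1)]; the exponent [gamma(p, n)] depends on this gain. *)

Lemma is_derive_along (f : V -> R) (x v : V) (df : R) :
  is_derive x v f df <-> is_derive (0 : R) 1 (fun h : R => f (h *: v + x)) df.
Proof.
have E : (fun h : R => h^-1 *: ((f \o shift x) (h *: v) - f x)) =
    (fun h : R => h^-1 *: (((fun h : R => f (h *: v + x)) \o shift 0) (h *: 1)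
                  - (fun h : R => f (h *: v + x)) 0)).
  by rewrite funeqE => h /=; rewrite addr0 scale0r add0r [_%:A]mulr1.
split=> -[df1 df2].
- by apply: DeriveDef; [exact: (derivable1P f x v).1|rewrite /derive -E].
- by apply: DeriveDef; [exact: (derivable1P f x v).2|rewrite /derive E].
Qed.

Lemma is_derive_comp (f : V -> R) (g : R -> R) (x v : V) (df dg : R) :
  is_derive (f x) 1 g dg -> is_derive x v f df ->
  is_derive x v (fun y => g (f y)) (dg * df).
Proof.
move=> hg /is_derive_along hf; apply/is_derive_along.
by apply: (@is_derive1_comp R g) => //; rewrite scale0r add0r.
Qed.

End chain_rule.

Section flat.
Context {R : realType}.
Implicit Types P : {poly R}.

(** A family indexed by polynomials in [1/x], rather than [exp (-1/x)] alone: it is stable under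
    differentiation and under division by [x], so smoothness at 0 needs a single limit. *)
Definition flat P (x : R) : R := if 0 < x then P.[x^-1] * expR (- x^-1) else 0.

Lemma flat_le0 P x : x <= 0 -> flat P x = 0.
Proof. by rewrite /flat leNgt => /negbTE ->. Qed.

Lemma flat_gt0 P x : 0 < x -> flat P x = P.[x^-1] * expR (- x^-1).
Proof. by rewrite /flat => ->. Qed.

Lemma flat_mulX P x : flat ('X * P) x = x^-1 * flat P x.
Proof.
by rewrite /flat; case: ifP => x0; rewrite ?mulr0// hornerM hornerX mulrA.
Qed.

(** With [y = 1/x], the Taylor bound [y^(N+1) <= (N+1)! exp y] has one power of [y] more than the
    size [N] of [P] requires, which leaves the factor [x]. *)
Lemma flat_bound P : exists C : R, forall x, `|flat P x| <= C * `|x|.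
Proof.
pose N := size P; exists ((\sum_(i < N) `|P`_i|) * N.+1`!%:R * 1 + (\sum_(i < N) `|P`_i|)).
set C0 := \sum_(i < N) _.
have C00 : 0 <= C0 by exact: sumr_ge0.
move=> x; have [x0|x0] := leP x 0.
  by rewrite flat_le0// normr0 mulr_ge0// mulr1 addr_ge0// mulr_ge0.
rewrite flat_gt0// normrM [X in _ * X]ger0_norm ?expR_ge0// (gtr0_norm x0).
set y := x^-1; have y0 : 0 < y by rewrite invr_gt0.
have Py : `|P.[y]| <= C0 * (1 + y ^+ N).
  rewrite horner_coef (le_trans (ler_norm_sum _ _ _))// /C0 mulr_suml.
  apply: ler_sum => i _; rewrite normrM ler_wpM2l// normrX (gtr0_norm y0).
  have [y1|y1] := leP y 1.
    by rewrite (le_trans (exprn_ile1 _ (ltW y0) y1))// lerDl exprn_ge0// ltW.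
  rewrite (@le_trans _ _ (y ^+ N))//; last by rewrite lerDr.
  by rewrite ler_eXn2l// ltnW.
have e1 : expR (- y) * y ^+ N <= N.+1`!%:R * x.
  rewrite expRN ler_pdivrMl ?expR_gt0//.
  have := expR_ge1Dxn N (ltW y0); set f := N.+1`!%:R => h.
  have f0 : 0 < f by rewrite ltr0n fact_gt0.
  have : y ^+ N.+1 <= expR y * f.
    by rewrite -ler_pdivrMr//; apply: le_trans h; rewrite lerDr.
  rewrite -(ler_pM2r x0) exprSr -mulrA [y * x]mulVf ?mulr1 ?gt_eqF// => /le_trans; apply.
  by rewrite mulrA.
have e2 : expR (- y) <= x.
  rewrite expRN -[leRHS]invrK -/y lef_pV2 ?posrE ?expR_gt0//.
  by rewrite (le_trans _ (expR_ge1Dx _))// lerDr.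
rewrite (le_trans (ler_wpM2r (expR_ge0 _) Py))// mulr1 -mulrA.
rewrite mulrDl mul1r [y ^+ N * _]mulrC mulrDl mulrDr addrC lerD//.
  by rewrite -mulrA ler_wpM2l.
by rewrite ler_wpM2l.
Qed.

Lemma flat_cvg0 P : flat P x @[x --> 0] --> 0.
Proof.
have [C hC] := flat_bound P.
apply/cvgr0Pnorm_le => e e0; near=> x.
rewrite (le_trans (hC x))//.
have C1 : 0 < `|C| + 1 by rewrite ltr_wpDl.
rewrite (@le_trans _ _ ((`|C| + 1) * `|x|))//.
  by rewrite ler_wpM2r// (le_trans (ler_norm C))// lerDl.
rewrite -ler_pdivlMl// mulrC; near: x.
by apply: cvgr0_norm_le; [exact: cvg_id|rewrite divr_gt0].
Unshelve. all: by end_near. Qed.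

(** From [(P(1/x) exp(-1/x))' = x^-2 (P - P')(1/x) exp(-1/x)] for [x > 0]. *)
Definition flatD P : {poly R} := 'X * ('X * (P - P^`())).

Lemma is_derive_flat P (x : R) : is_derive x (1 : R) (flat P) (flat (flatD P) x).
Proof.
have [x0|x0|->] := ltgtP x 0.
- rewrite (flat_le0 (flatD P) (ltW x0)).
  apply: (@near_eq_is_derive _ _ _ (cst (0 : R) : R -> R)).
    by near=> y; rewrite flat_le0//; near: y; exact: lt_le_nbhsl.
- rewrite (flat_gt0 (flatD P) x0).
  apply: (@near_eq_is_derive _ _ _ (fun y : R => P.[y^-1] * expR (- y^-1) : R)).
    near=> y; rewrite flat_gt0//; near: y; exact: lt_nbhsr.
  have dV : is_derive x (1 : R) (fun y : R => y^-1) (- x ^- 2 * 1).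
    have xn : x != 0 by rewrite gt_eqF.
    apply: DeriveDef; first by apply: (@derivableV _ _ id).
    by rewrite (@deriveV _ _ id)// derive_id /GRing.scale/=.
  have := @is_deriveM _ _ (fun y : R => P.[y^-1]) (fun y : R => expR (- y^-1) : R) x 1 _ _
     (is_derive_comp (is_derive_poly P x^-1) dV)
     (is_derive_comp (is_derive_expR _) (is_deriveN dV)).
  move=> H; apply: (is_derive_eq H).
  rewrite /GRing.scale/= !hornerM !hornerX hornerD hornerN.
  by rewrite [(- _) x]/= -exprVn; ring.
- rewrite [X in is_derive _ _ _ X]flat_le0//.
  (* At 0 the difference quotient is [flat P h / h], again a member of the family, so it tends to
     0. *)
  have E : (fun h : R => h^-1 *: ((flat P \o shift 0) (h *: 1) - flat P 0)) =
      flat ('X * P).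
    rewrite funeqE => h /=; rewrite addr0 [_%:A]mulr1 (@flat_le0 P 0)// subr0.
    by rewrite flat_mulX.
  have c : flat ('X * P) h @[h --> 0^'] --> 0.
    by apply: cvg_trans (flat_cvg0 _); exact: cvg_app (cvg_within _).
  apply: DeriveDef.
    by rewrite /derivable E; apply/cvg_ex; exists 0.
  by rewrite /derive E; apply: cvg_lim.
Unshelve. all: by end_near. Qed.

End flat.

(* The base functions are closed under directional derivatives, so that every
   member of the class is smooth. *)
Inductive elem_smooth {R : realType} {V : normedModType R} : (V -> R) -> Prop :=
| es_cst c : elem_smooth (fun=> c)
| es_lin (l : V -> R^o) : linear l -> continuous l -> elem_smooth l
| es_add f g : elem_smooth f -> elem_smooth g -> elem_smooth (fun x => f x + g x)
| es_mul f g : elem_smooth f -> elem_smooth g -> elem_smooth (fun x => f x * g x)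
| es_powR a f : (forall x, 0 < f x) -> elem_smooth f ->
    elem_smooth (fun x => f x `^ a)
| es_flat P f : elem_smooth f -> elem_smooth (fun x => flat P (f x)).

Section elem_smooth_theory.
Context {R : realType} {V : normedModType R}.
Implicit Types f g : V -> R.

Lemma es_differentiable f : elem_smooth f -> forall x, differentiable f x.
Proof.
elim=> {f}.
- by move=> c x; exact: differentiable_cst.
- move=> l ll cl x.
  pose L : {linear V -> R^o} := HB.pack l (GRing.isLinear.Build _ _ _ _ _ ll).
  exact: (@linear_differentiable _ _ _ L).
- by move=> f g _ hf _ hg x; exact: differentiableD.
- by move=> f g _ hf _ hg x; exact: differentiableM.
- move=> a f f0 _ hf x.
  apply: (@differentiable_comp _ _ _ _ f (fun y => y `^ a)) => //.
  by apply/derivable1_diffP; apply: ex_derive; exact: is_derive1_powR.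
- move=> P f _ hf x.
  apply: (@differentiable_comp _ _ _ _ f (flat P)) => //.
  by apply/derivable1_diffP; apply: ex_derive; exact: is_derive_flat.
Qed.

Lemma es_derivable f x v : elem_smooth f -> derivable f x v.
Proof. by move=> hf; apply/diff_derivable/es_differentiable. Qed.

Lemma es_continuous f : elem_smooth f -> continuous f.
Proof. by move=> hf x; apply/differentiable_continuous/es_differentiable. Qed.

Lemma es_opp f : elem_smooth f -> elem_smooth (fun x => - f x).
Proof.
move=> hf; have -> : (fun x => - f x) = (fun x => -1 * f x).
  by apply/funext => x; rewrite mulN1r.
by apply: es_mul => //; exact: es_cst.
Qed.

Lemma es_sub f g : elem_smooth f -> elem_smooth g ->
  elem_smooth (fun x => f x - g x).
Proof. by move=> hf hg; apply: es_add => //; exact: es_opp. Qed.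

Lemma es_exp f k : elem_smooth f -> elem_smooth (fun x => f x ^+ k).
Proof.
move=> hf; elim: k => [|k IH].
  have -> : (fun x => f x ^+ 0) = (fun=> 1) by apply/funext => x; rewrite expr0.
  exact: es_cst.
have -> : (fun x => f x ^+ k.+1) = (fun x => f x * f x ^+ k).
  by apply/funext => x; rewrite exprS.
exact: es_mul.
Qed.

Lemma es_sum n (f : 'I_n -> V -> R) : (forall i, elem_smooth (f i)) ->
  elem_smooth (fun x => \sum_(i < n) f i x).
Proof.
elim: n f => [|n IH] f hf.
  have -> : (fun x => \sum_(i < 0) f i x) = (fun=> 0).
    by apply/funext => x; rewrite big_ord0.
  exact: es_cst.
have -> : (fun x => \sum_(i < n.+1) f i x) =
   (fun x => \sum_(i < n) f (widen_ord (leqnSn n) i) x + f ord_max x).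
  by apply/funext => x; rewrite big_ord_recr.
by apply: es_add => //; exact: IH.
Qed.

Lemma es_is_derive f x v : elem_smooth f -> is_derive x v f ('D_v f x).
Proof. by move=> hf; apply/derivableP/es_derivable. Qed.

Lemma es_derive f v : elem_smooth f -> elem_smooth ('D_v f).
Proof.
elim=> {f}.
- move=> c; have -> : 'D_v (fun=> c) = (fun=> 0 : R) :> (V -> R).
    by apply/funext => x; exact: derive_cst.
  exact: es_cst.
- move=> l ll cl.
  pose L : {linear V -> R^o} := HB.pack l (GRing.isLinear.Build _ _ _ _ _ ll).
  have -> : 'D_v l = (fun=> l v).
    apply/funext => x; rewrite (@deriveE _ _ _ L) ?diff_lin//.
    exact: linear_differentiable.
  exact: es_cst.
- move=> f g hf df hg dg.
  have -> : 'D_v (fun x => f x + g x) = (fun x => 'D_v f x + 'D_v g x).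
    by apply/funext => x; apply: (@deriveD _ _ _ f g); exact: es_derivable.
  exact: es_add.
- move=> f g hf df hg dg.
  have -> : 'D_v (fun x => f x * g x) =
      (fun x => f x * 'D_v g x + g x * 'D_v f x).
    by apply/funext => x; apply: (@deriveM _ _ f g); exact: es_derivable.
  by apply: es_add; exact: es_mul.
- move=> a f f0 hf df.
  have -> : 'D_v (fun x => f x `^ a) = (fun x => a * f x `^ (a - 1) * 'D_v f x).
    apply/funext => x.
    have [_ ->//] := is_derive_comp
      (is_derive1_powR a (f0 x)) (es_is_derive x v hf).
  by apply: es_mul => //; apply: es_mul; [exact: es_cst|exact: es_powR].
- move=> P f hf df.
  have -> : 'D_v (fun x => flat P (f x)) = (fun x => flat (flatD P) (f x) * 'D_v f x).
    apply/funext => x.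
    have [_ ->//] := is_derive_comp
      (is_derive_flat P (f x)) (es_is_derive x v hf).
  by apply: es_mul => //; exact: es_flat.
Qed.

Lemma es_smooth f : elem_smooth f -> smooth f.
Proof.
move=> hf vs.
have hpsi : elem_smooth (foldr (fun v (h : V -> R) => 'D_v h) f vs).
  by elim: vs => //= v vs; exact: es_derive.
by split=> [x v|]; [exact: es_derivable|exact: es_continuous].
Qed.

End elem_smooth_theory.

Lemma es_id {R : realType} : elem_smooth (fun x : R => x).
Proof. by apply: (@es_lin R R^o id) => // x; exact: cvg_id. Qed.

Lemma es_comp {R : realType} {V : normedModType R} (h : R -> R) (f : V -> R) :
  elem_smooth h -> elem_smooth f -> elem_smooth (fun x => h (f x)).
Proof.
move=> hh hf; elim: hh => {h}.
- by move=> c; exact: es_cst.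
- move=> l ll _; have -> : (fun x => l (f x)) = (fun x => l 1 * f x).
    pose L : {linear R -> R^o} := HB.pack l (GRing.isLinear.Build _ _ _ _ _ ll).
    apply/funext => x; rewrite -[X in l X](mulr1 (f x)).
    have E : l (f x *: (1 : R)) = f x *: l 1 := linearZZ L (f x) 1.
    by rewrite -[f x * 1]/(f x *: (1 : R)) E mulrC.
  by apply: es_mul => //; exact: es_cst.
- by move=> g h _ hg _ hh; exact: es_add.
- by move=> g h _ hg _ hh; exact: es_mul.
- by move=> a g g0 _ hg; exact: es_powR.
- by move=> P g _ hg; exact: es_flat.
Qed.

(** * A smooth monotone step *)

Definition bump {R : realType} (x : R) : R := flat 1 x.

(** The usual smooth transition from 0 on [x <= 0] to 1 on [1 <= x]. The quotient is a power [-1] of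
    a positive function, the form that [elem_smooth] accepts. *)
HB.lock Definition step {R : realType} (x : R) : R :=
  bump x * (bump x + bump (1 - x)) `^ (-1).

Section step.
Context {R : realType}.
Implicit Types x s t : R.

Lemma flat_ge0 (P : {poly R}) x : (forall y, 0 <= y -> 0 <= P.[y]) -> 0 <= flat P x.
Proof.
move=> P0; have [x0|x0] := leP x 0; first by rewrite flat_le0.
by rewrite flat_gt0// mulr_ge0 ?expR_ge0// P0// invr_ge0 ltW.
Qed.

Lemma bump_ge0 x : 0 <= bump x.
Proof. by apply: flat_ge0 => y _; rewrite hornerC. Qed.

Lemma bump_gt0 x : 0 < x -> 0 < bump x.
Proof. by move=> x0; rewrite /bump flat_gt0// hornerC mul1r expR_gt0. Qed.

Lemma step_den_gt0 x : 0 < bump x + bump (1 - x).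
Proof.
have [x0|x0] := leP x 0.
  by rewrite ltr_wpDl ?bump_ge0// bump_gt0//; lra.
by rewrite ltr_wpDr ?bump_ge0// bump_gt0.
Qed.

Lemma step_divE x : step x = bump x / (bump x + bump (1 - x)).
Proof. by rewrite unlock powR_inv1// ltW// step_den_gt0. Qed.

Lemma es_affine (a b : R) : elem_smooth (fun x : R => a * x + b).
Proof. by apply: es_add (es_cst _); apply: es_mul es_id; exact: es_cst. Qed.

Lemma es_bump : elem_smooth (@bump R).
Proof. exact: es_flat es_id. Qed.

Lemma es_step : elem_smooth (@step R).
Proof.
have -> : @step R = fun x => bump x * (bump x + bump (1 - x)) `^ (-1).
  by apply/funext => x; rewrite unlock.
apply: es_mul; first exact: es_bump.
apply: es_powR; first exact: step_den_gt0.
apply: es_add; first exact: es_bump.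
have -> : (fun x => bump (1 - x)) = (fun x => bump (-1 * x + 1)).
  by apply/funext => x; congr bump; ring.
exact: (es_comp es_bump (es_affine _ _)).
Qed.

Lemma step_le0 x : x <= 0 -> step x = 0.
Proof. by move=> x0; rewrite unlock /bump flat_le0// mul0r. Qed.

Lemma step_ge1 x : 1 <= x -> step x = 1.
Proof.
move=> x1; rewrite step_divE [X in _ + X]flat_le0 ?addr0; last by lra.
by rewrite divff// gt_eqF// bump_gt0//; lra.
Qed.

Lemma step_ge0 x : 0 <= step x.
Proof. by rewrite unlock mulr_ge0 ?powR_ge0// bump_ge0. Qed.

Lemma step_le1 x : step x <= 1.
Proof.
by rewrite step_divE ler_pdivrMr ?step_den_gt0// mul1r lerDl bump_ge0.
Qed.

Lemma es_derive1 (g : R -> R) : elem_smooth g -> elem_smooth (derive1 g).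
Proof.
move=> /(es_derive (1 : R)).
by have -> : derive1 g = 'D_1 g by apply/funext => x; rewrite derive1E.
Qed.

Lemma es_is_derive1 (g : R -> R) x : elem_smooth g -> is_derive x 1 g (derive1 g x).
Proof. by move=> hg; rewrite derive1E; exact: es_is_derive. Qed.

Lemma derive1_val (g : R -> R) x (d : R) : is_derive x 1 g d -> derive1 g x = d.
Proof. by move=> [_ <-]; rewrite derive1E. Qed.

(** The quotient rule leaves [bump x * bump' (1 - x) + bump (1 - x) * bump' x] over a square, and
    [bump'] is nonnegative because [flatD 1] is ['X ^ 2]. This monotonicity fixes the sign of the
    data terms at the initial time. *)
Lemma step_derive_ge0 x : 0 <= derive1 (@step R) x.
Proof.
have dB : is_derive x 1 bump (flat (flatD 1) x) by exact: is_derive_flat.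
have dC : is_derive x 1 (fun y => bump (1 - y)) (flat (flatD 1) (1 - x) * -1).
  apply: (@is_derive_comp R R (fun y : R => 1 - y) bump); first exact: is_derive_flat.
  by apply: is_derive_eq; rewrite add0r mul1r.
have e0 y : 0 <= flat (flatD 1) y :> R.
  apply: flat_ge0 => z z0.
  by rewrite /flatD -polyC1 derivC subr0 polyC1 mulr1 hornerM hornerX mulr_ge0.
have E : @step R = (fun y => bump y * (bump y + bump (1 - y))^-1).
  by apply/funext => y; exact: step_divE.
have dn : bump x + bump (1 - x) != 0 by rewrite gt_eqF// step_den_gt0.
have dD : is_derive x 1 (fun y => bump y + bump (1 - y))
   (flat (flatD 1) x + flat (flatD 1) (1 - x) * -1) by exact: is_deriveD.
have dV : is_derive x 1 (fun y => (bump y + bump (1 - y))^-1)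
   (- (bump x + bump (1 - x)) ^- 2 * (flat (flatD 1) x + flat (flatD 1) (1 - x) * -1)).
  by have [h1 <-] := dD; apply: DeriveDef; [exact: derivableV|exact: deriveV].
have /derive1_val := is_deriveM dB dV.
rewrite -[X in derive1 X]/(fun y => bump y * (bump y + bump (1 - y))^-1) -E => ->.
rewrite /GRing.scale/=.
rewrite -[leRHS](@mulfVK _ ((bump x + bump (1 - x)) ^+ 2)) ?expf_neq0//.
rewrite mulr_ge0 ?sqr_ge0//.
set a := flat _ x; set b := flat _ (1 - x).
have -> : (bump x * (- (bump x + bump (1 - x)) ^- 2 * (a + b * -1)) +
   (bump x + bump (1 - x))^-1 * a) / (bump x + bump (1 - x)) ^+ 2 =
   (bump x * b + bump (1 - x) * a) / ((bump x + bump (1 - x)) ^+ 2) ^+2 by field.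
by rewrite divr_ge0 ?sqr_ge0// addr_ge0// mulr_ge0 ?bump_ge0 ?e0.
Qed.

Lemma continuous_bounded_itv (g : R -> R) (a b : R) : a <= b -> continuous g ->
  exists2 M, 0 < M & forall x, a <= x <= b -> `|g x| <= M.
Proof.
move=> ab cg.
have cn : {within `[a, b], continuous (fun x => `|g x|)}.
  by apply: continuous_subspaceT => x; apply: continuous_comp;
    [exact: cg|exact: norm_continuous].
have [c _ hc] := EVT_max ab cn.
exists (`|g c| + 1); first by rewrite ltr_wpDl.
by move=> x xab; rewrite (le_trans (hc x _))// ?lerDl// in_itv.
Qed.

Lemma derive1_locally_cst (g : R -> R) (x c : R) : (\near x, g x = c) -> derive1 g x = 0.
Proof.
move=> gc; rewrite derive1E.
rewrite (@near_eq_derive _ _ _ g (cst c) x 1)//; exact: derive_cst.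
Qed.

Lemma step_derive_lt0 x : x < 0 -> derive1 (@step R) x = 0.
Proof.
move=> x0; apply: (@derive1_locally_cst _ _ 0); near=> y.
by rewrite step_le0//; near: y; exact: lt_le_nbhsl.
Unshelve. all: by end_near. Qed.

Lemma step_derive_gt1 x : 1 < x -> derive1 (@step R) x = 0.
Proof.
move=> x0; apply: (@derive1_locally_cst _ _ 1); near=> y.
by rewrite step_ge1//; near: y; exact: lt_le_nbhsr.
Unshelve. all: by end_near. Qed.

Lemma step_derive2_lt0 x : x < 0 -> derive1 (derive1 (@step R)) x = 0.
Proof.
move=> x0; apply: (@derive1_locally_cst _ _ 0); near=> y.
by rewrite step_derive_lt0//; near: y; exact: lt_nbhsl.
Unshelve. all: by end_near. Qed.

Lemma step_derive2_gt1 x : 1 < x -> derive1 (derive1 (@step R)) x = 0.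
Proof.
move=> x0; apply: (@derive1_locally_cst _ _ 0); near=> y.
by rewrite step_derive_gt1//; near: y; exact: lt_nbhsr.
Unshelve. all: by end_near. Qed.

Lemma step_derive_bounded :
  exists2 M : R, 0 < M & forall x, `|derive1 (@step R) x| <= M /\
    `|derive1 (derive1 (@step R)) x| <= M.
Proof.
have c1 := es_continuous (es_derive1 es_step).
have c2 := es_continuous (es_derive1 (es_derive1 es_step)).
have [M1 M10 h1] := continuous_bounded_itv ler01 c1.
have [M2 M20 h2] := continuous_bounded_itv ler01 c2.
exists (M1 + M2); first exact: addr_gt0.
move=> x; have [x0|x0] := ltP x 0.
  by rewrite step_derive_lt0// step_derive2_lt0// normr0 addr_ge0// ltW.
have [x1|x1] := ltP 1 x.
  by rewrite step_derive_gt1// step_derive2_gt1// normr0 addr_ge0// ltW.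
split.
- by rewrite (le_trans (h1 x _)) ?x0// lerDl ltW.
- by rewrite (le_trans (h2 x _)) ?x0// lerDr ltW.
Qed.

End step.

(** * Functions of time and of the Lorentz form *)

Section wave_test_functions.
Context {R : realType} {n : nat}.
Variable a : R.
Local Notation V := ('rV[R]_n * R)%type.
Implicit Types (z v : V) (h eta : R -> R).

Definition sqnorm (x : 'rV[R]_n) : R := \sum_(i < n) x ord0 i ^+ 2.

Definition cone_form (z : V) : R := (z.2 + a) ^+ 2 - sqnorm z.1.

Lemma linear_is_derive (l : V -> R^o) z v : linear l -> continuous l ->
  is_derive z v l (l v).
Proof.
move=> ll cl.
pose L : {linear V -> R^o} := HB.pack l (GRing.isLinear.Build _ _ _ _ _ ll).
have dL := @linear_differentiable _ _ _ L z cl.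
apply: DeriveDef; first exact: diff_derivable.
by rewrite (@deriveE _ _ _ L)// diff_lin.
Qed.

Lemma time_linear : linear (fun z : V => z.2 : R^o).
Proof. by []. Qed.

Lemma time_continuous : continuous (fun z : V => z.2 : R^o).
Proof. by move=> z; exact: cvg_snd. Qed.

Lemma coord_linear i : linear (fun z : V => z.1 ord0 i : R^o).
Proof. by move=> k x y /=; rewrite !mxE. Qed.

Lemma coord_prod_continuous i : continuous (fun z : V => z.1 ord0 i : R^o).
Proof.
move=> z; apply: (@continuous_comp _ _ _ fst (fun x : 'rV[R]_n => x ord0 i)).
  exact: cvg_fst.
exact: coord_continuous.
Qed.

Lemma es_time : elem_smooth (fun z : V => z.2).
Proof. exact: (es_lin time_linear time_continuous). Qed.

Lemma es_coord i : elem_smooth (fun z : V => z.1 ord0 i).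
Proof. exact: (es_lin (coord_linear i) (@coord_prod_continuous i)). Qed.

Lemma es_cone_form : elem_smooth cone_form.
Proof.
apply: es_sub.
  by apply: es_exp; apply: es_add; [exact: es_time|exact: es_cst].
by apply: es_sum => i; apply: es_exp; exact: es_coord.
Qed.

Lemma is_derive_time z v : is_derive z v (fun z : V => z.2) v.2.
Proof. exact: (linear_is_derive z v time_linear time_continuous). Qed.

Lemma is_derive_coord z v i : is_derive z v (fun z : V => z.1 ord0 i) (v.1 ord0 i).
Proof. exact: (linear_is_derive z v (coord_linear i) (@coord_prod_continuous i)). Qed.

Lemma is_derive_sqr (f : V -> R) z v df : is_derive z v f df ->
  is_derive z v (fun z => f z ^+ 2) (2 * f z * df).
Proof.
move=> hf; apply: (@is_derive_comp _ _ f (fun y => y ^+ 2)) => //.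
by apply: is_derive_eq; rewrite /GRing.scale/=; ring.
Qed.

Lemma is_derive_cone_form z v : is_derive z v cone_form
  (2 * (z.2 + a) * v.2 - \sum_(i < n) 2 * z.1 ord0 i * v.1 ord0 i).
Proof.
have -> : cone_form = (fun z : V => (z.2 + a) ^+ 2) -
    \sum_(i < n) (fun z : V => z.1 ord0 i ^+ 2).
  by apply/funext => y; rewrite /cone_form/sqnorm !fctE fct_sumE.
apply: is_deriveB.
  apply: is_derive_sqr; rewrite -[v.2]addr0.
  by apply: is_deriveD; exact: is_derive_time.
by apply: is_derive_sum => i; apply: is_derive_sqr; exact: is_derive_coord.
Qed.

Definition cone_test eta h : V -> R := fun z => eta z.2 * h (cone_form z).

Lemma es_cone_test eta h : elem_smooth eta -> elem_smooth h ->
  elem_smooth (cone_test eta h).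
Proof.
move=> he hh; apply: es_mul; first exact: es_comp he es_time.
exact: es_comp hh es_cone_form.
Qed.

Lemma dt_cone_test eta h : elem_smooth eta -> elem_smooth h ->
  dt (cone_test eta h) = cone_test (derive1 eta) h +
    cone_test (fun t => 2 * (t + a) * eta t) (derive1 h).
Proof.
move=> he hh; apply/funext => z; rewrite !fctE /dt.
have d1 : is_derive z ((0 : 'rV[R]_n), 1 : R) (fun z : V => eta z.2) (derive1 eta z.2 * 1).
  by apply: is_derive_comp; [exact: es_is_derive1|exact: is_derive_time].
have d2 : is_derive z ((0 : 'rV[R]_n), 1 : R) (fun z : V => h (cone_form z))
    (derive1 h (cone_form z) * (2 * (z.2 + a))).
  apply: is_derive_comp; first exact: es_is_derive1.
  apply: is_derive_eq (is_derive_cone_form _ _) _ => /=.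
  by rewrite mulr1 big1 ?subr0// => i _; rewrite mxE mulr0.
have [_ ->] := is_deriveM d1 d2.
rewrite /cone_test /GRing.scale/=; ring.
Qed.

Lemma dx_cone_test i eta h : elem_smooth eta -> elem_smooth h ->
  dx i (cone_test eta h) = (fun z => -2 * z.1 ord0 i * cone_test eta (derive1 h) z).
Proof.
move=> he hh; apply/funext => z; rewrite /dx.
have d1 : is_derive z ((delta_mx ord0 i : 'rV[R]_n), 0 : R) (fun z : V => eta z.2)
    (derive1 eta z.2 * 0).
  by apply: is_derive_comp; [exact: es_is_derive1|exact: is_derive_time].
have d2 : is_derive z ((delta_mx ord0 i : 'rV[R]_n), 0 : R) (fun z : V => h (cone_form z))
    (derive1 h (cone_form z) * (- 2 * z.1 ord0 i)).
  apply: is_derive_comp; first exact: es_is_derive1.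
  apply: is_derive_eq (is_derive_cone_form _ _) _ => /=.
  rewrite mulr0 sub0r (bigD1 i)//= big1 ?addr0.
    by rewrite mxE !eqxx mulr1 !mulNr.
  by move=> j /negbTE ji; rewrite mxE ji andbF mulr0.
have [_ ->] := is_deriveM d1 d2.
rewrite /cone_test /GRing.scale/=; ring.
Qed.

Lemma dxdx_cone_test i eta h : elem_smooth eta -> elem_smooth h ->
  dx i (dx i (cone_test eta h)) = (fun z => -2 * cone_test eta (derive1 h) z
    + 4 * z.1 ord0 i ^+ 2 * cone_test eta (derive1 (derive1 h)) z).
Proof.
move=> he hh; rewrite dx_cone_test//; apply/funext => z; rewrite {1}/dx.
have hh' := es_derive1 hh.
have d1 : is_derive z ((delta_mx ord0 i : 'rV[R]_n), 0 : R)
    (fun z : V => -2 * z.1 ord0 i) (-2 * 1).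
  apply: (@is_derive_comp _ _ (fun z : V => z.1 ord0 i) (fun y => -2 * y)).
    by apply: is_derive_eq; rewrite /GRing.scale/=; ring.
  by apply: is_derive_eq (is_derive_coord _ _ _) _ => /=; rewrite mxE !eqxx.
have d2 := es_is_derive z ((delta_mx ord0 i : 'rV[R]_n), 0 : R) (es_cone_test he hh').
have [_ ->] := is_deriveM d1 d2.
move: (dx_cone_test i he hh'); rewrite {1}/dx => /(congr1 (fun F => F z)) ->.
rewrite /GRing.scale/=; ring.
Qed.

(** For the Lorentz form [q] one has [(dt q)^2 - |grad q|^2 = 4 q], and the wave operator maps [q]
    to [2 n + 2]. On functions of [q] it is thus an ordinary differential operator in [q], and a
    power of [q] reduces the wave equation to arithmetic of exponents. *)
Lemma wave_op_cone_test eta h z : elem_smooth eta -> elem_smooth h ->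
  wave_op (cone_test eta h) z =
    derive1 (derive1 eta) z.2 * h (cone_form z) +
    4 * (z.2 + a) * derive1 eta z.2 * derive1 h (cone_form z) +
    eta z.2 * ((2 * n%:R + 2) * derive1 h (cone_form z) +
               4 * cone_form z * derive1 (derive1 h) (cone_form z)).
Proof.
move=> he hh; have hh' := es_derive1 hh; have he' := es_derive1 he.
pose eta2 t := 2 * (t + a) * eta t.
have he2 : elem_smooth eta2.
  have -> : eta2 = (fun t => (2 * t + 2 * a) * eta t).
    by apply/funext => t; rewrite /eta2; ring.
  by apply: es_mul => //; exact: es_affine.
have de2 t : derive1 eta2 t = 2 * (t + a) * derive1 eta t + 2 * eta t.
  apply: derive1_val.
  have d1 : is_derive t (1 : R) (fun t : R => 2 * (t + a)) 2.
    by apply: is_derive_eq; rewrite /GRing.scale/=; ring.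
  have d2 := es_is_derive1 t he.
  apply: is_derive_eq (is_deriveM d1 d2) _.
  by rewrite /GRing.scale/=; ring.
rewrite /wave_op dt_cone_test//.
have dtD f g : elem_smooth f -> elem_smooth g -> dt (f + g) z = dt f z + dt g z.
  by move=> hf hg; rewrite /dt deriveD//; exact: es_derivable.
rewrite dtD; try exact: es_cone_test.
rewrite !dt_cone_test//.
under eq_bigr do rewrite dxdx_cone_test//.
rewrite big_split/= sumr_const card_ord -mulr_suml -mulr_sumr.
rewrite !fctE /cone_test -/eta2 de2.
rewrite -[_ *+ n]mulr_natl -/(sqnorm z.1) /eta2.
move: (h _) (derive1 h _) (derive1 (derive1 h) _) => h0 h1 h2.
rewrite /cone_form; ring.
Qed.

End wave_test_functions.

(** * Cutoffs *)

Section cutoffs.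
Context {R : realType}.
Implicit Types b s t d S : R.

Lemma derive1_affine (g : R -> R) (c d t : R) : elem_smooth g ->
  derive1 (fun t => g (c * t + d)) t = c * derive1 g (c * t + d).
Proof.
move=> hg; apply: derive1_val; rewrite mulrC.
apply: (@is_derive_comp _ _ (fun t : R => c * t + d) g).
  exact: es_is_derive1.
by apply: is_derive_eq; rewrite /GRing.scale/=; ring.
Qed.

Lemma derive1_mul (f g : R -> R) t : elem_smooth f -> elem_smooth g ->
  derive1 (fun t => f t * g t) t = f t * derive1 g t + g t * derive1 f t.
Proof.
move=> hf hg; apply: derive1_val.
exact: is_derive_eq (is_deriveM (es_is_derive1 t hf) (es_is_derive1 t hg)) _.
Qed.

Lemma derive1_add (f g : R -> R) t : elem_smooth f -> elem_smooth g ->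
  derive1 (fun t => f t + g t) t = derive1 f t + derive1 g t.
Proof.
by move=> hf hg; apply: derive1_val; apply: is_deriveD; exact: es_is_derive1.
Qed.

(** The transition takes place between [1/2] and [3/4], below the values [q >= 1] taken on the cone;
    profiles are therefore exact powers in a neighbourhood of those values, and their derivatives
    there are those of the powers. *)
Definition plateau (s : R) : R := step (4 * s + - 2).

Lemma es_plateau : elem_smooth plateau.
Proof. exact: (es_comp es_step (es_affine _ _)). Qed.

(** Equal to 1 below [1/2] and to [s] above [3/4], and positive in between. Real powers in
    [elem_smooth] require a base that is positive everywhere, which [s] itself is not. *)
Definition clamp (s : R) : R := s * plateau s + (1 - plateau s).

Lemma plateau_le s : s <= 2^-1 -> plateau s = 0.
Proof. by move=> hs; rewrite /plateau step_le0//; lra. Qed.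

Lemma plateau_ge s : 3 / 4 <= s -> plateau s = 1.
Proof. by move=> hs; rewrite /plateau step_ge1//; lra. Qed.

Lemma clamp_gt0 s : 0 < clamp s.
Proof.
have [hs|hs] := leP s 2^-1.
  by rewrite /clamp plateau_le// mulr0 subr0 add0r.
have := step_ge0 (4 * s + - 2); have := step_le1 (4 * s + - 2).
rewrite /clamp /plateau; set x := step _ => x1 x0.
have : x / 2 <= s * x by rewrite mulrC ler_wpM2r// ltW.
by lra.
Qed.

Lemma es_clamp : elem_smooth clamp.
Proof.
apply: es_add; first by apply: es_mul; [exact: es_id|exact: es_plateau].
by apply: es_sub; [exact: es_cst|exact: es_plateau].
Qed.

(* A smooth extension by zero of the power [s `^ (- b)] on [[1, +oo[]. *)
Definition power_profile (b s : R) : R := plateau s * clamp s `^ (- b).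

Lemma es_power_profile b : elem_smooth (power_profile b).
Proof.
apply: es_mul; first exact: es_plateau.
by apply: es_powR; [exact: clamp_gt0|exact: es_clamp].
Qed.

Lemma power_profile_le b s : s <= 2^-1 -> power_profile b s = 0.
Proof. by move=> hs; rewrite /power_profile plateau_le// mul0r. Qed.

Lemma power_profile_ge b s : 3 / 4 <= s -> power_profile b s = s `^ (- b).
Proof.
move=> hs; rewrite /power_profile /clamp plateau_ge// mul1r subrr addr0.
by rewrite mulr1.
Qed.

Lemma near_derive1 (f g : R -> R) s : (\near s, f s = g s) -> derive1 f s = derive1 g s.
Proof. by move=> fg; rewrite !derive1E; exact: near_eq_derive. Qed.

Lemma power_profile_derive1 b s : 3 / 4 < s ->
  derive1 (power_profile b) s = - b * s `^ (- b - 1).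
Proof.
move=> hs; rewrite (@near_derive1 _ (fun s => s `^ (- b))).
  by apply: derive1_val; apply: is_derive1_powR; lra.
by near=> x; rewrite power_profile_ge//; near: x; exact: lt_le_nbhsr.
Unshelve. all: by end_near. Qed.

Lemma power_profile_derive2 b s : 3 / 4 < s ->
  derive1 (derive1 (power_profile b)) s = b * (b + 1) * s `^ (- b - 2).
Proof.
move=> hs; rewrite (@near_derive1 _ (fun s => - b * s `^ (- b - 1))).
  apply: derive1_val.
  have h := is_deriveZ (- b) (is_derive1_powR (- b - 1) (_ : 0 < s)).
  apply: is_derive_eq (h _) _; first by lra.
  by rewrite /GRing.scale/= (_ : - b - 1 - 1 = - b - 2); ring.
by near=> x; rewrite power_profile_derive1//; near: x; exact: lt_nbhsr.
Unshelve. all: by end_near. Qed.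

(** Rises from 0 at [2 d] to 1 at [3 d]. The margin between [d] and [2 d] makes [rise d] and its
    derivatives vanish at [d], the lower end of all time integrals. *)
Definition rise (d t : R) : R := step (d^-1 * t + - 2).

Lemma es_rise d : elem_smooth (rise d).
Proof. exact: (es_comp es_step (es_affine _ _)). Qed.

Lemma rise_ge0 d t : 0 <= rise d t. Proof. exact: step_ge0. Qed.

Lemma rise_le1 d t : rise d t <= 1. Proof. exact: step_le1. Qed.

Lemma rise_le d t : 0 < d -> t <= 2 * d -> rise d t = 0.
Proof.
by move=> d0 td; rewrite /rise step_le0// subr_le0 mulrC ler_pdivrMr.
Qed.

Lemma rise_ge d t : 0 < d -> 3 * d <= t -> rise d t = 1.
Proof.
move=> d0 td; rewrite /rise step_ge1// lerBrDr mulrC ler_pdivlMr//; lra.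
Qed.

Lemma rise_derive1 d t : derive1 (rise d) t = d^-1 * derive1 step (d^-1 * t + - 2).
Proof. exact: derive1_affine es_step. Qed.

Lemma rise_derive2 d t :
  derive1 (derive1 (rise d)) t = d^-1 ^+ 2 * derive1 (derive1 step) (d^-1 * t + - 2).
Proof.
have -> : derive1 (rise d) = (fun t => d^-1 * derive1 step (d^-1 * t + - 2)).
  by apply/funext => x; exact: rise_derive1.
have es1 := es_derive1 (@es_step R).
rewrite derive1Ml; last exact: es_derivable (es_comp es1 (es_affine _ _)).
by rewrite (@derive1_affine (derive1 step))// mulrA expr2.
Qed.

Lemma rise_derive1_ge0 d t : 0 < d -> 0 <= derive1 (rise d) t.
Proof. by move=> d0; rewrite rise_derive1 mulr_ge0 ?step_derive_ge0 ?invr_ge0 ?ltW. Qed.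

Lemma rise_derive_lt d t : 0 < d -> t < 2 * d ->
  derive1 (rise d) t = 0 /\ derive1 (derive1 (rise d)) t = 0.
Proof.
move=> d0 td; have h : d^-1 * t + - 2 < 0 by rewrite subr_lt0 mulrC ltr_pdivrMr.
by rewrite rise_derive1 rise_derive2 step_derive_lt0// step_derive2_lt0// !mulr0.
Qed.

Lemma rise_derive_gt d t : 0 < d -> 3 * d < t ->
  derive1 (rise d) t = 0 /\ derive1 (derive1 (rise d)) t = 0.
Proof.
move=> d0 td; have h : 1 < d^-1 * t + - 2.
  by rewrite ltrBrDr mulrC ltr_pdivlMr//; lra.
by rewrite rise_derive1 rise_derive2 step_derive_gt1// step_derive2_gt1// !mulr0.
Qed.

Lemma rise_derive_bounded : exists2 M : R, 0 < M & forall d t, 0 < d ->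
  `|derive1 (rise d) t| <= M / d /\ `|derive1 (derive1 (rise d)) t| <= M / d ^+ 2.
Proof.
have [M M0 hM] := @step_derive_bounded R; exists M => // d t d0.
have [h1 h2] := hM (d^-1 * t + - 2).
have d1 : 0 < d^-1 by rewrite invr_gt0.
have d2 : 0 < d^-1 ^+ 2 by rewrite exprn_gt0.
rewrite rise_derive1 rise_derive2 -exprVn.
split; first by rewrite normrM (gtr0_norm d1) mulrC ler_pM2r.
by rewrite normrM (gtr0_norm d2) mulrC ler_pM2r.
Qed.

Definition fall (k : nat) (S t : R) : R := step (- (2 / S) * t + 2) ^+ k.

Lemma es_fall k S : elem_smooth (fall k S).
Proof. exact: es_exp (es_comp es_step (es_affine _ _)). Qed.

Lemma fall_ge0 k S t : 0 <= fall k S t. Proof. by rewrite exprn_ge0// step_ge0. Qed.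

Lemma fall_le k S t : 0 < S -> t <= S / 2 -> fall k S t = 1.
Proof.
move=> S0 tS; rewrite /fall step_ge1 ?expr1n//.
have : 2 / S * t <= 2 / S * (S / 2) by rewrite ler_pM2l// divr_gt0.
have -> : 2 / S * (S / 2) = 1 by field; rewrite gt_eqF.
by rewrite mulNr; lra.
Qed.

Lemma fall_ge k S t : (0 < k)%N -> 0 < S -> S <= t -> fall k S t = 0.
Proof.
move=> k0 S0 tS; rewrite /fall step_le0 ?expr0n ?gtn_eqF//.
have : 2 / S * S <= 2 / S * t by rewrite ler_pM2l// divr_gt0.
have -> : 2 / S * S = 2 by field; rewrite gt_eqF.
by rewrite mulNr; lra.
Qed.

Lemma fall_derive_lt k S t : 0 < S -> t < S / 2 ->
  derive1 (fall k S) t = 0 /\ derive1 (derive1 (fall k S)) t = 0.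
Proof.
move=> S0 tS.
have h x : x < S / 2 -> derive1 (fall k S) x = 0.
  move=> xS; apply: (@derive1_locally_cst _ _ _ 1); near=> y.
  by rewrite fall_le//; near: y; exact: lt_le_nbhsl.
split; first exact: h.
apply: (@derive1_locally_cst _ _ _ 0); near=> y.
by rewrite h//; near: y; exact: lt_nbhsl.
Unshelve. all: by end_near. Qed.

Lemma derive1_exp (f : R -> R) k t : elem_smooth f ->
  derive1 (fun t => f t ^+ k.+1) t = k.+1%:R * f t ^+ k * derive1 f t.
Proof.
move=> hf; apply: derive1_val.
have d : is_derive (f t) (1 : R) (fun y : R => y ^+ k.+1) (k.+1%:R * f t ^+ k).
  by apply: DeriveDef; [exact: exprn_derivable|rewrite -derive1E exp_derive1].
exact: is_derive_comp d (es_is_derive1 t hf).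
Qed.

(* The factor [fall `^ p^-1] absorbs the loss of two powers of [step] in the
   second derivative as soon as [k >= 2 p / (p - 1)]. *)
Lemma fall_derive_bounded (p : R) : 1 < p -> exists k : nat, (0 < k)%N /\
  exists2 M : R, 0 < M & forall S t, 0 < S ->
  `|derive1 (fall k S) t| <= M / S * fall k S t `^ p^-1 /\
  `|derive1 (derive1 (fall k S)) t| <= M / S ^+ 2 * fall k S t `^ p^-1.
Proof.
move=> p1; have p0 : 0 < p by lra.
have pV1 : 0 < 1 - p^-1 by rewrite subr_gt0 invf_lt1.
have [j [j_gt0 hk]] : exists j : nat, (0 < j)%N /\ j.+2%:R * p^-1 <= j%:R.
  pose j := (Num.truncn (2 / (1 - p^-1))).+1; exists j; split => //.
  have : 2 / (1 - p^-1) < j%:R by exact: truncnS_gt.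
  rewrite ltr_pdivrMr// => h.
  have -> : j.+2%:R = j%:R + 2 :> R by rewrite -natrD addn2.
  have : p^-1 < 1 by rewrite invf_lt1.
  nra.
pose k := j.+2.
exists k; split => //.
have [M M0 hM] := @step_derive_bounded R.
exists (k%:R * 2 * M + (k%:R * j.+1%:R * 4 * M ^+ 2 + k%:R * 4 * M)).
  by rewrite addr_gt0 ?addr_gt0 ?mulr_gt0 ?exprn_gt0 ?ltr0n.
move=> S t S0; set c := - (2 / S).
have es1 := es_comp (@es_step R) (es_affine c 2).
have es2 := es_comp (es_derive1 (@es_step R)) (es_affine c 2).
have E1 x : derive1 (fall k S) x =
    k%:R * step (c * x + 2) ^+ j.+1 * (c * derive1 step (c * x + 2)).
  rewrite (@derive1_exp (fun x => step (c * x + 2)))//.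
  by rewrite (@derive1_affine step)//; exact: es_step.
have E2 : derive1 (derive1 (fall k S)) t = c ^+ 2 *
    (k%:R * j.+1%:R * step (c * t + 2) ^+ j * derive1 step (c * t + 2) ^+ 2 +
     k%:R * step (c * t + 2) ^+ j.+1 * derive1 (derive1 step) (c * t + 2)).
  have -> : derive1 (fall k S) = (fun x => step (c * x + 2) ^+ j.+1 *
     (k%:R * c * derive1 step (c * x + 2))).
    by apply/funext => x; rewrite E1; ring.
  rewrite derive1_mul; last 2 first.
    exact: es_exp.
    by apply: es_mul => //; exact: es_cst.
  rewrite derive1Ml; last exact: es_derivable.
  rewrite (@derive1_exp (fun x => step (c * x + 2)))//.
  rewrite (derive1_affine c 2 t (@es_step R)).
  rewrite (derive1_affine c 2 t (es_derive1 (@es_step R))).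
  by ring.
have [] := hM (c * t + 2); have := step_ge0 (c * t + 2).
have := step_le1 (c * t + 2); rewrite E1 E2 /fall -/c.
set s := step _; set s1 := derive1 step _; set s2 := derive1 (derive1 step) _.
move=> sle1 s0 h1 h2.
(* This is [k / p <= j] read on [[0, 1]], where a smaller exponent gives a larger power: both
   derivatives of [s ^ k], with [k = j + 2], keep a factor [s ^ j]. *)
have sj : s ^+ j <= (s ^+ k) `^ p^-1.
  have [->|sn0] := eqVneq s 0; first by rewrite expr0n gtn_eqF// powR_ge0.
  rewrite -!powR_mulrn// -powRrM; apply: ger_powR => //.
  by rewrite lt_neqAle eq_sym sn0 s0.
have sj1 : s ^+ j.+1 <= s ^+ j by rewrite exprS ler_piMl ?exprn_ge0.
have c2 : `|c| = 2 / S by rewrite normrN gtr0_norm// divr_gt0.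
have sj0 : 0 <= s ^+ j by rewrite exprn_ge0.
have sj10 : 0 <= s ^+ j.+1 by rewrite exprn_ge0.
have k0 : 0 <= k%:R :> R by [].
have j0 : 0 <= j.+1%:R :> R by [].
set Q := (_ `^ _) in sj *.
split.
- rewrite !normrM c2 (ger0_norm k0) (ger0_norm sj10).
  apply: (@le_trans _ _ ((k%:R * 2 * M) / S * s ^+ j)).
    have -> : k%:R * 2 * M / S * s ^+ j = k%:R * s ^+ j * (2 / S * M) by ring.
    have S2 : 0 < 2 / S by rewrite divr_gt0.
    apply: ler_pM.
    - exact: mulr_ge0.
    - by rewrite mulr_ge0// ltW.
    - by rewrite ler_wpM2l.
    - by rewrite ler_pM2l.
  apply: ler_pM => //; first by rewrite !mulr_ge0 ?invr_ge0 ?ltW.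
  rewrite ler_pM2r ?invr_gt0// lerDl addr_ge0 ?mulr_ge0 ?exprn_ge0// ltW//.
- rewrite normrM normrX c2 [leRHS]mulrAC; set Z := `|_ + _|.
  have -> : (2 / S) ^+ 2 * Z = 4 * Z / S ^+ 2 by field; rewrite gt_eqF.
  rewrite ler_pM2r ?invr_gt0 ?exprn_gt0//.
  apply: (@le_trans _ _ ((k%:R * j.+1%:R * 4 * M ^+ 2 + k%:R * 4 * M) * s ^+ j)).
    have -> : (k%:R * j.+1%:R * 4 * M ^+ 2 + k%:R * 4 * M) * s ^+ j =
      4 * (k%:R * j.+1%:R * s ^+ j * M ^+ 2 + k%:R * s ^+ j * M) by ring.
    rewrite ler_pM2l// /Z (le_trans (ler_normD _ _))// lerD//.
      rewrite [leLHS]normrM ger0_norm ?mulr_ge0// ler_wpM2l ?mulr_ge0// normrX.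
      by rewrite ler_sqr ?nnegrE// ltW.
    rewrite !normrM (ger0_norm k0) (ger0_norm sj10); apply: ler_pM => //.
    by rewrite mulr_ge0.
    by rewrite ler_wpM2l.
  apply: ler_pM => //; first by rewrite !addr_ge0 ?mulr_ge0 ?exprn_ge0 ?ltW.
  by rewrite lerDr !mulr_ge0 // ltW.
Qed.

End cutoffs.

(** * Cone slices: compactness, measurability, enclosing boxes *)

Section cone_regions.
Context {R : realType} {n : nat}.
Local Notation V := ('rV[R]_n * R)%type.
(* The measurable structure carried by [spacetime_lebesgue]. *)
Local Notation VM := ('rV[R]_n * measurableTypeR R)%type.
Implicit Types (r c L : R) (x : 'rV[R]_n).

(** Boxes serve in place of balls in the volume bounds: their volume is a product of lengths, and
    only its power of [S] matters. *)
Definition cube L : set 'rV[R]_n := [set x | forall i, `[- L, L]%classic (x ord0 i)].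

Lemma sqnorm_ge0 x : 0 <= sqnorm x.
Proof. by apply: sumr_ge0 => i _; rewrite sqr_ge0. Qed.

Lemma le_coord_sqnorm x i : x ord0 i ^+ 2 <= sqnorm x.
Proof.
by rewrite /sqnorm (bigD1 i)//= lerDl sumr_ge0// => j _; rewrite sqr_ge0.
Qed.

Lemma sqnorm_cube x L : 0 <= L -> sqnorm x <= L ^+ 2 -> cube L x.
Proof.
move=> L0 xL i; have := le_trans (le_coord_sqnorm x i) xL.
by rewrite -ler_sqrt ?sqr_ge0// !sqrtr_sqr (ger0_norm L0) ler_norml /= in_itv.
Qed.

Lemma euclidean_norm_le x L : 0 <= L ->
  (euclidean_norm x <= L) = (sqnorm x <= L ^+ 2).
Proof.
move=> L0; rewrite /euclidean_norm -/(sqnorm x) -[in LHS](ger0_norm L0).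
by rewrite -sqrtr_sqr ler_sqrt// sqr_ge0.
Qed.

Lemma cube_compact L : compact (cube L).
Proof.
apply: (@rV_compact R n (fun=> `[- L, L]%classic)) => _.
exact: segment_compact.
Qed.

Lemma measurable_cube L : measurable (cube L).
Proof.
rewrite (_ : cube L = \bigcap_(i in [set: 'I_n])
  ((fun x : 'rV[R]_n => x ord0 i) @^-1` `[- L, L]%classic)).
  apply: fin_bigcap_measurable => // i _; rewrite -[X in measurable X]setTI.
  exact: measurable_coord.
by apply/seteqP; split => x /= Ax i; [move=> _|]; exact: Ax.
Qed.

Lemma lebesgue_cube L : 0 <= L ->
  (lebesgue_rV R n (cube L) = ((2 * L) ^+ n)%:E)%E.
Proof.
move=> L0; rewrite /cube (@lebesgue_rV_rect R n (fun=> `[- L, L]%classic))//.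
rewrite (eq_bigr (fun=> (2 * L)%:E)) => [|i _]; last first.
  rewrite lebesgue_measure_itv/= lte_fin.
  case: ifPn => [_|]; first by rewrite -EFinB; congr EFin; ring.
  by rewrite -leNgt => h; congr EFin; lra.
elim: (n) => [|k IH]; first by rewrite big_ord0.
by rewrite big_ord_recl IH -EFinM exprS.
Qed.

Lemma measurable_sqnorm : measurable_fun setT (@sqnorm R n).
Proof.
apply: measurable_sum => i; apply: measurable_funX.
exact: measurable_coord.
Qed.

(** Used twice: with [r = rho] and [c = 0] it is the region that carries [u]; with [r = rho + 1] and
    [c = 1/2] it is the larger compact region that contains the supports of the test functions. *)
Definition cone_slice r c d S : set V :=
  [set z | d <= z.2 <= S /\ sqnorm z.1 <= (z.2 + r) ^+ 2 - c].

Lemma cone_slice_sub r c d S : 0 <= r -> 0 <= c -> 0 <= d ->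
  cone_slice r c d S `<=` cube (S + r) `*` `[d, S]%classic.
Proof.
move=> r0 c0 d0 [x t] [/= /andP[dt tS] xt]; split; last by rewrite /= in_itv/= dt.
apply: sqnorm_cube; first by lra.
by rewrite (le_trans xt)//; nra.
Qed.

Lemma cone_slice_closed r c d S : closed (cone_slice r c d S).
Proof.
have -> : cone_slice r c d S = (fun z : V => z.2) @^-1` [set t | d <= t] `&`
   ((fun z : V => z.2) @^-1` [set t | t <= S] `&`
    (cone_form r @^-1` [set t | c <= t])).
  apply/seteqP; split => z; rewrite /cone_slice /cone_form /=.
    move=> [/andP[-> ->]]; rewrite lerBrDr addrC -lerBrDr => h.
    by do !split => //; rewrite lerBrDr addrC -lerBrDr.
  by move=> [-> [-> h]]; split => //; rewrite lerBrDr addrC -lerBrDr.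
apply: closedI; last apply: closedI.
- by apply: closed_comp; [move=> z _; exact: time_continuous|exact: closed_ge].
- by apply: closed_comp; [move=> z _; exact: time_continuous|exact: closed_le].
- apply: closed_comp; last exact: closed_ge.
  by move=> z _; exact: es_continuous (es_cone_form r) z.
Qed.

Lemma cone_slice_compact r c d S : 0 <= r -> 0 <= c -> 0 <= d ->
  compact (cone_slice r c d S).
Proof.
move=> r0 c0 d0.
apply: (@subclosed_compact _ _ (cube (S + r) `*` `[d, S]%classic)).
- exact: cone_slice_closed.
- by apply: compact_setX; [exact: cube_compact|exact: segment_compact].
- exact: cone_slice_sub.
Qed.

Lemma measurable_time : measurable_fun setT (fun z : VM => z.2 : R).
Proof. exact: measurable_snd. Qed.

Lemma measurable_cone_form r : measurable_fun setT (@cone_form R n r : VM -> R).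
Proof.
apply: measurable_funB.
  by apply: measurable_funX; apply: measurable_funD => //; exact: measurable_time.
exact: (measurableT_comp measurable_sqnorm measurable_fst).
Qed.

Lemma measurable_cone_slice r c d S : measurable (cone_slice r c d S : set VM).
Proof.
have -> : cone_slice r c d S = (fun z : V => z.2) @^-1` `[d, S]%classic `&`
    (cone_form r @^-1` `[c, +oo[%classic).
  apply/seteqP; split => z; rewrite /cone_slice /cone_form /= !in_itv/= andbT.
    by move=> [-> h]; split => //; rewrite lerBrDr addrC -lerBrDr.
  by move=> [-> h]; split => //; rewrite lerBrDr addrC -lerBrDr.
apply: measurableI; rewrite -[X in measurable X]setTI.
- exact: measurable_time.
- exact: measurable_cone_form.
Qed.

Lemma es_measurable (g : R -> R) : elem_smooth g -> measurable_fun setT g.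
Proof. by move=> hg; apply: continuous_measurable_fun; exact: es_continuous. Qed.

Lemma measurable_comp_time (g : R -> R) : measurable_fun setT g ->
  measurable_fun setT (fun z : VM => g z.2).
Proof. by move=> mg; exact: (measurableT_comp mg measurable_time). Qed.

Lemma measurable_cone_test r (eta h : R -> R) : elem_smooth eta -> elem_smooth h ->
  measurable_fun setT (@cone_test R n r eta h : VM -> R).
Proof.
move=> he hh; apply: measurable_funM.
  exact: measurable_comp_time (es_measurable he).
exact: (measurableT_comp (es_measurable hh) (measurable_cone_form r)).
Qed.

End cone_regions.

(** * Regions and supports *)

Section essential_support.
Context {R : realType} {n : nat}.
Local Notation mu := (lebesgue_rV R n).
Implicit Types (f : 'rV[R]_n -> R).

Let box (q : 'rV[rat]_n * nat) : set 'rV[R]_n :=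
  [set x | forall i, `|x ord0 i - ratr (q.1 ord0 i)| < q.2.+1%:R^-1].

Let box_basis (O : set 'rV[R]_n) x : open O -> O x ->
  exists q, box q x /\ box q `<=` O.
Proof.
move=> oO Ox; have /nbhs_ballP[e /= e0 eO] : nbhs x O by exact: open_nbhs_nbhs.
have e2 : 0 < e / 2 by rewrite divr_gt0.
pose k := Num.truncn (e / 2)^-1.
have ke : k.+1%:R^-1 < e / 2.
  by rewrite invf_plt ?posrE// truncnS_gt.
have k0 : 0 < k.+1%:R^-1 :> R by rewrite invr_gt0.
have /fin_all_exists[c hc] : forall i, exists q : rat, `|x ord0 i - ratr q| < k.+1%:R^-1.
  move: k0; set d := _^-1 => d0 i; have [|q] := @rat_in_itvoo R (x ord0 i - d) (x ord0 i + d).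
    by lra.
  by rewrite in_itv/= => /andP[q1 q2]; exists q; rewrite ltr_norml; lra.
exists (\row_i c i, k); split => [i /=|y hy]; first by rewrite mxE.
apply: eO; split => // i j; rewrite ord1.
have := hy j; have := hc j; rewrite /= mxE => h1 h2.
rewrite /ball /= (_ : x ord0 j - y ord0 j =
  (x ord0 j - ratr (c j)) - (y ord0 j - ratr (c j))); last by ring.
by rewrite (le_lt_trans (ler_normB _ _))// [ltRHS]splitr ltrD// (lt_trans _ ke).
Qed.

(* The complement of the essential support is a union of null open sets; by the
   Lindelöf property it is covered by countably many null rational boxes. *)
Lemma ae_ess_support f : {ae mu, forall x, ~ ess_support f x -> f x = 0}.
Proof.
pose null q := {ae mu, forall x, box q x -> f x = 0}.
pose N (j : nat) : set 'rV[R]_n :=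
  if unpickle j is Some q then [set x | null q /\ box q x /\ f x <> 0] else set0.
apply: (@negligibleS _ _ _ _ (\bigcup_j N j)).
  move=> x /= /not_implyP[/contrapT xO fx0]; have [U [oU aeU] Ux] := xO.
  have [q [qx qO]] := box_basis oU Ux.
  exists (pickle q) => //; rewrite /N pickleK /=; split => //.
  by apply: filterS aeU => y h /qO /h.
apply: negligible_bigcup => j; rewrite /N; case: unpickle => [q|]; last exact: negligible_set0.
have [nq|nq] := pselect (null q); last first.
  by apply: negligibleS (negligible_set0 _) => x [].
by apply: negligibleS nq => x [_ [qx fx]] /=; apply/not_implyP.
Qed.

End essential_support.

Section slices.
Context {R : realType} {n : nat}.
Local Notation Lam := (spacetime_lebesgue R n).

(** The support condition yields a null set at each fixed time, while the weak equation needs one in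
    space-time; Tonelli passes from the first to the second. *)
Lemma null_slices (N : set ('rV[R]_n * measurableTypeR R)) : measurable N ->
  (forall t, (lebesgue_rV R n).-negligible [set x | N (x, t)]) -> Lam N = 0%E.
Proof.
move=> mN hN; rewrite -(setIT N) -integral_indic//.
have := @fubini_tonelli2 _ _ _ (measurableTypeR R) R (lebesgue_rV R n)
  (@lebesgue_measure R) (fun z => (\1_N z)%:E).
rewrite /spacetime_lebesgue => ->; last 2 first.
- by apply/measurable_EFinP; exact: measurable_indic.
- by move=> z; rewrite lee_fin.
rewrite integral0_eq// => t _; rewrite /fubini_G.
have mt : measurable [set x | N (x, t)].
  by have := measurable_ysection t mN; rewrite ysectionE.
rewrite (eq_integral (fun x => (\1_[set x | N (x, t)] x)%:E)) => [|x _]; last first.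
  by congr EFin; rewrite !indicE; congr (_%:R); apply/idP/idP; rewrite !inE.
rewrite integral_indic// setIT.
exact: measure_negligible.
Qed.

End slices.

Lemma integrable_bounded_mul {d} {X : measurableType d} {R : realType}
    (mu : {measure set X -> \bar R}) (D : set X) (f h : X -> R) (M : R) :
  measurable D -> mu.-integrable D (EFin \o f) -> measurable_fun D h ->
  (forall x, D x -> `|h x| <= M) ->
  mu.-integrable D (EFin \o (fun x => f x * h x)).
Proof.
move=> mD fi mh hM.
have := integrableMl mD fi mh.
apply; exists M; split; first exact: num_real.
by move=> y My x Dx /=; rewrite (le_trans (hM x Dx))// ltW.
Qed.

Lemma spacetime_lebesgue_setX {R : realType} {n : nat} (A : set 'rV[R]_n)
    (B : set (measurableTypeR R)) : measurable A -> measurable B ->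
  spacetime_lebesgue R n (A `*` B) = (lebesgue_rV R n A * lebesgue_measure B)%E.
Proof. by move=> mA mB; exact: product_measure1E. Qed.

(** * Restriction of the weak equation to the light cone *)

Section weak_form.
Context {R : realType} {n : nat}.
Local Notation V := ('rV[R]_n * R)%type.
Local Notation VM := ('rV[R]_n * measurableTypeR R)%type.
Local Notation Lam := (spacetime_lebesgue R n).
Variables (p rho : R) (T : \bar R) (f g : 'rV[R]_n -> R) (u v : R -> 'rV[R]_n -> R).
Hypotheses (p1 : 1 < p) (rho0 : 0 < rho) (sol : weak_solution p T f g u v).
Hypothesis supp : support_curve T u v `<=` light_cone rho.

Lemma measurable_time_interval : measurable (time_interval T).
Proof.
have -> : time_interval T = `[0, +oo[%classic `&`
    ([set x : R | (x%:E < T)%E]).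
  by apply/seteqP; split => x; rewrite /time_interval /= in_itv/= andbT.
apply: measurableI => //.
have -> : [set x : R | (x%:E < T)%E] = EFin @^-1` `]-oo, T[%classic.
  by apply/seteqP; split => x; rewrite /= in_itv.
rewrite -[X in measurable X]setTI; apply: (@EFin_measurable R setT) => //.
exact: emeasurable_itv.
Qed.

Lemma slab_setX : slab T = (setT `*` (time_interval T `&` `]0, +oo[%classic) : set VM).
Proof.
apply/seteqP; split => z; rewrite /slab /time_interval /= in_itv/= andbT.
  by move=> [z0 zT]; split => //; split => //; split => //; exact: ltW.
by move=> [_ [[_ zT] z0]].
Qed.

Lemma measurable_slab : measurable (slab T : set VM).
Proof.
rewrite slab_setX; apply: measurableX => //; apply: measurableI => //.
exact: measurable_time_interval.
Qed.

Lemma slab_sub : (slab T : set VM) `<=` setT `*` time_interval T.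
Proof. by rewrite slab_setX => z [_ [? _]]. Qed.

Lemma outside_cone t x : time_interval T t -> (t + rho) ^+ 2 < sqnorm x ->
  ~ (ess_support (u t) `|` ess_support (v t)) x.
Proof.
move=> It xt xs; have /= := @supp (x, t) (conj It xs); move=> [t0].
by rewrite euclidean_norm_le ?(addr_ge0 t0 (ltW rho0))// leNgt xt.
Qed.

Lemma ae_outside_u t : time_interval T t ->
  {ae lebesgue_rV R n, forall x, (t + rho) ^+ 2 < sqnorm x -> u t x = 0}.
Proof.
move=> It; apply: filterS (ae_ess_support (u t)) => x h xt; apply: h => xs.
by apply: (outside_cone It xt); left.
Qed.

Lemma ae_outside_v t : time_interval T t ->
  {ae lebesgue_rV R n, forall x, (t + rho) ^+ 2 < sqnorm x -> v t x = 0}.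
Proof.
move=> It; apply: filterS (ae_ess_support (v t)) => x h xt; apply: h => xs.
by apply: (outside_cone It xt); right.
Qed.

Lemma measurable_setX_time : measurable (setT `*` time_interval T : set VM).
Proof. by apply: measurableX => //; exact: measurable_time_interval. Qed.

(** Joint measurability of [u] makes the exceptional set measurable, and each of its time slices is
    negligible by [ae_outside_u]. *)
Lemma ae_outside_cone : {ae Lam, forall z : V,
  time_interval T z.2 -> (z.2 + rho) ^+ 2 < sqnorm z.1 -> u z.2 z.1 = 0}.
Proof.
pose N : set VM := (setT `*` time_interval T) `&`
  (fun z : VM => u z.2 z.1) @^-1` (~` [set 0]) `&`
  (cone_form rho @^-1` `]-oo, 0[%classic).
have mN : measurable N.
  apply: measurableI.
    apply: (sol_measurable sol measurable_setX_time).
    by apply: measurableC; exact: measurable_set1.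
  rewrite -[X in measurable X]setTI; exact: measurable_cone_form.
exists N; split => //.
  apply: null_slices => // t; have [It|nIt] := pselect (time_interval T t).
    apply: negligibleS (ae_outside_u It) => x [[_ /= ux]].
    rewrite in_itv/= /cone_form/= subr_lt0 => xt h.
    exact/ux/h.
  by apply: negligibleS (negligible_set0 _) => x [[[]]].
move=> z /= /not_implyP[Iz] /not_implyP[zr uz]; split; first by split.
by rewrite /= in_itv/= /cone_form subr_lt0.
Qed.

Section cone_restriction.
Variables (d S : R).
Hypotheses (d0 : 0 < d) (dS : d <= S) (ST : (S%:E < T)%E).

Local Notation Z := (@cone_slice R n rho 0 d S).

Lemma cone_slice_slab r c : cone_slice r c d S `<=` (slab T : set V).
Proof.
move=> z [/andP[dz zS] _]; split; first exact: lt_le_trans dz.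
by apply: le_lt_trans ST; rewrite lee_fin.
Qed.

Lemma measurable_coneZ : measurable (Z : set VM).
Proof. exact: measurable_cone_slice. Qed.

Lemma compact_coneZ : compact Z.
Proof. by apply: cone_slice_compact => //; exact: ltW. Qed.

(** Trades the slab, unbounded in space, for a compact set on which the local integrability in
    [distributional_wave] is genuine integrability. The part cut away lies outside the time window
    or, up to a null set, where [u] vanishes. *)
Lemma slab_to_cone (F : VM -> R) : measurable_fun (slab T) F ->
  (forall z, slab T z -> u z.2 z.1 = 0 -> F z = 0) ->
  (forall z, slab T z -> ~ (d <= z.2 <= S) -> F z = 0) ->
  \int[Lam]_(z in slab T) F z = \int[Lam]_(z in Z) F z.
Proof.
move=> mF Fu Ft; congr fine; rewrite integral_mkcond [RHS]integral_mkcond.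
apply: ae_eq_integral => //.
- apply/(measurable_restrictT _ _).1; first exact: measurable_slab.
  exact/measurable_EFinP.
- apply/(measurable_restrictT _ _).1; first exact: measurable_coneZ.
  apply/measurable_EFinP; apply: measurable_funS mF; first exact: measurable_slab.
  exact: cone_slice_slab.
- apply: (@filterS _ _ (ae_filter_ringOfSetsType Lam) _ _ _ ae_outside_cone).
  move=> z uz _; rewrite !patchE.
  case: ifPn => [|/negP]; rewrite inE => zs; last first.
    case: ifPn => //; rewrite inE => zZ; exfalso; apply: zs.
    exact: cone_slice_slab zZ.
  case: ifPn => // /negP; rewrite inE => zZ; congr EFin.
  have [dzS|/Ft ->//] := pselect (d <= z.2 <= S).
  apply: Fu => //; apply: uz; first by have [] := slab_sub zs.
  by rewrite ltNge; apply/negP => h; apply: zZ; split => //; rewrite subr0.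
Qed.

Lemma measurable_u (D : set VM) : D `<=` slab T ->
  measurable_fun D (fun z : VM => u z.2 z.1).
Proof.
move=> DT; apply: measurable_funS (sol_measurable sol).
  exact: measurable_setX_time.
exact: subset_trans DT slab_sub.
Qed.

Lemma measurable_up (D : set VM) : D `<=` slab T ->
  measurable_fun D (fun z : VM => `|u z.2 z.1| `^ p).
Proof.
move=> DT.
have m1 : measurable_fun D (fun z : VM => `|u z.2 z.1|).
  by apply: measurableT_comp => //; exact: measurable_u.
exact: (measurableT_comp (@measurable_powR R p) m1).
Qed.

Lemma coneZ_finite : (Lam Z < +oo)%E.
Proof.
apply: (@le_lt_trans _ _ (Lam (cube (S + rho) `*` `[d, S]%classic))).
  apply: le_measure; rewrite ?inE; first exact: measurable_coneZ.
    by apply: measurableX => //; exact: measurable_cube.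
  by apply: cone_slice_sub => //; exact: ltW.
rewrite spacetime_lebesgue_setX//; last exact: measurable_cube.
rewrite lebesgue_cube; last exact: addr_ge0 (ltW (lt_le_trans d0 dS)) (ltW rho0).
apply: lte_mul_pinfty => //.
  rewrite lee_fin exprn_ge0// mulr_ge0//.
  exact: addr_ge0 (ltW (lt_le_trans d0 dS)) (ltW rho0).
by rewrite lebesgue_measure_itv/=; case: ifPn => // _; rewrite -EFinB ltry.
Qed.

Lemma integrable_up : Lam.-integrable Z (EFin \o (fun z : VM => `|u z.2 z.1| `^ p)).
Proof.
have [li _] := sol_equation sol.
apply: li; [exact: compact_coneZ|exact: cone_slice_slab].
Qed.

(** From [|u| <= 1 + |u|^p] and the finite volume of the slice. *)
Lemma integrable_u : Lam.-integrable Z (EFin \o (fun z : VM => u z.2 z.1)).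
Proof.
have i0 : Lam.-integrable Z (EFin \o cst (1 : R)).
  apply: measurable_bounded_integrable => //.
  - exact: measurable_coneZ.
  - exact: coneZ_finite.
  - by exists 1; split; [exact: num_real|move=> y y1 x _ /=; rewrite normr1 ltW].
have i1 : Lam.-integrable Z (EFin \o (fun z : VM => 1 + `|u z.2 z.1| `^ p)).
  exact: (integrableD measurable_coneZ i0 integrable_up).
apply: le_integrable i1; first exact: measurable_coneZ.
- by apply/measurable_EFinP; apply: measurable_u; exact: cone_slice_slab.
- move=> z _ /=; rewrite lee_fin [leRHS]ger0_norm ?addr_ge0 ?powR_ge0//.
  have [u1|u1] := leP (`|u z.2 z.1|) 1; first by rewrite (le_trans u1)// lerDl powR_ge0.
  by rewrite (@le_trans _ _ (`|u z.2 z.1| `^ p))// ?lerDr// le1r_powR// ltW.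
Qed.

End cone_restriction.
End weak_form.

(** * Products of a time cutoff with a function of space-time *)

Section time_multiplier.
Context {R : realType} {n : nat}.
Local Notation V := ('rV[R]_n * R)%type.
Implicit Types (zeta : R -> R) (Phi : V -> R).

Lemma es_time_mul zeta Phi : elem_smooth zeta -> elem_smooth Phi ->
  elem_smooth (fun z : V => zeta z.2 * Phi z).
Proof. by move=> hz hP; apply: es_mul => //; exact: es_comp hz es_time. Qed.

Lemma dt_time_mul zeta Phi : elem_smooth zeta -> elem_smooth Phi ->
  dt (fun z : V => zeta z.2 * Phi z) =
  (fun z => derive1 zeta z.2 * Phi z + zeta z.2 * dt Phi z).
Proof.
move=> hz hP; apply/funext => z; rewrite {1}/dt.
have d1 : is_derive z ((0 : 'rV[R]_n), 1 : R) (fun z : V => zeta z.2) (derive1 zeta z.2 * 1).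
  by apply: is_derive_comp; [exact: es_is_derive1|exact: is_derive_time].
have [_ ->] := is_deriveM d1 (es_is_derive z ((0 : 'rV[R]_n), 1 : R) hP).
rewrite /GRing.scale/= -/(dt Phi z); ring.
Qed.

Lemma dx_time_mul i zeta Phi : elem_smooth zeta -> elem_smooth Phi ->
  dx i (fun z : V => zeta z.2 * Phi z) = (fun z => zeta z.2 * dx i Phi z).
Proof.
move=> hz hP; apply/funext => z; rewrite {1}/dx.
have d1 : is_derive z ((delta_mx ord0 i : 'rV[R]_n), 0 : R) (fun z : V => zeta z.2)
    (derive1 zeta z.2 * 0).
  by apply: is_derive_comp; [exact: es_is_derive1|exact: is_derive_time].
have [_ ->] := is_deriveM d1 (es_is_derive z ((delta_mx ord0 i : 'rV[R]_n), 0 : R) hP).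
rewrite /GRing.scale/= -/(dx i Phi z); ring.
Qed.

Lemma es_dt Phi : elem_smooth Phi -> elem_smooth (dt Phi).
Proof. exact: es_derive. Qed.

Lemma es_dx i Phi : elem_smooth Phi -> elem_smooth (dx i Phi).
Proof. exact: es_derive. Qed.

Lemma wave_op_time_mul zeta Phi z : elem_smooth zeta -> elem_smooth Phi ->
  wave_op (fun z : V => zeta z.2 * Phi z) z =
  derive1 (derive1 zeta) z.2 * Phi z + 2 * derive1 zeta z.2 * dt Phi z +
  zeta z.2 * wave_op Phi z.
Proof.
move=> hz hP; have hz' := es_derive1 hz; have hP' := es_dt hP.
have E1 : dt (dt (fun z : V => zeta z.2 * Phi z)) z =
    derive1 (derive1 zeta) z.2 * Phi z + derive1 zeta z.2 * dt Phi z +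
    (derive1 zeta z.2 * dt Phi z + zeta z.2 * dt (dt Phi) z).
  rewrite (dt_time_mul hz hP).
  have -> : dt (fun z : V => derive1 zeta z.2 * Phi z + zeta z.2 * dt Phi z) z =
      dt (fun z : V => derive1 zeta z.2 * Phi z) z + dt (fun z : V => zeta z.2 * dt Phi z) z.
    by rewrite /dt; apply: deriveD; apply: es_derivable; exact: es_time_mul.
  by rewrite (dt_time_mul hz' hP) (dt_time_mul hz hP').
have E2 : \sum_(i < n) dx i (dx i (fun z : V => zeta z.2 * Phi z)) z =
    zeta z.2 * \sum_(i < n) dx i (dx i Phi) z.
  rewrite mulr_sumr; apply: eq_bigr => i _.
  by rewrite (dx_time_mul i hz hP) (dx_time_mul i hz (es_dx i hP)).
transitivity (derive1 (derive1 zeta) z.2 * Phi z + derive1 zeta z.2 * dt Phi z +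
    (derive1 zeta z.2 * dt Phi z + zeta z.2 * dt (dt Phi) z) -
    zeta z.2 * \sum_(i < n) dx i (dx i Phi) z).
  exact: (congr2 (fun a b : R => a - b) E1 E2).
rewrite /wave_op; ring.
Qed.

Lemma is_derive_time_section Phi x t : elem_smooth Phi ->
  is_derive t (1 : R) (fun t : R => Phi (x, t)) (dt Phi (x, t)).
Proof.
move=> hP; have /is_derive_along h := es_is_derive (x, t) ((0 : 'rV[R]_n), 1 : R) hP.
apply/is_derive_along; move: h; congr is_derive.
apply/funext => s; rewrite -[in LHS]/(Phi (s *: 0 + x, s *: 1 + t)).
by rewrite scaler0 add0r.
Qed.

End time_multiplier.

Lemma derive1_outside {R : realType} (zeta : R -> R) (d S : R) :
  (forall t, ~ (d <= t <= S) -> zeta t = 0) ->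
  forall t, ~ (d <= t <= S) -> derive1 zeta t = 0.
Proof.
move=> z0 t /negP; rewrite negb_and -!ltNge => /orP[td|St].
- apply: (@derive1_locally_cst _ _ _ 0); near=> y; apply: z0.
  have yd : y < d by near: y; exact: lt_nbhsl.
  by rewrite leNgt yd.
- apply: (@derive1_locally_cst _ _ _ 0); near=> y; apply: z0.
  have Sy : S < y by near: y; exact: lt_nbhsr.
  by rewrite andbC leNgt Sy.
Unshelve. all: by end_near. Qed.

Section weak_cone_form.
Context {R : realType} {n : nat}.
Local Notation V := ('rV[R]_n * R)%type.
Local Notation VM := ('rV[R]_n * measurableTypeR R)%type.
Local Notation Lam := (spacetime_lebesgue R n).
Variables (p rho : R) (T : \bar R) (f g : 'rV[R]_n -> R) (u v : R -> 'rV[R]_n -> R).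
Hypotheses (p1 : 1 < p) (rho0 : 0 < rho) (sol : weak_solution p T f g u v).
Hypothesis supp : support_curve T u v `<=` light_cone rho.
Variables (d S : R).
Hypotheses (d0 : 0 < d) (dS : d <= S) (ST : (S%:E < T)%E).
Local Notation Z := (@cone_slice R n rho 0 d S).

(** The product [zeta * Phi] is an admissible test function: [zeta] confines it in time and the
    vanishing of [Phi] for small [q] confines it in space. [Phi] may fail the wave equation outside
    the slice, but there the integrand is zero almost everywhere, so only the terms with derivatives
    of [zeta] remain. *)
Lemma weak_cone_form (zeta : R -> R) (Phi : V -> R) :
  elem_smooth zeta -> elem_smooth Phi ->
  measurable_fun setT (Phi : VM -> R) -> measurable_fun setT (dt Phi : VM -> R) ->
  measurable_fun setT (wave_op Phi : VM -> R) ->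
  (forall z : V, 0 <= z.2 -> cone_form (rho + 1) z <= 2^-1 -> Phi z = 0) ->
  (forall z : V, Z z -> wave_op Phi z = 0) ->
  (forall t, ~ (d <= t <= S) -> zeta t = 0) ->
  \int[Lam]_(z in Z) (u z.2 z.1 *
    (derive1 (derive1 zeta) z.2 * Phi z + 2 * derive1 zeta z.2 * dt Phi z)) =
  \int[Lam]_(z in Z) (`|u z.2 z.1| `^ p * (zeta z.2 * Phi z)).
Proof.
move=> hz hP mP mdP mwP P0 wP z0.
pose phi z := zeta z.2 * Phi z.
have hphi : elem_smooth (phi : V -> R) by exact: es_time_mul.
have sub : [set z : V | phi z != 0] `<=` cone_slice (rho + 1) 2^-1 d S.
  move=> z /=; rewrite mulf_eq0 negb_or => /andP[zn0 Pn0].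
  have dzS : d <= z.2 <= S.
    by apply: contrapT => /z0 E; rewrite E eqxx in zn0.
  split => //; rewrite lerBrDr addrC -lerBrDr -/(cone_form (rho + 1) z).
  rewrite leNgt; apply/negP => h; move: Pn0; rewrite P0 ?eqxx ?(ltW h)//.
  by move/andP: dzS => [dz _]; rewrite (le_trans (ltW d0)).
have subc : closure [set z : V | phi z != 0] `<=` cone_slice (rho + 1) 2^-1 d S.
  rewrite [X in _ `<=` X](closure_id _).1; last exact: cone_slice_closed.
  exact: closure_subset.
have tphi : test_function (slab T) (phi : V -> R).
  split; first exact: es_smooth.
    apply: (subclosed_compact _ _ subc); first exact: closed_closure.
    apply: cone_slice_compact; last exact: ltW.
      exact: addr_ge0 (ltW rho0) ler01.
    by rewrite invr_ge0.
  by move=> z zc; apply: (cone_slice_slab d0 ST); exact: subc zc.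
have [_ /(_ _ tphi)] := sol_equation sol.
have wE z : wave_op phi z = derive1 (derive1 zeta) z.2 * Phi z +
    2 * derive1 zeta z.2 * dt Phi z + zeta z.2 * wave_op Phi z.
  exact: (wave_op_time_mul z hz hP).
have mz := measurable_comp_time (es_measurable hz) (n := n).
have mz1 := measurable_comp_time (es_measurable (es_derive1 hz)) (n := n).
have mz2 := measurable_comp_time (es_measurable (es_derive1 (es_derive1 hz))) (n := n).
have mw : measurable_fun setT (wave_op phi : VM -> R).
  have -> : wave_op phi = (fun z : VM => derive1 (derive1 zeta) z.2 * Phi z +
    2 * derive1 zeta z.2 * dt Phi z + zeta z.2 * wave_op Phi z) :> (VM -> R).
    by apply/funext => z; exact: wE.
  apply: measurable_funD; last exact: measurable_funM.
  apply: measurable_funD; apply: measurable_funM => //.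
  exact: measurable_funM.
have ms := measurable_slab (n := n) T.
rewrite (slab_to_cone rho0 sol supp d0 ST); last 3 first.
- apply: measurable_funM; first exact: measurable_u sol _ _.
  exact: measurable_funTS.
- by move=> z _ ->; rewrite mul0r.
- move=> z _ nz; rewrite wE (z0 _ nz) mul0r addr0.
  have z1 := derive1_outside z0.
  by rewrite (derive1_outside z1 nz) (z1 _ nz) mul0r mulr0 mul0r addr0 mulr0.
rewrite (slab_to_cone rho0 sol supp d0 ST); last 3 first.
- apply: measurable_funM; first exact: measurable_up sol _ _.
  by apply: measurable_funTS; exact: measurable_funM.
- by move=> z _ ->; rewrite normr0 powR0 ?mul0r// gt_eqF// (lt_trans ltr01).
- by move=> z _ nz; rewrite /phi (z0 _ nz) mul0r mulr0.
move=> E; rewrite -E; apply: eq_Rintegral => z; rewrite inE => Zz.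
by rewrite wE wP// mulr0 addr0.
Qed.

End weak_cone_form.

(** * Multipliers *)

Section wave_multipliers.
Context {R : realType} {n : nat}.
Local Notation V := ('rV[R]_n * R)%type.
Local Notation VM := ('rV[R]_n * measurableTypeR R)%type.
Implicit Types (rho c M : R) (z : V).

(** What testing requires of both multipliers, so that the energy inequality is proved once. The
    bounds are asked for [t <= 1] only, since the initial cutoff varies there: [c] becomes the
    coefficient of the data, while [M] controls an error. *)
Record wave_multiplier rho c M (Phi : V -> R) : Prop := WaveMultiplier {
  wm_smooth : elem_smooth Phi ;
  wm_measurable : measurable_fun setT (Phi : VM -> R) ;
  wm_measurable_dt : measurable_fun setT (dt Phi : VM -> R) ;
  wm_measurable_wave : measurable_fun setT (wave_op Phi : VM -> R) ;
  wm_support : forall z, 0 <= z.2 -> cone_form (rho + 1) z <= 2^-1 -> Phi z = 0 ;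
  wm_wave : forall z, 0 <= z.2 -> sqnorm z.1 <= (z.2 + rho) ^+ 2 ->
    wave_op Phi z = 0 ;
  wm_bound : forall z, 0 <= z.2 <= 1 -> sqnorm z.1 <= (z.2 + rho) ^+ 2 ->
    c <= Phi z <= M ;
  wm_bound_dt : forall z, 0 <= z.2 <= 1 -> sqnorm z.1 <= (z.2 + rho) ^+ 2 ->
    - M <= dt Phi z <= 0 }.

Lemma measurable_dt_cone_test a (eta h : R -> R) : elem_smooth eta -> elem_smooth h ->
  measurable_fun setT (dt (@cone_test R n a eta h) : VM -> R).
Proof.
move=> he hh; rewrite (dt_cone_test a he hh).
apply: measurable_funD; apply: measurable_cone_test; do ?exact: es_derive1; first by [].
apply: es_mul => //; have -> : (fun t => 2 * (t + a)) = (fun t => 2 * t + 2 * a).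
  by apply/funext => t; rewrite mulrDr.
exact: es_affine.
Qed.

Lemma measurable_wave_op_cone_test a (eta h : R -> R) : elem_smooth eta -> elem_smooth h ->
  measurable_fun setT (wave_op (@cone_test R n a eta h) : VM -> R).
Proof.
move=> he hh; have he1 := es_derive1 he; have hh1 := es_derive1 hh.
pose q : VM -> R := cone_form a.
have mq : measurable_fun setT q by exact: measurable_cone_form.
have mhq (k : R -> R) : elem_smooth k -> measurable_fun setT (fun z : VM => k (q z)).
  by move=> hk; exact: (measurableT_comp (es_measurable hk) mq).
have mt (k : R -> R) : elem_smooth k -> measurable_fun setT (fun z : VM => k z.2).
  by move=> hk; exact: measurable_comp_time (es_measurable hk).
have -> : wave_op (@cone_test R n a eta h) = (fun z : VM =>
    derive1 (derive1 eta) z.2 * h (q z) +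
    (4 * z.2 + 4 * a) * derive1 eta z.2 * derive1 h (q z) +
    eta z.2 * ((2 * n%:R + 2) * derive1 h (q z) +
               4 * q z * derive1 (derive1 h) (q z))) :> (VM -> R).
  by apply/funext => z; rewrite wave_op_cone_test// -mulrDr.
apply: measurable_funD; first apply: measurable_funD.
- by apply: measurable_funM; [apply: mt; exact: es_derive1|exact: mhq].
- apply: measurable_funM; last exact: mhq.
  apply: measurable_funM; last exact: mt.
  exact: (mt _ (es_affine 4 (4 * a))).
- apply: measurable_funM; first exact: mt.
  apply: measurable_funD; apply: measurable_funM => //; first exact: mhq.
    exact: measurable_funM.
  by apply: mhq; exact: es_derive1.
Qed.

Lemma cone_form_ge1 rho z : 0 < rho -> 0 <= z.2 ->
  sqnorm z.1 <= (z.2 + rho) ^+ 2 -> 1 <= cone_form (rho + 1) z.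
Proof. by rewrite /cone_form => r0 z0 zr; nra. Qed.

Lemma cone_form_le a z : cone_form a z <= (z.2 + a) ^+ 2.
Proof. by rewrite /cone_form lerBlDr lerDl sqnorm_ge0. Qed.

(** The constant 1 on the cone, written as the power 0 of [q] so that the profile still cuts it to
    zero for [q <= 1/2]. *)
Definition multiplier0 rho : V -> R :=
  cone_test (rho + 1) (fun=> 1) (power_profile 0).

Lemma multiplier0E rho z : 0 < rho -> 0 <= z.2 ->
  sqnorm z.1 <= (z.2 + rho) ^+ 2 ->
  [/\ multiplier0 rho z = 1, dt (multiplier0 rho) z = 0 & wave_op (multiplier0 rho) z = 0].
Proof.
move=> r0 z0 zr; have q1 := cone_form_ge1 r0 z0 zr.
have q34 : 3 / 4 < cone_form (rho + 1) z by lra.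
have e1 : elem_smooth (fun _ : R => 1 : R) by exact: es_cst.
have e2 := @es_power_profile R 0.
have dc : derive1 (fun _ : R => 1 : R) = (fun=> 0) by apply/funext => x; exact: derive1_cst.
have dc2 : derive1 (fun _ : R => 0 : R) = (fun=> 0) by apply/funext => x; exact: derive1_cst.
split.
- by rewrite /multiplier0 /cone_test power_profile_ge ?ltW// oppr0 powRr0 mulr1.
- rewrite (dt_cone_test _ e1 e2) !fctE /cone_test dc power_profile_derive1//.
  by rewrite !(mul0r, oppr0, mulr0, addr0).
- rewrite (wave_op_cone_test _ _ e1 e2) dc dc2.
  rewrite power_profile_derive1// power_profile_derive2//.
  by rewrite !(mul0r, oppr0, mulr0, addr0).
Qed.

Lemma wave_multiplier0 rho M : 0 < rho -> 1 <= M -> wave_multiplier rho 1 M (multiplier0 rho).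
Proof.
move=> r0 M1.
have e1 : elem_smooth (fun _ : R => 1 : R) by exact: es_cst.
have e2 := @es_power_profile R 0.
split.
- exact: es_cone_test.
- exact: measurable_cone_test.
- exact: measurable_dt_cone_test.
- exact: measurable_wave_op_cone_test.
- by move=> z _ q; rewrite /multiplier0 /cone_test power_profile_le// mulr0.
- by move=> z z0 zr; have [] := multiplier0E r0 z0 zr.
- by move=> z /andP[z0 _] zr; have [-> _ _] := multiplier0E r0 z0 zr; rewrite lexx.
- move=> z /andP[z0 _] zr; have [_ -> _] := multiplier0E r0 z0 zr.
  by rewrite lexx oppr_le0 (le_trans ler01).
Qed.

Let m : R := (n%:R + 1) / 2.

Let m_gt0 : 0 < m.
Proof. by rewrite /m divr_gt0// ltr_wpDl. Qed.

Let two_m : 2 * m = n%:R + 1.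
Proof. by rewrite /m; field. Qed.

(* On the cone this is [tau (tau^2 - |x|^2)^(-(n+1)/2)] with [tau = t + rho + 1],
   which up to a factor is the time derivative of the fundamental-type solution
   [(tau^2 - |x|^2)^(-(n-1)/2)] of the wave equation. *)
Definition multiplier1 rho : V -> R :=
  cone_test (rho + 1) (fun t => t + (rho + 1)) (power_profile m).

(** For [tau * q^(-m)] the wave operator gives [m * tau * (4 * (m + 1) - (2 * n + 6)) * q^(-m-1)],
    and this forces [m = (n + 1) / 2]. *)
Lemma multiplier1E rho z (tau := z.2 + (rho + 1)) (q := cone_form (rho + 1) z) :
  0 < rho -> 0 <= z.2 -> sqnorm z.1 <= (z.2 + rho) ^+ 2 ->
  [/\ multiplier1 rho z = tau * q `^ (- m),
      dt (multiplier1 rho) z = q `^ (- m) - 2 * m * tau ^+ 2 * q `^ (- m - 1) &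
      wave_op (multiplier1 rho) z = 0].
Proof.
move=> r0 z0 zr; have q1 := cone_form_ge1 r0 z0 zr.
have q34 : 3 / 4 < cone_form (rho + 1) z by lra.
have e1 : elem_smooth (fun t : R => t + (rho + 1)).
  by apply: es_add; [exact: es_id|exact: es_cst].
have e2 := @es_power_profile R m.
have dc : derive1 (fun t : R => t + (rho + 1)) = (fun=> 1).
  apply/funext => x; apply: derive1_val.
  by apply: is_derive_eq; rewrite addr0.
have dc2 : derive1 (fun _ : R => 1 : R) = (fun=> 0) by apply/funext => x; exact: derive1_cst.
split.
- by rewrite /multiplier1 /cone_test power_profile_ge ?ltW.
- rewrite (dt_cone_test _ e1 e2) !fctE /cone_test dc power_profile_derive1//.
  by rewrite power_profile_ge ?ltW// -/tau -/q; ring.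
- rewrite (wave_op_cone_test _ _ e1 e2) dc dc2.
  rewrite power_profile_derive1// power_profile_derive2// -/tau -/q.
  have -> : 4 * q * (m * (m + 1) * q `^ (- m - 2)) = 4 * m * (m + 1) * q `^ (- m - 1).
    have -> : - m - 1 = 1 + (- m - 2) :> R by ring.
    rewrite [q `^ (1 + _)]powRD; last by rewrite (gt_eqF (lt_le_trans ltr01 q1)) implybT.
    by rewrite powRr1 ?(le_trans ler01)//; ring.
  have -> : n%:R = 2 * m - 1 :> R by rewrite two_m addrK.
  by ring.
Qed.

(** For [0 <= t <= 1] one has [1 <= q <= tau^2 <= (1 + a)^2] and [1 <= tau <= 1 + a], whence both
    constants. The time derivative is [q^(-m-1) * (q - (n + 1) * tau^2)], which is nonpositive
    because [q <= tau^2]. *)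
Lemma wave_multiplier1 rho (a := rho + 1) : 0 < rho ->
  wave_multiplier rho (((1 + a) ^+ 2) `^ (- m)) (1 + a + 2 * m * (1 + a) ^+ 2)
    (multiplier1 rho).
Proof.
move=> r0.
have e1 : elem_smooth (fun t : R => t + (rho + 1)).
  by apply: es_add; [exact: es_id|exact: es_cst].
have e2 := @es_power_profile R m.
have aux z : 0 <= z.2 <= 1 -> sqnorm z.1 <= (z.2 + rho) ^+ 2 ->
    [/\ 1 <= cone_form a z, cone_form a z <= (z.2 + a) ^+ 2 &
        1 <= z.2 + a <= 1 + a].
  move=> /andP[z0 z1] zr; split; [exact: cone_form_ge1|exact: cone_form_le|].
  by rewrite /a; apply/andP; split; lra.
split.
- exact: es_cone_test.
- exact: measurable_cone_test.
- exact: measurable_dt_cone_test.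
- exact: measurable_wave_op_cone_test.
- by move=> z _ q; rewrite /multiplier1 /cone_test power_profile_le// mulr0.
- by move=> z z0 zr; have [] := multiplier1E r0 z0 zr.
- move=> z z01 zr; have [q1 qt /andP[t1 ta]] := aux z z01 zr.
  have z0 : 0 <= z.2 by case/andP: z01.
  have [-> _ _] := multiplier1E r0 z0 zr; rewrite -/a.
  set q := cone_form a z in q1 qt *; set tau := z.2 + a in qt t1 ta *.
  have qm : q `^ (- m) <= 1.
    by rewrite -[leRHS](powRr0 q) ler_powR// oppr_le0 ltW.
  have q0 : 0 <= q `^ (- m) by exact: powR_ge0.
  apply/andP; split.
    apply: (@le_trans _ _ (q `^ (- m))); last by rewrite ler_peMl.
    rewrite !powRN lef_pV2 ?posrE ?powR_gt0//; last 2 first.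
      by rewrite exprn_gt0//; lra.
      by lra.
    apply: ge0_ler_powR; rewrite ?nnegrE ?sqr_ge0//; [exact: ltW|exact: le_trans q1|].
    rewrite (le_trans qt)// ler_sqr ?nnegrE//.
      exact: le_trans t1.
    by rewrite addr_ge0// addr_ge0 ?ltW.
  apply: (@le_trans _ _ tau); first exact: ler_piMr (le_trans ler01 t1) qm.
  by rewrite (le_trans ta)// lerDl mulr_ge0 ?sqr_ge0// mulr_ge0// ltW.
- move=> z z01 zr; have [q1 qt /andP[t1 ta]] := aux z z01 zr.
  have z0 : 0 <= z.2 by case/andP: z01.
  have [_ -> _] := multiplier1E r0 z0 zr; rewrite -/a.
  set q := cone_form a z in q1 qt *; set tau := z.2 + a in qt t1 ta *.
  have q0 : 0 <= q `^ (- m) by exact: powR_ge0.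
  have q10 : 0 <= q `^ (- m - 1) by exact: powR_ge0.
  have qm1 : q `^ (- m - 1) <= 1.
    by rewrite -[leRHS](powRr0 q) ler_powR// -opprD oppr_le0 addr_ge0// ltW.
  have E : q `^ (- m) = q * q `^ (- m - 1).
    have {1}-> : - m = 1 + (- m - 1) :> R by ring.
    rewrite [q `^ (1 + _)]powRD; last by rewrite (gt_eqF (lt_le_trans ltr01 q1)) implybT.
    by rewrite powRr1//; lra.
  have n0 : 0 <= n%:R :> R by [].
  have t2 : 0 <= tau ^+ 2 by rewrite sqr_ge0.
  have ta2 : tau ^+ 2 <= (1 + a) ^+ 2 by rewrite ler_sqr ?nnegrE//; lra.
  apply/andP; split.
    have : 2 * m * tau ^+ 2 * q `^ (- m - 1) <= 2 * m * (1 + a) ^+ 2 * 1.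
      apply: ler_pM => //; first by rewrite mulr_ge0// mulr_ge0// ltW.
      by rewrite ler_wpM2l// mulr_ge0// ltW.
    by lra.
  rewrite E -mulrBl mulr_le0_ge0//; rewrite two_m; nra.
Qed.

(** Since [q = (tau - |x|) * (tau + |x|) >= sigma * tau], negative powers of [q] split. The time
    derivative decays no worse than the multiplier, because [tau] and [sigma] are at least 1;
    [n + 2] adds the coefficients 1 and [2 * m = n + 1] of its two terms. *)
Lemma multiplier1_decay rho z (tau := z.2 + (rho + 1))
    (sigma := tau - euclidean_norm z.1) :
  0 < rho -> 0 <= z.2 -> sqnorm z.1 <= (z.2 + rho) ^+ 2 ->
  `|multiplier1 rho z| <= (n%:R + 2) * (tau `^ (1 - m) * sigma `^ (- m)) /\
  `|dt (multiplier1 rho) z| <= (n%:R + 2) * (tau `^ (1 - m) * sigma `^ (- m)).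
Proof.
move=> r0 z0 zr; have [-> -> _] := multiplier1E r0 z0 zr.
have q1 := cone_form_ge1 r0 z0 zr; rewrite -/tau.
have tau1 : 1 <= tau by rewrite /tau; lra.
have tau0 : 0 < tau by lra.
have sg1 : 1 <= sigma.
  have : euclidean_norm z.1 <= z.2 + rho by rewrite euclidean_norm_le//; lra.
  by rewrite /sigma /tau; lra.
have sg0 : 0 < sigma by lra.
set q := cone_form _ z in q1 *.
have en0 : 0 <= euclidean_norm z.1 by exact: sqrtr_ge0.
have qst : sigma * tau <= q.
  rewrite /q /cone_form -/tau /sigma.
  have -> : sqnorm z.1 = euclidean_norm z.1 ^+ 2 by rewrite sqr_sqrtr// sqnorm_ge0.
  have : euclidean_norm z.1 <= tau by rewrite -subr_ge0 ltW.
  by nra.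
have dec b : 0 <= b -> q `^ (- b) <= sigma `^ (- b) * tau `^ (- b).
  move=> b0; have q0 : 0 < q by exact: lt_le_trans q1.
  rewrite -powRM ?(ltW sg0) ?(ltW tau0)// !powRN.
  rewrite lef_pV2 ?posrE ?powR_gt0 ?mulr_gt0//.
  by apply: ge0_ler_powR => //; rewrite nnegrE ltW// mulr_gt0.
have E1 : tau `^ (1 - m) = tau * tau `^ (- m).
  by rewrite powRD ?(gt_eqF tau0) ?implybT// powRr1// ltW.
have E2 : tau `^ (1 - m) = tau ^+ 2 * tau `^ (- (m + 1)).
  have {1}-> : 1 - m = 2 + (- (m + 1)) :> R by ring.
  by rewrite powRD ?(gt_eqF tau0) ?implybT// -powR_mulrn// ltW.
have P0 : 0 <= tau `^ (1 - m) * sigma `^ (- m) by rewrite mulr_ge0 ?powR_ge0.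
have A : tau * q `^ (- m) <= tau `^ (1 - m) * sigma `^ (- m).
  rewrite E1 -mulrA ler_wpM2l ?(ltW tau0)// mulrC.
  exact: dec (ltW m_gt0).
have B : tau ^+ 2 * q `^ (- m - 1) <= tau `^ (1 - m) * sigma `^ (- m).
  rewrite E2 -mulrA ler_wpM2l ?sqr_ge0// -opprD.
  apply: le_trans (dec (m + 1) _) _; first by rewrite addr_ge0 ?(ltW m_gt0).
  by rewrite mulrC ler_wpM2l ?powR_ge0// ler_powR// lerN2 lerDl.
have C : q `^ (- m) <= tau * q `^ (- m) by rewrite ler_peMl ?powR_ge0.
have n0 : 0 <= n%:R :> R by [].
have q0 : 0 <= q `^ (- m) by exact: powR_ge0.
have q10 : 0 <= q `^ (- m - 1) by exact: powR_ge0.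
move: P0 A B C; set P := _ * sigma `^ _ => P0 A B C.
have t20 : 0 <= tau ^+ 2 * q `^ (- m - 1) by rewrite mulr_ge0 ?sqr_ge0.
split.
  rewrite ger0_norm ?mulr_ge0 ?(ltW tau0)// (le_trans A)//.
  by rewrite ler_peMl//; lra.
rewrite (le_trans (ler_normB _ _))// ger0_norm//.
have m20 : 0 <= 2 * m by rewrite mulr_ge0// ltW.
rewrite -[2 * m * _ * _]mulrA (ger0_norm (mulr_ge0 m20 t20)) two_m.
have : (n%:R + 1) * (tau ^+ 2 * q `^ (- m - 1)) <= (n%:R + 1) * P.
  by rewrite ler_wpM2l//; lra.
by lra.
Qed.

End wave_multipliers.

(** * Fubini estimates and square-integrable functions *)

Section product_integrals.
Context {R : realType} {n : nat}.
Local Notation VM := ('rV[R]_n * measurableTypeR R)%type.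
Local Notation Lam := (spacetime_lebesgue R n).
Local Notation nu := (lebesgue_rV R n).
Local Notation leb := (@lebesgue_measure R).
Implicit Types (A : set 'rV[R]_n) (B : set (measurableTypeR R)) (F : VM -> R).

Let patchX A B F z :
  ((EFin \o F) \_ (A `*` B)) z =
  (((fun x => (((fun t => (F (x, t))%:E) \_ B) z.2)) \_ A) z.1).
Proof.
case: z => x t; rewrite !patchE /= in_setX.
by case: (x \in A) => //=.
Qed.

Lemma tonelli_time_le A B F (K : R) : measurable A -> measurable B ->
  measurable_fun (A `*` B) F -> (forall z, (A `*` B) z -> 0 <= F z) ->
  (forall t, B t -> (\int[nu]_(x in A) (F (x, t))%:E <= K%:E)%E) ->
  (\int[Lam]_(z in A `*` B) (F z)%:E <= K%:E * leb B)%E.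
Proof.
move=> mA mB mF F0 hK; rewrite integral_mkcond.
have mAB : measurable (A `*` B) by exact: measurableX.
have mP : measurable_fun setT ((EFin \o F) \_ (A `*` B)).
  by apply/(measurable_restrictT _ _).1; [exact: mAB|exact/measurable_EFinP].
have P0 z : (0 <= ((EFin \o F) \_ (A `*` B)) z)%E.
  by rewrite patchE; case: ifPn => //; rewrite inE => /F0; rewrite lee_fin.
have := @fubini_tonelli2 _ _ _ (measurableTypeR R) R nu leb _ mP P0.
rewrite /spacetime_lebesgue => ->.
rewrite -integral_cst// [leRHS]integral_mkcond.
apply: ge0_le_integral => //.
- by move=> t _; apply: integral_ge0.
- exact: measurable_fun_fubini_tonelli_G.
- by apply/(measurable_restrictT _ _).1; [exact: mB|exact: measurable_cst].
move=> t _; rewrite /fubini_G.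
under eq_integral do rewrite patchX.
rewrite -integral_mkcond patchE; case: ifPn => tB.
  apply: le_trans (hK t _); last by rewrite inE in tB.
  by rewrite (eq_integral (fun x => (F (x, t))%:E)) => // x _; rewrite patchE/= tB.
by rewrite integral0_eq// => x _; rewrite patchE/= (negbTE tB).
Qed.

Lemma tonelli_space_le A B F (K : R) : measurable A -> measurable B ->
  measurable_fun (A `*` B) F -> (forall z, (A `*` B) z -> 0 <= F z) ->
  (forall x, A x -> (\int[leb]_(t in B) (F (x, t))%:E <= K%:E)%E) ->
  (\int[Lam]_(z in A `*` B) (F z)%:E <= K%:E * nu A)%E.
Proof.
move=> mA mB mF F0 hK; rewrite integral_mkcond.
have mAB : measurable (A `*` B) by exact: measurableX.
have mP : measurable_fun setT ((EFin \o F) \_ (A `*` B)).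
  by apply/(measurable_restrictT _ _).1; [exact: mAB|exact/measurable_EFinP].
have P0 z : (0 <= ((EFin \o F) \_ (A `*` B)) z)%E.
  by rewrite patchE; case: ifPn => //; rewrite inE => /F0; rewrite lee_fin.
have := @fubini_tonelli1 _ _ _ (measurableTypeR R) R nu leb _ mP P0.
rewrite /spacetime_lebesgue => ->.
rewrite -integral_cst// [leRHS]integral_mkcond.
apply: ge0_le_integral => //.
- by move=> t _; apply: integral_ge0.
- exact: measurable_fun_fubini_tonelli_F.
- by apply/(measurable_restrictT _ _).1; [exact: mA|exact: measurable_cst].
move=> x _; rewrite /fubini_F.
under eq_integral do rewrite patchX.
rewrite patchE; case: ifPn => xA.
  apply: le_trans (hK x _); last by rewrite inE in xA.
  rewrite [leRHS]integral_mkcond le_eqVlt; apply/orP; left; apply/eqP.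
  by apply: eq_integral => t _; rewrite /= [in LHS]patchE xA.
by rewrite integral0_eq// => t _; rewrite patchE/= (negbTE xA).
Qed.

(** The version for integrands without sign, such as those containing [rise'']: integrability takes
    the place of positivity. *)
Lemma fubini_le A B F (G : 'rV[R]_n -> R) : measurable A -> measurable B ->
  Lam.-integrable (A `*` B) (EFin \o F) -> nu.-integrable A (EFin \o G) ->
  (forall x, A x -> (\int[leb]_(t in B) (F (x, t))%:E <= (G x)%:E)%E) ->
  \int[Lam]_(z in A `*` B) F z <= \int[nu]_(x in A) G x.
Proof.
move=> mA mB iF iG hFG.
have mAB : measurable (A `*` B) by exact: measurableX.
apply: fine_le.
- exact: integrable_fin_num iF.
- exact: integrable_fin_num iG.
rewrite integral_mkcond [leRHS]integral_mkcond.
have iP : Lam.-integrable setT ((EFin \o F) \_ (A `*` B)).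
  by apply/(integrable_mkcond _ _).1.
have := @integral12_prod_meas1 _ _ _ (measurableTypeR R) R nu leb _ iP.
rewrite /spacetime_lebesgue => <-.
apply: le_integral => //.
- exact: (@integrable_fubini_F _ _ _ (measurableTypeR R) R nu leb _ iP).
- by apply/(integrable_mkcond _ _).1.
move=> x _; rewrite /fubini_F.
under eq_integral do rewrite patchX.
rewrite patchE; case: ifPn => xA.
  apply: le_trans (hFG x _); last by rewrite inE in xA.
  rewrite [leRHS]integral_mkcond le_eqVlt; apply/orP; left; apply/eqP.
  by apply: eq_integral => t _; rewrite /= [in LHS]patchE xA.
by rewrite integral0_eq// => t _; rewrite patchE/= (negbTE xA).
Qed.

End product_integrals.

Section square_integrable.
Context {R : realType} {n : nat}.
Local Notation nu := (lebesgue_rV R n).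
Implicit Types (w : 'rV[R]_n -> R) (A : set 'rV[R]_n).

Lemma L2_measurable w : L2 w -> measurable_fun setT w.
Proof. by rewrite /L2 inE => /andP[/[!inE]]. Qed.

Lemma L2_fin_num w : L2 w -> ('N[nu]_2%:E[EFin \o w] \is a fin_num)%E.
Proof.
rewrite /L2 inE => /andP[_ /[!inE]] /= h.
by rewrite ge0_fin_numE ?Lnorm_ge0.
Qed.

Lemma L2_lin (a b : R) w1 w2 : L2 w1 -> L2 w2 -> L2 (fun x => a * w1 x + b * w2 x).
Proof.
have p1 : (1 <= 2%:E :> \bar R)%E by rewrite lee_fin ler1n.
move=> h1 h2; have [h0 hl] := Lfun_submod_closed nu p1.
have h2' : (b *: w2 : 'rV[R]_n -> R) \in Lfun nu 2%:E.
  by have := hl b _ _ h2 h0; rewrite addr0.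
exact: hl a _ _ h1 h2'.
Qed.

Lemma L2_integral_sqr w : L2 w ->
  (\int[nu]_x ((w x) ^+ 2)%:E = (L2norm w ^+ 2)%:E)%E.
Proof.
move=> hw; have fin := L2_fin_num hw.
have N0 : 0 <= L2norm w by rewrite fine_ge0// Lnorm_ge0.
have := @powR_Lnorm _ _ R nu (EFin \o w) 2 (_ : 2 != 0 :> R).
rewrite -(fineK fin) -/(L2norm w) poweR_EFin powR_mulrn// => -> //.
by apply: eq_integral => x _ /=; rewrite powR_mulrn// real_normK ?num_real.
Qed.

(** A substitute for the Cauchy-Schwarz inequality, from [|w| <= kappa + kappa^-1 * w^2] pointwise.
    Any positive [kappa] above the norm is allowed, so that a zero norm needs no separate case. *)
Lemma L2_integral_abs_le w A (kappa V : R) : L2 w -> measurable A ->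
  nu A = V%:E -> 0 < kappa -> L2norm w <= kappa ->
  (\int[nu]_(x in A) `|w x|%:E <= (kappa * (V + 1))%:E)%E.
Proof.
move=> hw mA nuA k0 wk.
have mw := L2_measurable hw.
have mwA : measurable_fun A w by exact: measurable_funTS.
have N0 : 0 <= L2norm w by rewrite fine_ge0// Lnorm_ge0.
apply: (@le_trans _ _ (\int[nu]_(x in A) (kappa%:E + kappa^-1%:E * (w x ^+ 2)%:E))%E).
  apply: ge0_le_integral => //.
  - by apply/measurable_EFinP; exact: measurableT_comp.
  - apply: emeasurable_funD => //; apply: emeasurable_funM => //.
    by apply/measurable_EFinP; exact: measurable_funX.
  - move=> x _; rewrite -EFinM -EFinD lee_fin.
    rewrite -(ler_pM2l k0) mulrDr mulrA divff ?gt_eqF// mul1r.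
    rewrite -(real_normK (num_real (w x))).
    have : 0 <= `|w x| by []; nra.
rewrite ge0_integralD//; last 3 first.
- by move=> x _; rewrite lee_fin ltW.
- by move=> x _; rewrite -EFinM lee_fin mulr_ge0 ?invr_ge0 ?sqr_ge0// ltW.
- by apply: emeasurable_funM => //; apply/measurable_EFinP; exact: measurable_funX.
have -> : (\int[nu]_(x in A) kappa%:E = (kappa * V)%:E)%E.
  by rewrite (integral_cst nu mA) EFinM -nuA.
rewrite ge0_integralZl//; last 3 first.
- by apply/measurable_EFinP; exact: measurable_funX.
- by move=> x _; rewrite lee_fin sqr_ge0.
- by rewrite lee_fin invr_ge0 ltW.
have h : (\int[nu]_(x in A) (w x ^+ 2)%:E <= (kappa ^+ 2)%:E)%E.
  apply: (@le_trans _ _ (\int[nu]_x ((w x) ^+ 2)%:E)%E).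
    apply: ge0_subset_integral => //.
      by apply/measurable_EFinP; exact: measurable_funX.
    by move=> x _; rewrite lee_fin sqr_ge0.
  by rewrite L2_integral_sqr// lee_fin ler_sqr ?nnegrE// ltW.
rewrite mulrDr mulr1 EFinD leeD2l//.
apply: (@le_trans _ _ (kappa^-1%:E * (kappa ^+ 2)%:E)%E).
  by apply: lee_wpmul2l => //; rewrite lee_fin invr_ge0 ltW.
by rewrite -EFinM lee_fin expr2 mulKf// gt_eqF.
Qed.

End square_integrable.

(** * Integration in time at a fixed point of space *)

Lemma es_time_section {R : realType} {n : nat} (Phi : 'rV[R]_n * R -> R) x :
  elem_smooth Phi -> elem_smooth (fun t : R => Phi (x, t)).
Proof.
elim=> {Phi}.
- by move=> k; exact: es_cst.
- move=> l ll _.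
  have -> : (fun t : R => l (x, t)) = (fun t => l ((0 : 'rV[R]_n), 1 : R) * t + l (x, 0)).
    apply/funext => t; rewrite mulrC -[t * _]/(t *: (l _ : R^o)) -ll.
    congr l; rewrite -[LHS]/(x, t) -[RHS]/(t *: 0 + x, t * 1 + 0).
    by rewrite scaler0 add0r mulr1 addr0.
  exact: es_affine.
- by move=> f g _ hf _ hg; exact: es_add.
- by move=> f g _ hf _ hg; exact: es_mul.
- by move=> a f f0 _ hf; exact: es_powR.
- by move=> P f _ hf; exact: es_flat.
Qed.

Section time_integration.
Context {R : realType} {n : nat}.
Local Notation V := ('rV[R]_n * R)%type.
Local Notation leb := (@lebesgue_measure R).

Lemma es_integrable_itv (g : R -> R) (a b : R) : elem_smooth g ->
  leb.-integrable `[a, b] (EFin \o g).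
Proof.
move=> hg; apply: continuous_compact_integrable; first exact: segment_compact.
by apply: continuous_subspaceT => x; exact: es_continuous.
Qed.

Lemma es_FTC (g : R -> R) (a b : R) : a < b -> elem_smooth g ->
  (\int[leb]_(t in `[a, b]) (derive1 g t)%:E = (g b - g a)%:E)%E.
Proof.
move=> ab hg; rewrite (@continuous_FTC2 _ (derive1 g) g a b)//.
- by apply: continuous_subspaceT => x; exact: es_continuous (es_derive1 hg) x.
- split.
  + by move=> x _; exact: es_derivable.
  + by apply: cvg_at_right_filter; exact: es_continuous hg a.
  + by apply: cvg_at_left_filter; exact: es_continuous hg b.
Qed.

(** The wave operator applied to [rise d * Phi], wherever [Phi] solves the wave equation. *)
Definition rise_kernel (d : R) (Phi : V -> R) (z : V) : R :=
  derive1 (derive1 (rise d)) z.2 * Phi z + 2 * derive1 (rise d) z.2 * dt Phi z.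

(* The integrand is at most the derivative of
   [(alpha + beta t) rise' Phi - beta c rise], since [dt Phi <= 0] and
   [c <= Phi] where [rise' <> 0]. *)
Lemma rise_kernel_integral_le rho c M (Phi : V -> R) (x : 'rV[R]_n) (d S alpha beta : R) :
  wave_multiplier rho c M Phi -> 0 < rho -> sqnorm x <= rho ^+ 2 ->
  0 <= alpha -> 0 <= beta -> 0 < d -> 3 * d < 1 -> 1 <= S ->
  (\int[leb]_(t in `[d, S]) ((alpha + beta * t) * rise_kernel d Phi (x, t))%:E <=
   (- (c * beta))%:E)%E.
Proof.
move=> wm rho0 xr a0 b0 d0 d1 S1.
have hP := wm_smooth wm.
have hPx := es_time_section x hP; have hdPx := es_time_section x (es_dt hP).
have hr := es_rise d; have hr1 := es_derive1 hr; have hr2 := es_derive1 hr1.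
pose E t := (beta * t + alpha) * (derive1 (rise d) t * Phi (x, t)) - (beta * c) * rise d t.
have haff := es_affine beta alpha.
have hE : elem_smooth E.
  apply: es_sub; first by apply: es_mul => //; exact: es_mul.
  by apply: es_mul => //; exact: es_cst.
have dS : d < S by lra.
have dE t : derive1 E t = beta * (derive1 (rise d) t * Phi (x, t)) +
    (beta * t + alpha) * (derive1 (derive1 (rise d)) t * Phi (x, t) +
      derive1 (rise d) t * dt Phi (x, t)) -
    (beta * c) * derive1 (rise d) t.
  apply: derive1_val.
  have i1 : is_derive t (1 : R) (fun t => beta * t + alpha) beta.
    by apply: is_derive_eq; rewrite /GRing.scale/=; ring.
  have i2 := is_deriveM (es_is_derive1 t hr1) (is_derive_time_section x t hP).
  have i3 := is_deriveM i1 i2.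
  have i4 := is_deriveZ (beta * c) (es_is_derive1 t hr).
  apply: is_derive_eq (is_deriveB i3 i4) _.
  rewrite /GRing.scale/= mulrfctE; ring.
(* The terms with [rise'] vanish at both ends; [rise d] goes from 0 to 1, so the last term of [E]
   alone gives [- c * beta]. *)
have -> : (- (c * beta))%:E = (\int[leb]_(t in `[d, S]) (derive1 E t)%:E)%E.
  rewrite es_FTC//; congr EFin; rewrite /E.
  have d2 : d < 2 * d by lra.
  have dS3 : 3 * d < S by lra.
  have [-> _] := rise_derive_lt d0 d2; have [-> _] := rise_derive_gt d0 dS3.
  rewrite (rise_le d0 (ltW d2)) (rise_ge d0 (ltW dS3)).
  by ring.
apply: le_integral => //.
- have hk : elem_smooth (fun t => (beta * t + alpha) * rise_kernel d Phi (x, t)).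
    apply: es_mul => //; rewrite /rise_kernel /=; apply: es_add; first exact: es_mul.
    by apply: es_mul => //; apply: es_mul => //; exact: es_cst.
  have -> : (fun t => ((alpha + beta * t) * rise_kernel d Phi (x, t))%:E) =
      EFin \o (fun t => (beta * t + alpha) * rise_kernel d Phi (x, t)).
    by apply/funext => t; rewrite /= addrC.
  exact: es_integrable_itv.
- exact: (es_integrable_itv d S (es_derive1 hE)).
move=> t; rewrite inE /= in_itv/= => /andP[td tS]; rewrite lee_fin dE /rise_kernel /=.
have r0 := rise_derive1_ge0 t d0.
have [t1|t1] := leP t (3 * d); last first.
  have [-> ->] := rise_derive_gt d0 t1.
  by rewrite !(mul0r, mulr0, addr0, subr0).
have t01 : 0 <= (x, t).2 <= 1 by apply/andP; split => /=; lra.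
have xt : sqnorm (x, t).1 <= ((x, t).2 + rho) ^+ 2.
  by rewrite (le_trans xr)// ler_sqr ?nnegrE /=; lra.
have /andP[cP _] := wm_bound wm t01 xt.
have /andP[_ dP] := wm_bound_dt wm t01 xt.
rewrite -subr_ge0.
set r1 := derive1 (rise d) t in r0 *; set r2 := derive1 (derive1 _) _.
rewrite [X in 0 <= X](_ : _ = beta * r1 * (Phi (x, t) - c) +
    (alpha + beta * t) * r1 * - dt Phi (x, t)); last by ring.
have t0 : 0 <= t by lra.
apply: addr_ge0; first by rewrite mulr_ge0 ?mulr_ge0 ?subr_ge0.
by rewrite mulr_ge0 ?oppr_ge0// mulr_ge0// addr_ge0// mulr_ge0.
Qed.

End time_integration.

(** * Boundary terms at the initial time *)

Section initial_data.
Context {R : realType} {n : nat}.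
Local Notation V := ('rV[R]_n * R)%type.
Local Notation VM := ('rV[R]_n * measurableTypeR R)%type.
Local Notation Lam := (spacetime_lebesgue R n).
Local Notation nu := (lebesgue_rV R n).
Local Notation leb := (@lebesgue_measure R).
Variables (p rho : R) (T : \bar R) (f g : 'rV[R]_n -> R) (u v : R -> 'rV[R]_n -> R).
Hypotheses (p1 : 1 < p) (rho0 : 0 < rho) (sol : weak_solution p T f g u v).
Hypothesis supp : support_curve T u v `<=` light_cone rho.
Hypothesis u0_ge0 : {ae nu, forall x, 0 <= u 0 x}.
Hypothesis v0_ge0 : {ae nu, forall x, 0 <= v 0 x}.

Definition data_ball : set 'rV[R]_n := [set x | sqnorm x <= rho ^+ 2].

Lemma measurable_data_ball : measurable data_ball.
Proof.
have -> : data_ball = sqnorm @^-1` `]-oo, rho ^+ 2]%classic.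
  by apply/seteqP; split => x; rewrite /data_ball /= in_itv.
by rewrite -[X in measurable X]setTI; exact: measurable_sqnorm.
Qed.

(* Representatives of the initial data that are nonnegative and supported in
   the ball everywhere rather than almost everywhere. *)
Definition data_rep (w : 'rV[R]_n -> R) x := `|w x| * \1_data_ball x.

Lemma data_rep_ge0 w x : 0 <= data_rep w x.
Proof. by rewrite mulr_ge0. Qed.

Lemma data_rep_out w x : ~ data_ball x -> data_rep w x = 0.
Proof. by move=> nx; rewrite /data_rep indicE memNset// mulr0. Qed.

Lemma data_rep_in w x : data_ball x -> data_rep w x = `|w x|.
Proof. by move=> nx; rewrite /data_rep indicE mem_set// mulr1. Qed.

Lemma measurable_data_rep w : L2 w -> measurable_fun setT (data_rep w).
Proof.
move=> hw; apply: measurable_funM.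
  by apply: measurableT_comp => //; exact: L2_measurable.
by apply: measurable_indic; exact: measurable_data_ball.
Qed.

Lemma time_interval0 : time_interval T 0.
Proof. by split => //; exact: sol_time_gt0 sol. Qed.

Lemma ae_data_rep_u : {ae nu, forall x, data_rep (u 0) x = u 0 x}.
Proof.
have out := ae_outside_u rho0 supp time_interval0.
apply: filterS2 out u0_ge0 => x hx ux.
have [xB|xB] := pselect (data_ball x); first by rewrite data_rep_in// ger0_norm.
by rewrite data_rep_out// hx// add0r ltNge; apply/negP.
Qed.

Lemma ae_data_rep_v : {ae nu, forall x, data_rep (v 0) x = v 0 x}.
Proof.
have out := ae_outside_v rho0 supp time_interval0.
apply: filterS2 out v0_ge0 => x hx ux.
have [xB|xB] := pselect (data_ball x); first by rewrite data_rep_in// ger0_norm.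
by rewrite data_rep_out// hx// add0r ltNge; apply/negP.
Qed.

Lemma L2_u0 : L2 (u 0). Proof. by have [] := sol_H1 sol time_interval0. Qed.
Lemma L2_v0 : L2 (v 0). Proof. exact: sol_L2 sol _ time_interval0. Qed.

(** The first-order Taylor remainder of [u] in time at 0. *)
Definition remainder (z : VM) : R :=
  u z.2 z.1 - (data_rep (u 0) z.1 + data_rep (v 0) z.1 * z.2).

Lemma measurable_remainder (D : set VM) : D `<=` slab T -> measurable_fun D remainder.
Proof.
move=> DT; apply: measurable_funB; first exact: measurable_u sol _ DT.
apply: measurable_funTS; apply: measurable_funD.
  exact: (measurableT_comp (measurable_data_rep L2_u0) measurable_fst).
apply: measurable_funM; last exact: measurable_time.
exact: (measurableT_comp (measurable_data_rep L2_v0) measurable_fst).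
Qed.

(** The [L^2] differentiability of the curve at 0 writes the remainder as [t * w] with the norm of
    [w] below [kappa]; [L2_integral_abs_le] converts this into an [L^1] bound on sets of finite
    measure. *)
Lemma remainder_small (kappa : R) : 0 < kappa -> exists2 e : R, 0 < e &
  forall t A (W : R), 0 < t -> t < e -> time_interval T t -> measurable A -> nu A = W%:E ->
  (\int[nu]_(x in A) `|remainder (x, t)|%:E <= (t * (kappa * (W + 1)))%:E)%E.
Proof.
move=> k0.
have := sol_derivative sol time_interval0 => /cvgr0_norm_lt /(_ _ k0).
rewrite near_withinE => /nbhs_ballP[e /= e0 he].
exists e => // t A W t0 te It mA nuA.
pose w x := (u t x - u 0 x) / (t - 0) - v 0 x.
have wk : L2norm w <= kappa.
  rewrite ltW// (le_lt_trans (ler_norm _))//; apply: he => //.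
    by rewrite /ball/= sub0r normrN gtr0_norm.
  by rewrite gt_eqF.
have hw : L2 w.
  have [h _] := sol_H1 sol It.
  have := L2_lin t^-1 (-1) (L2_lin 1 (-1) h L2_u0) L2_v0.
  congr L2; apply/funext => x; rewrite /w subr0; ring.
have mw := L2_measurable hw.
have mr : measurable_fun A (fun x => remainder (x, t)).
  apply: measurable_funB.
    by apply: measurable_funTS; apply: L2_measurable; have [] := sol_H1 sol It.
  apply: measurable_funTS; apply: measurable_funD; first exact: measurable_data_rep L2_u0.
  by apply: measurable_funM => //; exact: measurable_data_rep L2_v0.
rewrite (@ae_eq_integral _ _ _ nu A (fun x => t%:E * `|w x|%:E)%E)//; first last.
- apply: filterS2 ae_data_rep_u ae_data_rep_v => x ux vx _.
  rewrite /remainder /= ux vx /w subr0 -EFinM; congr EFin.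
  rewrite -[in RHS](gtr0_norm t0) -normrM (gtr0_norm t0); congr (`|_|).
  by field; rewrite gt_eqF.
- apply: emeasurable_funM => //; apply/measurable_EFinP; apply: measurableT_comp => //.
  exact: measurable_funTS.
- by apply/measurable_EFinP; exact: measurableT_comp.
rewrite ge0_integralZl//; last 2 first.
- apply/measurable_EFinP; apply: measurableT_comp => //.
  exact: measurable_funTS.
- by rewrite lee_fin ltW.
rewrite EFinM; apply: lee_wpmul2l; first by rewrite lee_fin ltW.
exact: L2_integral_abs_le.
Qed.

Lemma integrable_data_rep w (L a b : R) : 0 <= L -> L2 w ->
  Lam.-integrable (cube L `*` `[a, b]) (EFin \o (fun z : VM => data_rep w z.1)).
Proof.
move=> L0 hw.
have mC := @measurable_cube R n L.
have mab : measurable (`[a, b]%classic : set (measurableTypeR R)) by [].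
have mF : measurable_fun (cube L `*` `[a, b]%classic) (fun z : VM => data_rep w z.1).
  apply: measurable_funTS.
  exact: (measurableT_comp (measurable_data_rep hw) measurable_fst).
apply/integrableP; split; first exact/measurable_EFinP.
have N0 : 0 <= L2norm w by rewrite fine_ge0// Lnorm_ge0.
apply: (@le_lt_trans _ _ (((L2norm w + 1) * ((2 * L) ^+ n + 1))%:E * leb `[a, b]%classic)%E).
  under eq_integral do rewrite /= ger0_norm ?data_rep_ge0//.
  apply: tonelli_time_le => //; first by move=> z _; exact: data_rep_ge0.
  move=> t _; apply: le_trans
    (@L2_integral_abs_le _ _ w (cube L) _ _ hw mC (lebesgue_cube _) _ _) => //.
  - apply: ge0_le_integral => //.
    + by move=> x _; rewrite lee_fin data_rep_ge0.
    + by apply/measurable_EFinP; apply: measurable_funTS; exact: measurable_data_rep.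
    + apply/measurable_EFinP; apply: measurableT_comp => //.
      by apply: measurable_funTS; exact: L2_measurable.
    + by move=> x _; rewrite lee_fin /data_rep ler_piMr// indicE.
  - by rewrite ltr_wpDl.
  - by rewrite lerDl.
rewrite lte_mul_pinfty//.
  by rewrite lee_fin mulr_ge0 ?addr_ge0 ?exprn_ge0 ?mulr_ge0.
by rewrite lebesgue_measure_itv/=; case: ifPn => // _; rewrite -EFinB ltry.
Qed.

End initial_data.

(** * Testing the equation against a multiplier *)

Section energy_inequality.
Context {R : realType} {n : nat}.
Local Notation V := ('rV[R]_n * R)%type.
Local Notation VM := ('rV[R]_n * measurableTypeR R)%type.
Local Notation Lam := (spacetime_lebesgue R n).
Local Notation nu := (lebesgue_rV R n).
Local Notation leb := (@lebesgue_measure R).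
Variables (p rho : R) (T : \bar R) (f g : 'rV[R]_n -> R) (u v : R -> 'rV[R]_n -> R).
Hypotheses (p1 : 1 < p) (rho0 : 0 < rho) (sol : weak_solution p T f g u v).
Hypothesis supp : support_curve T u v `<=` light_cone rho.
Hypothesis u0_ge0 : {ae nu, forall x, 0 <= u 0 x}.
Hypothesis v0_ge0 : {ae nu, forall x, 0 <= v 0 x}.
Variables (c M : R) (Phi : V -> R).
Hypotheses (c0 : 0 < c) (M0 : 0 < M) (wm : wave_multiplier rho c M Phi).
Variable S : R.
Hypotheses (S1 : 1 <= S) (ST : (S%:E < T)%E).

Local Notation Z := (fun d : R => @cone_slice R n rho 0 d S : set VM).
Local Notation U0 := (data_rep rho (u 0)).
Local Notation V0 := (data_rep rho (v 0)).

Lemma es_bounded_cone (d : R) (w : V -> R) : 0 <= d -> elem_smooth w ->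
  exists B, forall z, Z d z -> `|w z| <= B.
Proof.
move=> d0 hw.
have cw : {within Z d, continuous w}.
  by apply: continuous_subspaceT => z; exact: es_continuous.
have cZ : compact (Z d : set V) by apply: cone_slice_compact => //; exact: ltW.
have [B [_ hB]] := compact_bounded (continuous_compact cw cZ).
by exists (B + 1) => z Zz; apply: (hB (B + 1)); [rewrite ltrDl|exists z].
Qed.

Lemma es_rise_kernel (d : R) : elem_smooth (rise_kernel d Phi).
Proof.
have hP := wm_smooth wm; have hr := es_rise d.
apply: es_add.
  by apply: es_mul => //; exact: es_comp (es_derive1 (es_derive1 hr)) es_time.
apply: es_mul; last exact: es_dt.
apply: es_mul; first exact: es_cst.
exact: es_comp (es_derive1 hr) es_time.
Qed.

Lemma measurable_rise_kernel (d : R) : measurable_fun setT (rise_kernel d Phi : VM -> R).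
Proof.
have hr := es_rise d; have h1 := es_derive1 hr; have h2 := es_derive1 h1.
apply: measurable_funD; apply: measurable_funM.
- exact: measurable_comp_time (es_measurable h2).
- exact: wm_measurable wm.
- by apply: measurable_funM => //; exact: measurable_comp_time (es_measurable h1).
- exact: wm_measurable_dt wm.
Qed.

Lemma integrable_cone_mul (d : R) (w F : V -> R) : 0 < d -> elem_smooth w ->
  measurable_fun setT (w : VM -> R) -> Lam.-integrable (Z d) (EFin \o (F : VM -> R)) ->
  Lam.-integrable (Z d) (EFin \o (fun z : VM => F z * w z)).
Proof.
move=> d0 hw mw iF; have [B hB] := es_bounded_cone (ltW d0) hw.
apply: (@integrable_bounded_mul _ _ _ _ _ _ _ B) => //.
- exact: measurable_cone_slice.
- exact: measurable_funTS.
Qed.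

Lemma rise_kernel_out (d : R) z : 0 < d -> ~ (2 * d <= z.2 <= 3 * d) ->
  rise_kernel d Phi z = 0.
Proof.
move=> d0 /negP; rewrite negb_and -!ltNge /rise_kernel => /orP[h|h].
- by have [-> ->] := rise_derive_lt d0 h; rewrite mulr0 !mul0r addr0.
- by have [-> ->] := rise_derive_gt d0 h; rewrite mulr0 !mul0r addr0.
Qed.

Lemma rise_kernel_bounded : exists2 Mk, 0 < Mk & forall d z, 0 < d -> 3 * d < 1 ->
  Z d z -> `|rise_kernel d Phi z| <= Mk / d ^+ 2.
Proof.
have [Mr Mr0 hr] := @rise_derive_bounded R.
exists (3 * (Mr * M)); first by rewrite !mulr_gt0.
move=> d z d0 d1 [/andP[dz zS]]; rewrite subr0 => zr.
have [hz|hz] := pselect (2 * d <= z.2 <= 3 * d); last first.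
  by rewrite rise_kernel_out// normr0 !mulr_ge0 ?invr_ge0 ?sqr_ge0 ?ltW.
have z01 : 0 <= z.2 <= 1.
  by move/andP: hz => [_ hz]; apply/andP; split; lra.
have [r1 r2] := hr d z.2 d0.
have /andP[cP PM] := wm_bound wm z01 zr.
have /andP[Md dP] := wm_bound_dt wm z01 zr.
have aP : `|Phi z| <= M by rewrite ger0_norm// (le_trans (ltW c0)).
have ad : `|dt Phi z| <= M by rewrite ler0_norm// lerNl.
rewrite /rise_kernel (le_trans (ler_normD _ _))// !normrM.
have n2 : `|2 : R| = 2 by rewrite ger0_norm.
have h1 : `|derive1 (derive1 (rise d)) z.2| * `|Phi z| <= Mr / d ^+ 2 * M.
  exact: ler_pM.
have h2 : `|derive1 (rise d) z.2| * `|dt Phi z| <= Mr / d * M by exact: ler_pM.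
have h3 : Mr / d * M <= Mr / d ^+ 2 * M.
  rewrite ler_pM2r// ler_pM2l// lef_pV2 ?posrE ?exprn_gt0//.
  by rewrite expr2 ler_piMl ?ltW//; lra.
rewrite n2 -mulrA.
have -> : 3 * (Mr * M) / d ^+ 2 = 3 * (Mr / d ^+ 2 * M) by ring.
lra.
Qed.

(** The powers of [d] cancel: the kernel is at most [Mk * d^-2], the space integral of the remainder
    is at most [3 * d] times a small factor, and the kernel lives on [[2 d, 3 d]], of length [d].
    The small factor is at disposal. *)
Lemma remainder_integral_small (K : R) : 0 < K -> exists2 e : R, 0 < e &
  forall d, 0 < d -> d < e ->
  `|\int[Lam]_(z in Z d) (remainder rho u v z * rise_kernel d Phi z)| <= K.
Proof.
move=> K0; have [Mk Mk0 hk] := rise_kernel_bounded.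
pose W := (2 * (1 + rho)) ^+ n.
have W0 : 0 <= W by rewrite exprn_ge0// mulr_ge0// addr_ge0// ltW.
(* Chosen so that the total is exactly [K]; the 3 comes from [t <= 3 * d], and [W] is the volume of
   a box containing the cone up to time 1. *)
pose kappa := K / (3 * Mk * (W + 1)).
have W1 : 0 < W + 1 by rewrite ltr_wpDl.
have k0 : 0 < kappa by rewrite divr_gt0// !mulr_gt0.
have [e e0 he] := remainder_small rho0 sol supp u0_ge0 v0_ge0 k0.
exists (Num.min (e / 3) (1 / 3)); first by rewrite lt_min !divr_gt0.
move=> d d0; rewrite lt_min => /andP[de d1].
have d31 : 3 * d < 1 by rewrite mulrC -ltr_pdivlMr.
have d3e : 3 * d < e by rewrite mulrC -ltr_pdivlMr.
have mZ : measurable (Z d) by exact: measurable_cone_slice.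
have ZT : Z d `<=` slab T by move=> z Zz; exact: (cone_slice_slab d0 ST Zz).
have mrZ : measurable_fun (Z d) (fun z : VM => remainder rho u v z * rise_kernel d Phi z).
  apply: measurable_funM; first exact: (measurable_remainder rho sol ZT).
  by apply: measurable_funTS; exact: measurable_rise_kernel.
pose Q : set VM := cube (1 + rho) `*` `[2 * d, 3 * d]%classic.
have QT : Q `<=` slab T.
  move=> z [_ /=]; rewrite in_itv/= => /andP[z2 z3]; split.
    by apply: lt_le_trans z2; rewrite mulr_gt0.
  apply: le_lt_trans ST; rewrite lee_fin; apply: le_trans z3 _.
  exact: le_trans (ltW d31) S1.
have mQ1 := @measurable_cube R n (1 + rho).
have mQ2 : measurable (`[2 * d, 3 * d]%classic : set (measurableTypeR R)) by [].
have mQ : measurable Q by exact: measurableX.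
have mrQ : measurable_fun Q (fun z : VM => Mk / d ^+ 2 * `|remainder rho u v z|).
  apply: measurable_funM => //; apply: measurableT_comp => //.
  exact: (measurable_remainder rho sol QT).
have bound : (\int[Lam]_(z in Z d) `|remainder rho u v z * rise_kernel d Phi z|%:E <= K%:E)%E.
  apply: (@le_trans _ _ (\int[Lam]_(z in Q) (Mk / d ^+ 2 * `|remainder rho u v z|)%:E)%E).
    rewrite integral_mkcond [leRHS]integral_mkcond; apply: ge0_le_integral => //.
    - by move=> z _; rewrite patchE; case: ifP => // _; rewrite lee_fin.
    - apply/(measurable_restrictT _ _).1; first exact: mZ.
      by apply/measurable_EFinP; exact: measurableT_comp.
    - apply/(measurable_restrictT _ _).1; first exact: mQ.
      exact/measurable_EFinP.
    move=> z _; rewrite !patchE.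
    have Q0 : (0 <= if z \in Q then (Mk / d ^+ 2 * `|remainder rho u v z|)%:E else 0)%E.
      by case: ifP => // _; rewrite lee_fin mulr_ge0// divr_ge0 ?sqr_ge0// ltW.
    case: ifPn => //; rewrite inE => Zz.
    have [hz|hz] := pselect (2 * d <= z.2 <= 3 * d); last first.
      by rewrite rise_kernel_out// mulr0 normr0.
    have zQ : Q z.
      split; last by rewrite /= in_itv.
      have [_] := Zz; rewrite subr0 => zr; move/andP: hz => [hz1 hz2].
      apply: sqnorm_cube; first by rewrite addr_ge0// ltW.
      rewrite (le_trans zr)//; have z1 : z.2 <= 1 := le_trans hz2 (ltW d31).
      have z0 : 0 <= z.2 by apply: le_trans hz1; rewrite mulr_ge0// ltW.
      rewrite ler_sqr ?nnegrE ?addr_ge0 ?(ltW rho0)//.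
      by rewrite lerD2r.
    by rewrite mem_set// lee_fin normrM mulrC ler_wpM2r// hk.
  have t3 t : (`[2 * d, 3 * d]%classic : set R) t ->
    (\int[nu]_(x in cube (1 + rho)) (Mk / d ^+ 2 * `|remainder rho u v (x, t)|)%:E <=
     (K / d)%:E)%E.
    rewrite /= in_itv/= => /andP[t1 t2].
    have It : time_interval T t.
      split; first by lra.
      by apply: le_lt_trans ST; rewrite lee_fin (le_trans t2)// (le_trans (ltW d31)).
    have t0 : 0 < t by lra.
    have te : t < e by lra.
    have hr := he t _ W t0 te It mQ1 (lebesgue_cube (addr_ge0 ler01 (ltW rho0))).
    have mrt : measurable_fun (cube (1 + rho)) (fun x => `|remainder rho u v (x, t)|%:E).
      apply/measurable_EFinP; apply: measurableT_comp => //.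
      apply: measurable_funB.
        by apply: measurable_funTS; apply: L2_measurable; have [] := sol_H1 sol It.
      apply: measurable_funTS; apply: measurable_funD.
        exact: measurable_data_rep (L2_u0 sol).
      by apply: measurable_funM => //; exact: measurable_data_rep (L2_v0 sol).
    under eq_integral do rewrite EFinM.
    have Mkd : 0 < Mk / d ^+ 2 by rewrite divr_gt0 ?exprn_gt0.
    rewrite ge0_integralZl//; last by rewrite lee_fin ltW.
    apply: (@le_trans _ _ ((Mk / d ^+ 2)%:E * (t * (kappa * (W + 1)))%:E)%E).
      by apply: lee_wpmul2l => //; rewrite lee_fin ltW.
    rewrite -EFinM lee_fin.
    have -> : kappa * (W + 1) = K / (3 * Mk).
      by rewrite /kappa; field; rewrite !gt_eqF.
    apply: (@le_trans _ _ (Mk / d ^+ 2 * (3 * d * (K / (3 * Mk))))).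
      by rewrite ler_pM2l// ler_pM2r// divr_gt0// mulr_gt0.
    rewrite le_eqVlt; apply/orP; left; apply/eqP; field.
    by rewrite !gt_eqF.
  apply: le_trans (tonelli_time_le mQ1 mQ2 mrQ _ t3) _.
    by move=> z _; rewrite mulr_ge0// divr_ge0 ?sqr_ge0// ltW.
  rewrite lebesgue_measure_itv/= lte_fin ltr_pM2r// ltr_nat/= -EFinB -EFinM lee_fin.
  have -> : K / d * (3 * d - 2 * d) = K by field; rewrite gt_eqF.
  by [].
have irk : Lam.-integrable (Z d)
    (EFin \o (fun z : VM => remainder rho u v z * rise_kernel d Phi z)).
  apply/integrableP; split; first exact/measurable_EFinP.
  exact: le_lt_trans bound (ltry _).
apply: (le_trans (le_normr_Rintegral mZ irk)).
rewrite -lee_fin /Rintegral fineK//.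
rewrite ge0_fin_numE; last by apply: integral_ge0 => z _; rewrite lee_fin.
exact: le_lt_trans bound (ltry _).
Qed.

Lemma integrable_data_ball w : L2 w -> nu.-integrable (data_ball rho) (EFin \o data_rep rho w).
Proof.
move=> hw; have mC := @measurable_cube R n rho.
apply: (@integrableS _ _ _ _ (cube rho)) => //.
- exact: measurable_data_ball.
- by move=> x xB; apply: sqnorm_cube => //; exact: ltW.
have md : measurable_fun (cube rho) (data_rep rho w).
  by apply: measurable_funTS; exact: measurable_data_rep.
apply/integrableP; split; first exact/measurable_EFinP.
have N0 : 0 <= L2norm w by rewrite fine_ge0// Lnorm_ge0.
have N1 : 0 < L2norm w + 1 by rewrite ltr_wpDl.
have Nl : L2norm w <= L2norm w + 1 by rewrite lerDl.
apply: le_lt_trans (ltry _).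
apply: le_trans (L2_integral_abs_le hw mC (lebesgue_cube (ltW rho0)) N1 Nl).
apply: ge0_le_integral => //.
- exact/measurable_EFinP/measurableT_comp.
- apply/measurable_EFinP; apply: measurableT_comp => //.
  by apply: measurable_funTS; exact: L2_measurable.
- move=> x _; rewrite /= lee_fin ger0_norm ?data_rep_ge0//.
  by rewrite /data_rep ler_piMr// indicE.
Qed.

Definition data_part (z : VM) : R := U0 z.1 + V0 z.1 * z.2.

Lemma integrable_data_part (d : R) : 0 < d -> Lam.-integrable (Z d) (EFin \o data_part).
Proof.
move=> d0; have mZ : measurable (Z d) by exact: measurable_cone_slice.
have aux w : L2 w -> Lam.-integrable (Z d) (EFin \o (fun z : VM => data_rep rho w z.1)).
  move=> hw; have Sr : 0 <= S + rho by rewrite addr_ge0 ?(ltW rho0)// (le_trans ler01).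
  apply: integrableS (integrable_data_rep rho d S Sr hw) => //.
    by apply: measurableX => //; exact: measurable_cube.
  by apply: cone_slice_sub => //; exact: ltW.
have i2 : Lam.-integrable (Z d) (EFin \o (fun z : VM => V0 z.1 * z.2)).
  apply: (integrable_cone_mul d0 es_time _ (aux _ (L2_v0 sol))).
  exact: measurable_time.
by have := integrableD mZ (aux _ (L2_u0 sol)) i2; apply: eq_integrable.
Qed.

(** The representatives vanish outside the ball at every point, so the slice may be replaced by the
    cylinder over the ball. There [rise_kernel_integral_le] applies at each [x], with [alpha] and
    [beta] the values of the two data. *)
Lemma data_integral_le (d : R) : 0 < d -> 3 * d < 1 ->
  \int[Lam]_(z in Z d) (data_part z * rise_kernel d Phi z) <=
  - (c * \int[nu]_(x in data_ball rho) V0 x).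
Proof.
move=> d0 d1.
have mB := @measurable_data_ball R n rho.
have mI : measurable (`[d, S]%classic : set (measurableTypeR R)) by [].
pose F z : R := data_part z * rise_kernel d Phi z.
have iF : Lam.-integrable (Z d) (EFin \o F).
  apply: (integrable_cone_mul d0 (es_rise_kernel d)); last exact: integrable_data_part.
  exact: measurable_rise_kernel.
have sub : data_ball rho `*` `[d, S]%classic `<=` Z d.
  move=> z [zB /=]; rewrite in_itv/= => dzS; split => //; rewrite subr0 (le_trans zB)//.
  have z0 : 0 <= z.2 by case/andP: dzS => h _; apply: le_trans h; exact: ltW.
  by rewrite ler_sqr ?nnegrE ?addr_ge0 ?(ltW rho0)// lerDr.
have -> : \int[Lam]_(z in Z d) (data_part z * rise_kernel d Phi z) =
    \int[Lam]_(z in data_ball rho `*` `[d, S]%classic) F z.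
  rewrite Rintegral_mkcond [RHS]Rintegral_mkcond; apply: eq_Rintegral => z _.
  rewrite !patchE; case: ifPn => zZ; case: ifPn => zQ //.
  - have [dzS _] := set_mem zZ.
    rewrite /data_part !data_rep_out ?mul0r ?addr0 ?mul0r// => zB;
    by apply: (negP zQ); rewrite inE; split => //=; rewrite in_itv.
  - by exfalso; apply: (negP zZ); rewrite inE; apply: sub; exact: set_mem zQ.
have iV := integrable_data_ball (L2_v0 sol).
have -> : - (c * \int[nu]_(x in data_ball rho) V0 x) =
    \int[nu]_(x in data_ball rho) (- c * V0 x).
  by rewrite RintegralZl// mulNr.
apply: fubini_le => //.
- apply: integrableS iF => //; first exact: measurable_cone_slice.
  exact: measurableX.
- have := integrableZl mB (- c) iV.
  by apply: eq_integrable => // x _; rewrite /= EFinM.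
- move=> x xB; rewrite mulNr.
  exact: (rise_kernel_integral_le wm rho0 xB
    (data_rep_ge0 _ _ _) (data_rep_ge0 _ _ _) d0 d1 S1).
Qed.

(** The two cutoffs vary at different times: [rise'] lives before [3 d < 1/2], where [psi = 1]. The
    wave operator of [rise * psi * Phi] is thus [rise_kernel] plus [rise] times the terms in [psi']
    and [psi'']. In the kernel part [u] is split into data and remainder. The factor [rise d] stays
    in both integrals, which spares a limit [d -> 0]. *)
Lemma energy_inequality (psi : R -> R) : elem_smooth psi ->
  (forall t, t <= 2^-1 -> psi t = 1) -> (forall t, S <= t -> psi t = 0) ->
  0 < \int[nu]_(x in data_ball rho) V0 x ->
  exists2 e : R, 0 < e & forall d, 0 < d -> d < e ->
    \int[Lam]_(z in Z d) (`|u z.2 z.1| `^ p * (rise d z.2 * psi z.2 * Phi z)) +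
      c * (\int[nu]_(x in data_ball rho) V0 x) / 2 <=
    \int[Lam]_(z in Z d) (u z.2 z.1 * (rise d z.2 *
      (derive1 (derive1 psi) z.2 * Phi z + 2 * derive1 psi z.2 * dt Phi z))).
Proof.
set I0 := \int[nu]_(x in _) _ => hpsi psi1 psi0 I00.
(* Half of the data term is spent on the remainder, whence the division by 2 in the conclusion. *)
have [e e0 he] := remainder_integral_small (divr_gt0 (mulr_gt0 c0 I00) (ltr0Sn _ 1)).
exists (Num.min e (1 / 6)); first by rewrite lt_min e0 divr_gt0.
move=> d d0; rewrite lt_min => /andP[de d6].
have d3 : 3 * d < 2^-1 by lra.
have d1 : 3 * d < 1 by lra.
have dS : d <= S by apply: le_trans S1; lra.
have hP := wm_smooth wm.
have hr := es_rise d.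
pose zeta t := rise d t * psi t.
have hz : elem_smooth zeta by exact: es_mul.
have dz : derive1 zeta = (fun t => rise d t * derive1 psi t + derive1 (rise d) t).
  apply/funext => t; rewrite derive1_mul//; congr (_ + _).
  have [t2|t2] := leP t 2^-1; first by rewrite psi1// mul1r.
  by have [-> _] := rise_derive_gt d0 (lt_trans d3 t2); rewrite mulr0.
have dpsi_rise t : derive1 psi t * derive1 (rise d) t = 0.
  have [t2|t2] := ltP t 2^-1.
    rewrite (@derive1_locally_cst _ psi t 1) ?mul0r//.
    by near=> y; rewrite psi1//; near: y; exact: lt_le_nbhsl.
  by have [-> _] := rise_derive_gt d0 (lt_le_trans d3 t2); rewrite mulr0.
have ddz t : derive1 (derive1 zeta) t =
    rise d t * derive1 (derive1 psi) t + derive1 (derive1 (rise d)) t.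
  rewrite dz derive1_add; last 2 first.
    by apply: es_mul => //; exact: es_derive1.
    exact: es_derive1.
  rewrite derive1_mul//; last exact: es_derive1.
  by rewrite dpsi_rise addr0.
have z_out t : ~ (d <= t <= S) -> zeta t = 0.
  move=> /negP; rewrite negb_and -!ltNge /zeta => /orP[h|h].
    by rewrite rise_le ?mul0r//; lra.
  by rewrite psi0 ?mulr0// ltW.
have wP z : Z d z -> wave_op Phi z = 0.
  move=> [/andP[dz1 _]]; rewrite subr0 => zr; apply: (wm_wave wm) => //.
  by rewrite (le_trans (ltW d0)).
have W := weak_cone_form p1 rho0 sol supp d0 ST hz hP (wm_measurable wm)
  (wm_measurable_dt wm) (wm_measurable_wave wm) (wm_support wm) wP z_out.
rewrite -/(zeta _) -W.
have mZ : measurable (Z d) by exact: measurable_cone_slice.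
have iu : Lam.-integrable (Z d) (EFin \o (fun z : VM => u z.2 z.1)).
  exact: (integrable_u p1 rho0 sol d0 dS ST).
pose w1 z := rise d z.2 * (derive1 (derive1 psi) z.2 * Phi z + 2 * derive1 psi z.2 * dt Phi z).
have hp1 := es_derive1 hpsi; have hp2 := es_derive1 hp1.
have hw1 : elem_smooth (w1 : V -> R).
  apply: (es_mul (es_comp hr es_time)).
  apply: (es_add (es_mul (es_comp hp2 es_time) hP)).
  exact: (es_mul (es_mul (es_cst 2) (es_comp hp1 es_time)) (es_dt hP)).
have mw1 : measurable_fun setT (w1 : VM -> R).
  apply: measurable_funM; first exact: measurable_comp_time (es_measurable hr).
  apply: measurable_funD; apply: measurable_funM.
  - exact: measurable_comp_time (es_measurable hp2).
  - exact: wm_measurable wm.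
  - by apply: measurable_funM => //; exact: measurable_comp_time (es_measurable hp1).
  - exact: wm_measurable_dt wm.
have iw1 := integrable_cone_mul d0 hw1 mw1 iu.
have hk := es_rise_kernel d; have mk := measurable_rise_kernel d.
have iD := integrable_cone_mul d0 hk mk (integrable_data_part d0).
have iuk := integrable_cone_mul d0 hk mk iu.
have ir : Lam.-integrable (Z d)
    (EFin \o (fun z : VM => remainder rho u v z * rise_kernel d Phi z)).
  have := integrableB mZ iuk iD; apply: eq_integrable => // z _ /=.
  by rewrite -EFinB; congr EFin; rewrite /remainder /data_part; ring.
have -> : \int[Lam]_(z in Z d) (u z.2 z.1 *
      (derive1 (derive1 zeta) z.2 * Phi z + 2 * derive1 zeta z.2 * dt Phi z)) =
    \int[Lam]_(z in Z d) (remainder rho u v z * rise_kernel d Phi z) +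
    \int[Lam]_(z in Z d) (data_part z * rise_kernel d Phi z) +
    \int[Lam]_(z in Z d) (u z.2 z.1 * w1 z).
  rewrite -RintegralD// -RintegralD//; last first.
    have := integrableD mZ ir iD; apply: eq_integrable => // z _.
  apply: eq_Rintegral => z _.
  rewrite ddz dz /remainder /data_part /rise_kernel /w1.
  move: (rise d z.2) (derive1 (rise d) z.2) (derive1 (derive1 (rise d)) z.2) => r0 r1 r2.
  move: (derive1 psi z.2) (derive1 (derive1 psi) z.2) (Phi z) (dt Phi z) => s1 s2 P Q.
  move: (u z.2 z.1) (U0 z.1) (V0 z.1) (z.2 : R) => u0 U V' t.
  by ring.
have := he d d0 de; rewrite ler_norml => /andP[_ hr1].
have hd := data_integral_le d0 d1; rewrite -/I0 in hd.
move: hr1 hd.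
set X1 := \int[_]_(_ in _) (remainder _ _ _ _ * _).
set X2 := \int[_]_(_ in _) (data_part _ * _).
move: X1 X2 (\int[_]_(_ in _) _) => x1 x2 x3 h1 h2.
lra.
Unshelve. all: by end_near. Qed.

End energy_inequality.

(** * The lifespan bound *)

(** An antiderivative is [-2 * (t - L + 1)^(-1/2)], taken through [power_profile] to be smooth on
    the whole line. The bound is uniform in [L], [d] and [S]. *)
Lemma integral_shifted_power_le {R : realType} (L d S : R) :
  (\int[@lebesgue_measure R]_(t in `[d, S])
     ((((t : R) - L + 1) `^ (- (3 / 2))) * (L <= t :> R)%R%:R)%R%:E <= 2%:E)%E.
Proof.
pose g t : R := - 2 * power_profile 2^-1 (1 * t + (1 - L)).
have hp := @es_power_profile R 2^-1.
have hg : elem_smooth g.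
  by apply: es_mul; [exact: es_cst|exact: es_comp hp (es_affine _ _)].
have dg t : L <= t -> derive1 g t = (t - L + 1) `^ (- (3 / 2)).
  move=> Lt; rewrite /g derive1Ml; last exact: es_derivable (es_comp hp (es_affine _ _)).
  rewrite (derive1_affine 1 (1 - L) t hp) power_profile_derive1; last by lra.
  have -> : 1 * t + (1 - L) = t - L + 1 by ring.
  have -> : - 2^-1 - 1 = - (3 / 2) :> R by field.
  by rewrite mul1r; field.
(* A right end point strictly beyond [L], even when [S < L] and the integrand vanishes almost
   everywhere on [[d, S]]. *)
pose S' := Num.max S L + 1.
have LS' : L < S' by rewrite /S' ltr_pwDr// le_max lexx orbT.
have SS' : S <= S' by rewrite /S' (@le_trans _ _ (Num.max S L))// ?le_max ?lexx// lerDl.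
have mh : measurable_fun setT (fun t : R => (t - L + 1) `^ (- (3 / 2)) * (L <= t)%R%:R).
  apply: measurable_funM.
    apply: (measurableT_comp (@measurable_powR R _)).
    by apply: measurable_funD => //; apply: measurable_funB.
  have -> : (fun t : R => (L <= t)%R%:R) = \1_(`[L, +oo[%classic) :> (R -> R).
    by apply/funext => t; rewrite indicE mem_setE in_itv/= andbT.
  exact: measurable_indic.
apply: (@le_trans _ _ (\int[@lebesgue_measure R]_(t in `[L, S']) (derive1 g t)%:E)%E).
  rewrite integral_mkcond [leRHS]integral_mkcond; apply: ge0_le_integral => //.
  - by move=> t _; rewrite patchE; case: ifP => // _; rewrite lee_fin mulr_ge0 ?powR_ge0.
  - apply/(measurable_restrictT _ _).1 => //.
    by apply/measurable_EFinP; exact: measurable_funTS.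
  - apply/(measurable_restrictT _ _).1 => //.
    apply/measurable_EFinP; apply: measurable_funTS; apply: es_measurable.
    exact: es_derive1.
  move=> t _; rewrite !patchE !mem_setE !in_itv/=.
  have [Lt|tL] := leP L t; last by rewrite mulr0 andFb; case: ifP.
  case: ifPn => [/andP[dt tS]|_].
    by rewrite (le_trans tS SS') /= mulr1 dg.
  by case: ifP => // _; rewrite lee_fin dg// powR_ge0.
rewrite es_FTC// lee_fin /g.
have -> : power_profile 2^-1 (1 * L + (1 - L)) = 1.
  have -> : 1 * L + (1 - L) = 1 by ring.
  by rewrite power_profile_ge ?powR1//; lra.
have : 0 <= power_profile 2^-1 (1 * S' + (1 - L)).
  by rewrite power_profile_ge ?powR_ge0//; lra.
by lra.
Qed.

(** Young's inequality for [lam * a] and [lam^-1 * b], with the factors [1/p] and [1/q] bounded by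
    1; the free scale [lam] serves to balance the two terms. *)
Lemma young_scaled {R : realType} (lam a b p q : R) : 0 < lam -> 0 <= a -> 0 <= b ->
  1 < p -> 1 < q -> p^-1 + q^-1 = 1 ->
  a * b <= lam `^ p * a `^ p + lam `^ (- q) * b `^ q.
Proof.
move=> l0 a0 b0 p1 q1 pq.
have p0 : 0 < p by lra.
have q0 : 0 < q by lra.
have lV : 0 < lam^-1 by rewrite invr_gt0.
have := conjugate_powR (mulr_ge0 (ltW l0) a0) (mulr_ge0 (ltW lV) b0) p0 q0 pq.
rewrite (powRM _ (ltW l0) a0) (powRM _ (ltW lV) b0).
have -> : lam * a * (lam^-1 * b) = a * b by field; rewrite gt_eqF.
have -> : lam^-1 `^ q = lam `^ (- q).
  by rewrite -(powR_inv1 (ltW l0)) -powRrM mulN1r.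
move/le_trans; apply.
by apply: lerD; rewrite ler_piMr ?mulr_ge0 ?powR_ge0// invf_le1 ?ltW.
Qed.

(** * Volume of the cone slice and integral of its weight *)

Section space_weight.
Context {R : realType} {n : nat}.
Local Notation VM := ('rV[R]_n * measurableTypeR R)%type.
Local Notation Lam := (spacetime_lebesgue R n).
Variables (rho d S : R).
Hypotheses (rho0 : 0 < rho) (d0 : 0 < d) (dS : d <= S).
Local Notation Z := (@cone_slice R n rho 0 d S : set VM).

Definition cone_distance (z : VM) : R := z.2 + (rho + 1) - euclidean_norm z.1.

Lemma measurable_cone_distance : measurable_fun setT cone_distance.
Proof.
apply: measurable_funB.
  exact: measurable_comp_time (es_measurable (es_add es_id (es_cst (rho + 1)))).
apply: (measurableT_comp (continuous_measurable_fun (@sqrt_continuous R))).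
exact: (measurableT_comp measurable_sqnorm measurable_fst).
Qed.

Lemma cone_distance_ge1 z : Z z -> 1 <= cone_distance z.
Proof.
move=> [/andP[dz _]]; rewrite subr0 => zr.
have z0 : 0 <= z.2 by apply: le_trans dz; exact: ltW.
have : euclidean_norm z.1 <= z.2 + rho by rewrite euclidean_norm_le// addr_ge0// ltW.
by move=> h; rewrite /cone_distance lerBrDr addrA [leLHS]addrC lerD2r.
Qed.

Let L0 : 0 <= S + rho.
Proof. by rewrite addr_ge0 ?(ltW rho0)// (le_trans (ltW d0)). Qed.

Lemma cone_slice_volume : fine (Lam Z) <= (2 * (S + rho)) ^+ n * S.
Proof.
have h : (Lam Z <= ((2 * (S + rho)) ^+ n * (S - d))%:E)%E.
  apply: (@le_trans _ _ (Lam (cube (S + rho) `*` `[d, S]%classic))).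
    apply: le_measure; rewrite ?inE; first exact: measurable_cone_slice.
      by apply: measurableX => //; exact: measurable_cube.
    by apply: cone_slice_sub => //; exact: ltW.
  rewrite spacetime_lebesgue_setX//; last exact: measurable_cube.
  rewrite lebesgue_cube// lebesgue_measure_itv/= lte_fin EFinM.
  apply: lee_wpmul2l; first by rewrite lee_fin exprn_ge0// mulr_ge0.
  by case: ifPn => // _; rewrite lee_fin subr_ge0.
apply: (@le_trans _ _ ((2 * (S + rho)) ^+ n * (S - d))).
  rewrite -lee_fin fineK// ge0_fin_numE ?measure_ge0//.
  exact: le_lt_trans h (ltry _).
by rewrite ler_wpM2l ?exprn_ge0 ?mulr_ge0// lerBlDr lerDl ltW.
Qed.

(** For fixed [x] the cone is entered at time [L = |x| - rho], and the weight is then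
    [(t - L + 1)^(-3/2)], whose time integral is at most 2. Only the volume in space remains, one
    power of [S] less than in [cone_slice_volume]. *)
Lemma cone_distance_integral : \int[Lam]_(z in Z) (cone_distance z `^ (- (3 / 2))) <=
  2 * (2 * (S + rho)) ^+ n.
Proof.
have mQ1 := @measurable_cube R n (S + rho).
have mQ2 : measurable (`[d, S]%classic : set (measurableTypeR R)) by [].
have mZ : measurable Z by exact: measurable_cone_slice.
have mw : measurable_fun setT (fun z => cone_distance z `^ (- (3 / 2))).
  exact: (measurableT_comp (@measurable_powR R _) measurable_cone_distance).
pose F z := cone_distance z `^ (- (3 / 2)) * \1_Z z.
have h : (\int[Lam]_(z in Z) (cone_distance z `^ (- (3 / 2)))%:E <=
    (2 * (2 * (S + rho)) ^+ n)%:E)%E.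
  apply: (@le_trans _ _ (\int[Lam]_(z in cube (S + rho) `*` `[d, S]%classic) (F z)%:E)%E).
    rewrite integral_mkcond [leRHS]integral_mkcond.
    rewrite le_eqVlt; apply/orP; left; apply/eqP; apply: eq_integral => z _.
    rewrite !patchE /F indicE; case: ifPn => zZ.
      rewrite mem_set ?mulr1//; apply: cone_slice_sub (set_mem zZ) => //; exact: ltW.
    by case: ifP => // _; rewrite mulr0.
  rewrite EFinM -(lebesgue_cube L0); apply: tonelli_space_le => //.
  - apply: measurable_funTS; apply: measurable_funM; first exact: mw.
    exact: (measurable_indic mZ).
  - by move=> z _; rewrite mulr_ge0 ?powR_ge0.
  move=> x _; apply: le_trans (integral_shifted_power_le (euclidean_norm x - rho) d S).
  rewrite le_eqVlt; apply/orP; left; apply/eqP; apply: eq_integral => t.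
  rewrite inE /= in_itv/= => dtS; rewrite /F; congr (EFin (_ * _)).
    by congr powR; rewrite /cone_distance /=; ring.
  rewrite indicE lerBlDr euclidean_norm_le; last first.
    by case/andP: dtS => dt _; rewrite addr_ge0 ?(ltW rho0)// (le_trans (ltW d0)).
  congr (_%:R); congr nat_of_bool; apply/idP/idP; rewrite inE /cone_slice /= subr0.
    by move=> [].
  by move=> ?; split.
rewrite -lee_fin /Rintegral fineK// ge0_fin_numE; last first.
  by apply: integral_ge0 => z _; rewrite lee_fin powR_ge0.
exact: le_lt_trans h (ltry _).
Qed.

Lemma integrable_cone_distance :
  Lam.-integrable Z (EFin \o (fun z => cone_distance z `^ (- (3 / 2)))).
Proof.
apply: measurable_bounded_integrable.
- exact: measurable_cone_slice.
- exact: coneZ_finite.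
- apply: measurable_funTS.
  exact: (measurableT_comp (@measurable_powR R _) measurable_cone_distance).
- exists 1; split; first exact: num_real.
  move=> y y1 z Zz /=; rewrite ger0_norm ?powR_ge0// (le_trans _ (ltW y1))//.
  by rewrite -[leRHS](powRr0 (cone_distance z)) ler_powR ?cone_distance_ge1//; lra.
Qed.

End space_weight.

Lemma le_powR_inv {R : realType} (a p : R) : 0 <= a <= 1 -> 1 < p -> a <= a `^ p^-1.
Proof.
move=> /andP[]; rewrite le_eqVlt => /predU1P[<- _ _|a0 a1 p1]; first exact: powR_ge0.
by apply: ger1_powR; rewrite ?a0// invf_le1 ?ltW// (lt_trans ltr01).
Qed.

(** * Estimates from the two multipliers *)

Section lifespan_bound.
Context {R : realType} {n : nat}.
Local Notation V := ('rV[R]_n * R)%type.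
Local Notation VM := ('rV[R]_n * measurableTypeR R)%type.
Local Notation Lam := (spacetime_lebesgue R n).
Local Notation nu := (lebesgue_rV R n).
Variables (p rho : R) (T : \bar R) (f g : 'rV[R]_n -> R) (u v : R -> 'rV[R]_n -> R).
Hypotheses (n2 : (2 <= n)%N) (p1 : 1 < p) (rho0 : 0 < rho).
Hypothesis sol : weak_solution p T f g u v.
Variables (k : nat) (Mf : R) (S d : R).
Hypotheses (Mf0 : 0 < Mf) (S1 : 1 <= S) (ST : (S%:E < T)%E).
Hypotheses (d0 : 0 < d) (dS : d <= S).
Hypothesis hfall : forall t,
  `|derive1 (fall k S) t| <= Mf / S * fall k S t `^ p^-1 /\
  `|derive1 (derive1 (fall k S)) t| <= Mf / S ^+ 2 * fall k S t `^ p^-1.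
Variable I0 : R.
Hypothesis I0_ge0 : 0 <= I0.

Local Notation Z := (@cone_slice R n rho 0 d S : set VM).
Local Notation q := (p / (p - 1)).
Local Notation psi := (fall k S).
Local Notation m := ((n%:R + 1) / 2 : R).

Definition weighted_energy : R :=
  \int[Lam]_(z in Z) (`|u z.2 z.1| `^ p * (rise d z.2 * psi z.2)).
Local Notation Y := weighted_energy.

(** The form in which [energy_inequality] is consumed, with [I0] standing for the data integral. *)
Definition energy_estimate c (Phi : V -> R) : Prop :=
  \int[Lam]_(z in Z) (`|u z.2 z.1| `^ p * (rise d z.2 * psi z.2 * Phi z)) +
    c * I0 / 2 <=
  \int[Lam]_(z in Z) (u z.2 z.1 * (rise d z.2 *
    (derive1 (derive1 psi) z.2 * Phi z + 2 * derive1 psi z.2 * dt Phi z))).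

Let p0 : 0 < p. Proof. exact: lt_trans ltr01 p1. Qed.
Let pm1 : 0 < p - 1. Proof. by rewrite subr_gt0. Qed.
Let q0 : 0 < q. Proof. exact: divr_gt0. Qed.
Let q1 : 1 < q. Proof. by rewrite ltr_pdivlMr// mul1r ltrBlDr ltrDl. Qed.
Let pq : p^-1 + q^-1 = 1.
Proof. by rewrite invf_div; field; rewrite !gt_eqF. Qed.
Let S0 : 0 < S. Proof. exact: lt_le_trans ltr01 S1. Qed.
Let mZ : measurable Z. Proof. exact: measurable_cone_slice. Qed.

Let Z_time z : Z z -> 0 <= z.2.
Proof. by move=> [/andP[dz _] _]; apply: le_trans dz; exact: ltW. Qed.

Let Z_cone z : Z z -> sqnorm z.1 <= (z.2 + rho) ^+ 2.
Proof. by move=> [_]; rewrite subr0. Qed.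

Let zeta_ge0 t : 0 <= rise d t * psi t.
Proof. by rewrite mulr_ge0 ?rise_ge0 ?fall_ge0. Qed.

(** Since [0 <= rise <= 1], the factor [psi^(1/p)] supplied by the derivatives of [fall] can be
    completed to [(rise * psi)^(1/p)], whose product with [|u|] has as [p]-th power the integrand of
    [weighted_energy]. *)
Let rise_fall_le t : rise d t * psi t `^ p^-1 <= (rise d t * psi t) `^ p^-1.
Proof.
rewrite powRM ?rise_ge0 ?fall_ge0// ler_wpM2r ?powR_ge0//.
by apply: le_powR_inv => //; rewrite rise_ge0 rise_le1.
Qed.

Let amplitude_powR (w t : R) : (`|w| * (rise d t * psi t) `^ p^-1) `^ p =
  `|w| `^ p * (rise d t * psi t) :> R.
Proof.
rewrite (powRM _ (normr_ge0 w) (powR_ge0 _ _)) -powRrM mulVf ?gt_eqF//.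
by rewrite powRr1// zeta_ge0.
Qed.

Let integrable_cone (w F : V -> R) : elem_smooth w ->
  measurable_fun setT (w : VM -> R) -> Lam.-integrable Z (EFin \o (F : VM -> R)) ->
  Lam.-integrable Z (EFin \o (fun z : VM => F z * w z)).
Proof. exact: (integrable_cone_mul rho0 (S := S) (d := d)). Qed.

Let iu : Lam.-integrable Z (EFin \o (fun z : VM => u z.2 z.1)).
Proof. exact: (integrable_u p1 rho0 sol d0 dS ST). Qed.

Let iup : Lam.-integrable Z (EFin \o (fun z : VM => `|u z.2 z.1| `^ p)).
Proof. exact: (integrable_up rho0 sol d0 ST). Qed.

Let er := @es_rise R d.
Let ef := es_fall k S.
Let ef1 := es_derive1 ef.
Let ef2 := es_derive1 ef1.

Let iY : Lam.-integrable Z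
  (EFin \o (fun z : VM => `|u z.2 z.1| `^ p * (rise d z.2 * psi z.2))).
Proof.
apply: (@integrable_cone (fun z => rise d z.2 * psi z.2)) iup.
  exact: (es_mul (es_comp er es_time) (es_comp ef es_time)).
by apply: measurable_funM; apply: measurable_comp_time; exact: es_measurable.
Qed.

Let iw (Phi : V -> R) c M : wave_multiplier rho c M Phi ->
  Lam.-integrable Z (EFin \o (fun z : VM => u z.2 z.1 * (rise d z.2 *
    (derive1 (derive1 psi) z.2 * Phi z + 2 * derive1 psi z.2 * dt Phi z)))).
Proof.
move=> wm; have hP := wm_smooth wm.
apply: (@integrable_cone (fun z => rise d z.2 *
    (derive1 (derive1 psi) z.2 * Phi z + 2 * derive1 psi z.2 * dt Phi z))) iu.
  apply: (es_mul (es_comp er es_time)).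
  apply: (es_add (es_mul (es_comp ef2 es_time) hP)).
  exact: (es_mul (es_mul (es_cst 2) (es_comp ef1 es_time)) (es_dt hP)).
apply: measurable_funM; first exact: measurable_comp_time (es_measurable er).
apply: measurable_funD; apply: measurable_funM.
- exact: measurable_comp_time (es_measurable ef2).
- exact: wm_measurable wm.
- by apply: measurable_funM => //; exact: measurable_comp_time (es_measurable ef1).
- exact: wm_measurable_dt wm.
Qed.

Let volume_ge0 : 0 <= fine (Lam Z).
Proof. by rewrite fine_ge0// measure_ge0. Qed.

(** On the cone [multiplier0] is constant, so only [psi''] is left. Young's inequality returns
    [Y / p], which is absorbed on the left as [1 - 1/p = 1/q]; the factor [1/q] then cancels. *)
Lemma weighted_energy_le : energy_estimate 1 (multiplier0 rho) ->
  Y <= (Mf / S ^+ 2) `^ q * ((2 * (S + rho)) ^+ n * S).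
Proof.
rewrite /energy_estimate => E.
have b0 : 0 <= Mf / S ^+ 2 by rewrite divr_ge0 ?sqr_ge0// ltW.
have pw z : Z z -> u z.2 z.1 * (rise d z.2 *
    (derive1 (derive1 psi) z.2 * multiplier0 rho z +
     2 * derive1 psi z.2 * dt (multiplier0 rho) z)) <=
    `|u z.2 z.1| `^ p * (rise d z.2 * psi z.2) * p^-1 + (Mf / S ^+ 2) `^ q / q.
  move=> Zz; have [-> -> _] := multiplier0E rho0 (Z_time Zz) (Z_cone Zz).
  rewrite mulr1 mulr0 addr0 -amplitude_powR.
  apply: le_trans _ (conjugate_powR (mulr_ge0 (normr_ge0 _) (powR_ge0 _ _)) b0 p0 q0 pq).
  rewrite (le_trans (ler_norm _))// !normrM -[leRHS]mulrA ler_wpM2l//.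
  rewrite (ger0_norm (rise_ge0 _ _)).
  apply: (@le_trans _ _ (rise d z.2 * (Mf / S ^+ 2 * psi z.2 `^ p^-1))).
    by rewrite ler_wpM2l ?rise_ge0//; have [] := hfall z.2.
  by rewrite mulrCA mulrC ler_wpM2r.
have h0 : \int[Lam]_(z in Z)
    (`|u z.2 z.1| `^ p * (rise d z.2 * psi z.2 * multiplier0 rho z)) = Y.
  apply: eq_Rintegral => z /set_mem Zz.
  by have [-> _ _] := multiplier0E rho0 (Z_time Zz) (Z_cone Zz); rewrite mulr1.
rewrite h0 in E.
have ic : Lam.-integrable Z (EFin \o cst ((Mf / S ^+ 2) `^ q / q)).
  apply: measurable_bounded_integrable => //; first exact: coneZ_finite.
  exists `|(Mf / S ^+ 2) `^ q / q|; split; first exact: num_real.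
  by move=> y hy z _ /=; exact: ltW.
have iYp := integrable_bounded_mul mZ iY (measurable_cst p^-1) (fun _ _ => lexx `|p^-1|).
have wm := @wave_multiplier0 R n rho 1 rho0 (lexx 1).
have iR : Lam.-integrable Z (EFin \o (fun z : VM =>
    `|u z.2 z.1| `^ p * (rise d z.2 * psi z.2) * p^-1 + (Mf / S ^+ 2) `^ q / q)).
  by have := integrableD mZ iYp ic; apply: eq_integrable.
have E2 := le_Rintegral mZ (iw wm) iR pw.
have := le_trans E E2.
rewrite RintegralD// RintegralZr// -/Y Rintegral_cst// => E3.
set b := (Mf / S ^+ 2) `^ q in E3 *.
have bq : 0 <= b by exact: powR_ge0.
have vol := cone_slice_volume (n := n) rho0 d0 dS.
have E4 : Y / q <= b / q * ((2 * (S + rho)) ^+ n * S).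
  have : b / q * fine (Lam Z) <= b / q * ((2 * (S + rho)) ^+ n * S).
    by rewrite ler_wpM2l// divr_ge0// ltW.
  move: E3 I0_ge0 pq.
  move: (b / q * fine _) (b / q * (_ * S)) => x1 x2 E3 I1 pq' x12.
  have EY : Y = Y * p^-1 + Y * q^-1 by rewrite -mulrDr pq' mulr1.
  by move: E3 EY; move: (Y * p^-1) (Y * q^-1) => y1 y2; lra.
by rewrite -(ler_pM2r (_ : 0 < q^-1)) ?invr_gt0// (le_trans E4)// mulrAC.
Qed.

(** Bounds the terms in [psi'] and [psi''], apart from [psi^(1/p)] and the weight: 3 is [1 + 2],
    [Mf / S] dominates both derivatives of the cutoff, and the rest is the decay of the multiplier
    at [tau >= S / 2]. *)
Definition weight_const : R := 3 * (Mf / S) * ((n%:R + 2) * (S / 2) `^ (1 - m)).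

(** The derivatives of [psi] vanish before [S / 2], so the decay of the multiplier in [tau] becomes
    a power of [S]. The decay in [sigma] is kept inside the integral as the weight. *)
Lemma initial_data_le (c lam : R) : 0 < lam -> energy_estimate c (multiplier1 rho) ->
  c * I0 / 2 <= lam `^ p * Y +
    lam `^ (- q) * (weight_const `^ q * (2 * (2 * (S + rho)) ^+ n)).
Proof.
move=> lam0; rewrite /energy_estimate => E.
have n0 : 0 <= n%:R :> R by [].
have n22 : 2 <= n%:R :> R by rewrite (ler_nat R 2).
have MS0 : 0 <= Mf / S by rewrite divr_ge0// ltW.
have wc0 : 0 <= weight_const.
  by apply: mulr_ge0; [exact: mulr_ge0|exact: mulr_ge0 (addr_ge0 n0 _) (powR_ge0 _ _)].
have pw z : Z z -> u z.2 z.1 * (rise d z.2 *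
    (derive1 (derive1 psi) z.2 * multiplier1 rho z +
     2 * derive1 psi z.2 * dt (multiplier1 rho) z)) <=
    lam `^ p * (`|u z.2 z.1| `^ p * (rise d z.2 * psi z.2)) +
    lam `^ (- q) * weight_const `^ q * cone_distance rho z `^ (- (3 / 2)).
  move=> Zz.
  have rhs0 : 0 <= lam `^ p * (`|u z.2 z.1| `^ p * (rise d z.2 * psi z.2)) +
      lam `^ (- q) * weight_const `^ q * cone_distance rho z `^ (- (3 / 2)).
    by rewrite addr_ge0 ?mulr_ge0 ?powR_ge0 ?rise_ge0 ?fall_ge0.
  have [tS|tS] := ltP z.2 (S / 2).
    by have [-> ->] := fall_derive_lt k S0 tS; rewrite mulr0 !mul0r addr0 !mulr0.
  have [hm hdm] := multiplier1_decay rho0 (Z_time Zz) (Z_cone Zz).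
  rewrite -/(cone_distance rho z) in hm hdm.
  have [h1 h2] := hfall z.2.
  have sg1 := cone_distance_ge1 rho0 d0 Zz.
  set sg := cone_distance rho z in hm hdm sg1 *.
  set D := (n%:R + 2) * ((S / 2) `^ (1 - m) * sg `^ (- m)).
  have tau_le : (z.2 + (rho + 1)) `^ (1 - m) <= (S / 2) `^ (1 - m).
    have -> : 1 - m = - (m - 1) :> R by ring.
    have S20 : 0 < S / 2 by rewrite divr_gt0.
    have hS : S / 2 <= z.2 + (rho + 1).
      by rewrite (le_trans tS)// lerDl addr_ge0// ltW.
    have hm1 : 0 <= m - 1 by lra.
    rewrite !powRN lef_pV2 ?posrE ?powR_gt0 ?(lt_le_trans S20)//.
    apply: ge0_ler_powR => //; rewrite nnegrE; first exact: ltW.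
    exact: le_trans (ltW S20) hS.
  have DD : (n%:R + 2) * ((z.2 + (rho + 1)) `^ (1 - m) * sg `^ (- m)) <= D.
    by rewrite ler_wpM2l ?addr_ge0// ler_wpM2r ?powR_ge0.
  have D0 : 0 <= D.
    by apply: mulr_ge0; [exact: addr_ge0|exact: mulr_ge0 (powR_ge0 _ _) (powR_ge0 _ _)].
  have P0 := powR_ge0 (psi z.2) p^-1.
  have hMS : Mf / S ^+ 2 <= Mf / S.
    by rewrite ler_pM2l// lef_pV2 ?posrE ?exprn_gt0// expr2 ler_peMl// ltW.
  have b1 : `|derive1 (derive1 psi) z.2 * multiplier1 rho z +
      2 * derive1 psi z.2 * dt (multiplier1 rho) z| <=
      psi z.2 `^ p^-1 * (3 * (Mf / S) * D).
    apply: le_trans (ler_normD _ _) _.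
    rewrite (normrM _ (multiplier1 rho z)) (normrM _ (dt (multiplier1 rho) z)).
    rewrite (normrM 2) (ger0_norm (ler0n _ 2)).
    have e1 : `|derive1 (derive1 psi) z.2| * `|multiplier1 rho z| <=
        Mf / S * psi z.2 `^ p^-1 * D.
      apply: ler_pM => //; last exact: le_trans hm DD.
      by apply: le_trans h2 _; rewrite ler_wpM2r.
    have e2 : `|derive1 psi z.2| * `|dt (multiplier1 rho) z| <=
        Mf / S * psi z.2 `^ p^-1 * D.
      by apply: ler_pM => //; exact: le_trans hdm DD.
    have -> : psi z.2 `^ p^-1 * (3 * (Mf / S) * D) =
      Mf / S * psi z.2 `^ p^-1 * D + 2 * (Mf / S * psi z.2 `^ p^-1 * D) by ring.
    by apply: lerD; [exact: e1|rewrite -mulrA; exact: ler_wpM2l e2].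
  have b2 : 3 * (Mf / S) * D = weight_const * sg `^ (- m).
    by rewrite /D /weight_const; ring.
  rewrite b2 in b1.
  have wsg0 : 0 <= weight_const * sg `^ (- m) by rewrite mulr_ge0 ?powR_ge0.
  apply: (@le_trans _ _ (`|u z.2 z.1| * (rise d z.2 * psi z.2) `^ p^-1 *
      (weight_const * sg `^ (- m)))).
    rewrite (le_trans (ler_norm _))// !normrM -[leRHS]mulrA ler_wpM2l//.
    rewrite (ger0_norm (rise_ge0 _ _)).
    apply: le_trans (ler_wpM2l (rise_ge0 _ _) b1) _.
    by rewrite [leLHS]mulrA ler_wpM2r.
  apply: le_trans (young_scaled lam0 (mulr_ge0 (normr_ge0 _) (powR_ge0 _ _)) wsg0 p1 q1 pq) _.
  rewrite amplitude_powR lerD2l -mulrA ler_wpM2l ?powR_ge0//.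
  rewrite (powRM _ wc0 (powR_ge0 _ _)) ler_wpM2l ?powR_ge0// -powRrM.
  apply: ler_powR => //.
  (* Here [2 <= n] enters, through [m >= 3/2], together with [q > 1]. An exponent above 1 keeps the
     time integral of the weight bounded. *)
  have : 3 / 2 <= m * q.
    by rewrite -[leLHS]mulr1; apply: ler_pM => //; [lra|exact: ltW].
  by rewrite mulNr lerN2.
have pos : 0 <= \int[Lam]_(z in Z)
    (`|u z.2 z.1| `^ p * (rise d z.2 * psi z.2 * multiplier1 rho z)).
  apply: Rintegral_ge0 => z Zz.
  have [-> _ _] := multiplier1E rho0 (Z_time Zz) (Z_cone Zz).
  rewrite mulr_ge0 ?powR_ge0// mulr_ge0// mulr_ge0 ?powR_ge0//.
  by rewrite addr_ge0 ?(Z_time Zz)// addr_ge0// ltW.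
have wm := @wave_multiplier1 R n rho rho0.
have iD := integrable_cone_distance (n := n) rho0 d0 dS.
have i1 : Lam.-integrable Z (EFin \o (fun z : VM =>
    lam `^ p * (`|u z.2 z.1| `^ p * (rise d z.2 * psi z.2)))).
  by have := integrableZl mZ (lam `^ p) iY; apply: eq_integrable.
have i2 : Lam.-integrable Z (EFin \o (fun z : VM =>
    lam `^ (- q) * weight_const `^ q * cone_distance rho z `^ (- (3 / 2)))).
  by have := integrableZl mZ (lam `^ (- q) * weight_const `^ q) iD; apply: eq_integrable.
have iR : Lam.-integrable Z (EFin \o (fun z : VM =>
    lam `^ p * (`|u z.2 z.1| `^ p * (rise d z.2 * psi z.2)) +
    lam `^ (- q) * weight_const `^ q * cone_distance rho z `^ (- (3 / 2)))).
  by have := integrableD mZ i1 i2; apply: eq_integrable.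
have E2 := le_Rintegral mZ (iw wm) iR pw.
have E3 : c * I0 / 2 <= lam `^ p * Y + lam `^ (- q) * weight_const `^ q *
    \int[Lam]_(z in Z) (cone_distance rho z `^ (- (3 / 2))).
  have -> : lam `^ p * Y + lam `^ (- q) * weight_const `^ q *
    \int[Lam]_(z in Z) (cone_distance rho z `^ (- (3 / 2))) =
    \int[Lam]_(z in Z) (lam `^ p * (`|u z.2 z.1| `^ p * (rise d z.2 * psi z.2)) +
    lam `^ (- q) * weight_const `^ q * cone_distance rho z `^ (- (3 / 2))).
    by rewrite RintegralD// RintegralZl// RintegralZl.
  apply: le_trans E2; apply: le_trans E.
  by rewrite lerDr.
apply: (le_trans E3); rewrite lerD2l mulrA ler_wpM2l ?mulr_ge0 ?powR_ge0//.
exact: cone_distance_integral.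
Qed.

End lifespan_bound.

Arguments weight_const {R} n Mf S.

(** * Exponents and the optimal scale *)

Section exponents.
Context {R : realType}.
Implicit Types (p rho S Mf : R) (n : nat).

(** Completing the square, with [n^2 + 10 n - 7 = (n + 1)^2 + 8 (n - 1)] as discriminant. *)
Lemma gamma_poly_gt0 p n : (2 <= n)%N -> 1 < p < strauss_exponent R n ->
  0 < gamma_poly p n.
Proof.
move=> n2 /andP[p1 ps]; rewrite /gamma_poly.
have : 2 <= n%:R :> R by rewrite (ler_nat R 2).
move: ps; rewrite /strauss_exponent; move: (n%:R : R) => N ps N2.
have N1 : 0 < N - 1 by lra.
have E : 2 * (N - 1) * p - (N + 1) < Num.sqrt (N ^+ 2 + 10 * N - 7).
  by move: ps; rewrite ltr_pdivlMr; [lra|rewrite mulr_gt0].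
have [h|h] := ltP (2 * (N - 1) * p - (N + 1)) 0; first by nra.
have D0 : 0 <= N ^+ 2 + 10 * N - 7 by nra.
have : (2 * (N - 1) * p - (N + 1)) ^+ 2 < N ^+ 2 + 10 * N - 7.
  by rewrite -[ltRHS]sqr_sqrtr// ltr_sqr ?nnegrE// sqrtr_ge0.
have -> : (2 * (N - 1) * p - (N + 1)) ^+ 2 =
  4 * (N - 1) * ((N - 1) * p ^+ 2 - (N + 1) * p) + (N + 1) ^+ 2 by ring.
move=> h2; suff : (N - 1) * ((N - 1) * p ^+ 2 - (N + 1) * p) < (N - 1) * 2.
  by rewrite ltr_pM2l//; lra.
by move: h2; lra.
Qed.

Definition decay_rate p n : R := gamma_poly p n / (2 * p * (p - 1)).

Lemma optimized_scale n p rho S Mf (X : R) (q := p / (p - 1))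
    (m := (n%:R + 1) / 2 : R) :
  1 < p -> 0 < rho -> 1 <= S -> 0 < Mf ->
  (forall lam : R, 0 < lam ->
    X <= lam `^ p * ((Mf / S ^+ 2) `^ q * ((2 * (S + rho)) ^+ n * S)) +
    lam `^ (- q) * (weight_const n Mf S `^ q * (2 * (2 * (S + rho)) ^+ n))) ->
  X <= ((2 * (1 + rho)) ^+ n * (Mf `^ q +
         2 * (3 * Mf * ((n%:R + 2) * (2^-1) `^ (1 - m))) `^ q)) *
       S `^ (- decay_rate p n).
Proof.
move=> p1 r0 S1 M0 H.
have p0 : 0 < p by exact: lt_trans ltr01 p1.
have pm1 : 0 < p - 1 by rewrite subr_gt0.
have q0 : 0 < q by exact: divr_gt0.
have S0 : 0 < S by exact: lt_le_trans ltr01 S1.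
have Sn0 : S != 0 by rewrite gt_eqF.
(* Equates the two exponents of [S]: [mu * p - 2 * q + n + 1 = - mu * q - m * q + n], where
   [p + q = p * q] for conjugate exponents. The common value is [- decay_rate p n]. *)
pose mu := (2 * q - m * q - 1) / (p * q).
set A := (2 * (1 + rho)) ^+ n; set B := 3 * Mf * _.
have A0 : 0 <= A by rewrite exprn_ge0// mulr_ge0// addr_ge0// ltW.
have B0 : 0 <= B.
  apply: mulr_ge0; first by rewrite mulr_ge0// ltW.
  by apply: mulr_ge0; [exact: addr_ge0|exact: powR_ge0].
have hvol : (2 * (S + rho)) ^+ n <= A * S `^ n%:R.
  rewrite powR_mulrn ?(ltW S0)// -exprMn; apply: lerXn2r.
  - by rewrite nnegrE mulr_ge0// addr_ge0// ltW.
  - by rewrite nnegrE !mulr_ge0// ?addr_ge0// ltW.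
  by nra.
have wcE : weight_const n Mf S = B * S `^ (- m).
  have -> : S `^ (- m) = S^-1 * S `^ (1 - m).
    rewrite -(powR_inv1 (ltW S0)) -powRD ?Sn0 ?implybT//.
    by congr (_ `^ _); ring.
  rewrite /weight_const -/m powRM ?(ltW S0) ?invr_ge0// /B; ring.
have MSE : Mf / S ^+ 2 = Mf * S `^ (- 2).
  by rewrite powRN powR_mulrn ?(ltW S0).
apply: le_trans (H (S `^ mu) (powR_gt0 _ S0)) _.
rewrite wcE MSE (powRM _ (ltW M0) (powR_ge0 _ _)) (powRM _ B0 (powR_ge0 _ _)) -!powRrM.
have e1 : S `^ (- decay_rate p n) = S `^ (mu * p) * S `^ (- 2 * q) * S `^ n%:R * S.
  rewrite -[X in _ * X](powRr1 (ltW S0)) -!powRD ?Sn0 ?implybT//; congr (_ `^ _).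
  rewrite /decay_rate /gamma_poly /mu /q /m; field.
  by rewrite !gt_eqF.
have e2 : S `^ (- decay_rate p n) = S `^ (mu * - q) * S `^ (- m * q) * S `^ n%:R.
  rewrite -!powRD ?Sn0 ?implybT//; congr (_ `^ _).
  rewrite /decay_rate /gamma_poly /mu /q /m; field.
  by rewrite !gt_eqF.
rewrite [in leRHS]mulrDr [leRHS]mulrDl; apply: lerD.
- have -> : A * Mf `^ q * S `^ (- decay_rate p n) =
     S `^ (mu * p) * (Mf `^ q * S `^ (- 2 * q) * (A * S `^ n%:R * S)).
    by rewrite e1; ring.
  rewrite ler_wpM2l ?powR_ge0// ler_wpM2l ?mulr_ge0 ?powR_ge0//.
  by rewrite ler_wpM2r// ltW.
- have -> : A * (2 * B `^ q) * S `^ (- decay_rate p n) =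
     S `^ (mu * - q) * (B `^ q * S `^ (- m * q) * (2 * (A * S `^ n%:R))).
    by rewrite e2; ring.
  rewrite ler_wpM2l ?powR_ge0// ler_wpM2l ?mulr_ge0 ?powR_ge0//.
  by rewrite ler_wpM2l.
Qed.

End exponents.

(** The bound on [weighted_energy] from the first multiplier is inserted into the estimate from the
    second. The constant precedes the data, the solution and [S], so that it applies to data of size
    [eps] without depending on [eps]. *)
Lemma lifespan_inequality (R : realType) (n : nat) (p rho : R) : (2 <= n)%N ->
  1 < p -> 0 < rho -> exists2 C : R, 0 < C &
  forall (T : \bar R) (f g : 'rV[R]_n -> R) (u v : R -> 'rV[R]_n -> R),
  weak_solution p T f g u v -> support_curve T u v `<=` light_cone rho ->
  {ae lebesgue_rV R n, forall x, 0 <= u 0 x} ->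
  {ae lebesgue_rV R n, forall x, 0 <= v 0 x} ->
  0 < \int[lebesgue_rV R n]_(x in data_ball rho) data_rep rho (v 0) x ->
  forall S : R, 1 <= S -> (S%:E < T)%E ->
  \int[lebesgue_rV R n]_(x in data_ball rho) data_rep rho (v 0) x <=
    C * S `^ (- decay_rate p n).
Proof.
move=> n2 p1 r0; have [k [k0 [Mf M0 hfall]]] := fall_derive_bounded p1.
set c := (((1 + (rho + 1)) ^+ 2) `^ (- ((n%:R + 1) / 2)) : R).
have c0 : 0 < c by rewrite powR_gt0// exprn_gt0// addr_gt0// addr_gt0.
pose K : R := (2 * (1 + rho)) ^+ n * (Mf `^ (p / (p - 1)) +
  2 * (3 * Mf * ((n%:R + 2) * (2^-1) `^ (1 - (n%:R + 1) / 2))) `^ (p / (p - 1))).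
have K0 : 0 < K.
  apply: mulr_gt0; first by rewrite exprn_gt0// mulr_gt0// addr_gt0.
  by apply: ltr_pwDl; [exact: powR_gt0|rewrite mulr_ge0// powR_ge0].
exists (2 * K / c); first by rewrite divr_gt0// mulr_gt0.
move=> T f g u v sol supp u0 v0 I0 S S1 ST; set I := \int[_]_(_ in _) _ in I0 *.
have S0 : 0 < S by exact: lt_le_trans ltr01 S1.
have wm0 := @wave_multiplier0 R n rho 1 r0 (lexx 1).
have wm1 := @wave_multiplier1 R n rho r0.
have M10 : 0 < 1 + (rho + 1) + 2 * ((n%:R + 1) / 2) * (1 + (rho + 1)) ^+ 2.
  apply: ltr_pwDl; first by rewrite addr_gt0// addr_gt0.
  by rewrite mulr_ge0 ?sqr_ge0// mulr_ge0// divr_ge0// addr_ge0.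
have hpsi : elem_smooth (fall k S) by exact: es_fall.
have psi1 t : t <= 2^-1 -> fall k S t = 1.
  move=> t2; apply: fall_le => //; apply: (le_trans t2).
  by rewrite -[leLHS]mul1r ler_pM2r.
have psi0 t : S <= t -> fall k S t = 0 by exact: fall_ge.
have [e0 e00 h0] := energy_inequality p1 r0 sol supp u0 v0
  ltr01 ltr01 wm0 S1 ST hpsi psi1 psi0 I0.
have [e1 e10 h1] := energy_inequality p1 r0 sol supp u0 v0
  c0 M10 wm1 S1 ST hpsi psi1 psi0 I0.
(* One [d] must serve both multipliers, because [weighted_energy] depends on it; the entry 1 ensures
   [d <= S]. *)
pose d := Num.min (Num.min e0 e1) 1 / 2.
have d0 : 0 < d by rewrite divr_gt0// !lt_min e00 e10 ltr01.
have dm : d < Num.min (Num.min e0 e1) 1.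
  by rewrite /d ltr_pdivrMr// mulr_natr mulr2n ltrDl !lt_min e00 e10 ltr01.
move: dm; rewrite !lt_min => /andP[/andP[de0 de1] d1].
have dS : d <= S by exact: le_trans (ltW d1) S1.
have hf t := hfall S t S0.
have E0 := weighted_energy_le p1 r0 sol M0 ST d0 dS hf (ltW I0) (h0 d d0 de0).
have E1 lam (l0 : 0 < lam) := initial_data_le n2 p1 r0 sol M0 S1 ST d0 dS hf l0 (h1 d d0 de1).
rewrite -/I in E1.
have H (lam : R) : 0 < lam -> c * I / 2 <=
    lam `^ p * ((Mf / S ^+ 2) `^ (p / (p - 1)) * ((2 * (S + rho)) ^+ n * S)) +
    lam `^ (- (p / (p - 1))) *
      (weight_const n Mf S `^ (p / (p - 1)) * (2 * (2 * (S + rho)) ^+ n)).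
  move=> l0; apply: le_trans (E1 lam l0) _; rewrite lerD2r.
  by rewrite ler_wpM2l ?powR_ge0.
have := optimized_scale p1 r0 S1 M0 H; rewrite -/K.
set P := S `^ _ => h.
have -> : 2 * K / c * P = (K * P) * (2 / c) by ring.
rewrite -ler_pdivrMr ?divr_gt0//.
apply: le_trans h; rewrite invf_div; lra.
Qed.

Theorem theorem3p1 (R : realType) (n : nat) (p rho : R) (f g : 'rV[R]_n -> R)
    (hn : (2 <= n)%N) (hp : 1 < p < strauss_exponent R n) (hrho : 0 < rho)
    (hf : H1 f) (hg : L2 g)
    (hf0 : {ae lebesgue_rV R n, forall x, 0 <= f x})
    (hg0 : {ae lebesgue_rV R n, forall x, 0 <= g x})
    (hfc : compact (ess_support f)) (hgc : compact (ess_support g))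
    (hgN0 : ~ {ae lebesgue_rV R n, forall x, g x = 0}) :
  exists eps0 C : R,
    [/\ 0 < eps0, 0 < C &
      forall eps : R, 0 < eps <= eps0 ->
        (exists u v : R -> 'rV[R]_n -> R,
          weak_solution p (lifespan p f g eps)
            (fun x => eps * f x) (fun x => eps * g x) u v /\
          support_curve (lifespan p f g eps) u v `<=` light_cone rho) ->
        (lifespan p f g eps <=
          (C * eps `^ (- (2 * p * (p - 1) / gamma_poly p n)))%:E)%E].
Proof.
have /andP[p1 _] := hp; have p0 : 0 < p by exact: lt_trans ltr01 p1.
have gam0 := gamma_poly_gt0 hn hp.
have [C C0 hC] := lifespan_inequality hn p1 hrho.
pose I := \int[lebesgue_rV R n]_(x in data_ball rho) data_rep rho g x.
have mB := @measurable_data_ball R n rho.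
(* The constants are chosen before any solution is given, while [0 < I] is drawn from one: at time 0
   the support condition confines [eps * g] to the ball of radius [rho]. *)
have Ipos (eps : R) (T : \bar R) (u v : R -> 'rV[R]_n -> R) : 0 < eps ->
    weak_solution p T (fun x => eps * f x) (fun x => eps * g x) u v ->
    support_curve T u v `<=` light_cone rho -> 0 < I.
  move=> e0 sol supp; rewrite lt_neqAle Rintegral_ge0 ?andbT; last first.
    by move=> x _; exact: data_rep_ge0.
  apply/negP => /eqP I0; apply: hgN0.
  have gB : {ae lebesgue_rV R n, forall x, data_ball rho x -> g x = 0}.
    have md : measurable_fun (data_ball rho) (EFin \o data_rep rho g).
      by apply/measurable_EFinP; apply: measurable_funTS; exact: measurable_data_rep.
    have /(ae_eq_integral_abs _ mB md) : (\int[lebesgue_rV R n]_(x in data_ball rho)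
        `|(EFin \o data_rep rho g) x| = 0)%E.
      under eq_integral do rewrite /= ger0_norm ?data_rep_ge0//.
      rewrite -[RHS]/((0 : R)%:E) I0 /I /Rintegral fineK//.
      exact: integrable_fin_num (integrable_data_ball hrho hg).
    apply: filterS => x h xB; have := h xB; rewrite /= data_rep_in// => -[].
    by move/eqP; rewrite normr_eq0 => /eqP.
  have := ae_outside_v hrho supp (time_interval0 sol).
  apply: filterS3 gB (sol_init_t sol) => x gx vx ox.
  have [xB|xB] := pselect (data_ball rho x); first exact: gx.
  have : v 0 x = 0 by apply: ox; rewrite add0r ltNge; apply/negP.
  by rewrite vx => /eqP; rewrite mulf_eq0 gt_eqF//= => /eqP.
(* If [I] is not positive, no [eps] admits a solution with the required support, and any constants
   do. *)
have [I0|I0] := leP I 0.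
  exists 1, 1; split => // eps /andP[e0 _] [u [v [sol supp]]].
  by have := Ipos _ _ _ _ e0 sol supp; rewrite ltNge I0.
pose kap := decay_rate p n.
have kap0 : 0 < kap by rewrite /kap /decay_rate divr_gt0// !mulr_gt0// subr_gt0.
pose C1 := (C / I) `^ kap^-1.
(* The estimate holds for [1 <= S] only; with [eps <= 1] the maximum makes the candidate bound at
   least 1. *)
exists 1, (Num.max 1 C1); split; [exact: ltr01|by rewrite lt_max ltr01|].
move=> eps /andP[e0 e1] [u [v [sol supp]]].
set T := lifespan p f g eps in sol supp *.
have u0 : {ae lebesgue_rV R n, forall x, 0 <= u 0 x}.
  by apply: filterS2 hf0 (sol_init sol) => x fx ->; rewrite mulr_ge0// ltW.
have v0 : {ae lebesgue_rV R n, forall x, 0 <= v 0 x}.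
  by apply: filterS2 hg0 (sol_init_t sol) => x gx ->; rewrite mulr_ge0// ltW.
have IE : \int[lebesgue_rV R n]_(x in data_ball rho) data_rep rho (v 0) x = eps * I.
  rewrite -RintegralZl//; last exact: integrable_data_ball.
  congr fine; apply: ae_eq_integral => //.
  - apply/measurable_EFinP; apply: measurable_funTS; apply: measurable_data_rep.
    exact: L2_v0 sol.
  - apply/measurable_EFinP; apply: measurable_funM => //.
    by apply: measurable_funTS; exact: measurable_data_rep.
  apply: filterS (sol_init_t sol) => x vx _; congr EFin.
  by rewrite /data_rep vx normrM gtr0_norm// mulrA.
have Iv0 : 0 < \int[lebesgue_rV R n]_(x in data_ball rho) data_rep rho (v 0) x.
  by rewrite IE mulr_gt0.
set E := - (2 * p * (p - 1) / gamma_poly p n).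
have EE : E = - kap^-1 by rewrite /E /kap /decay_rate invf_div.
have bound (S : R) : 1 <= S -> (S%:E < T)%E -> S <= C1 * eps `^ E.
  move=> S1 ST; have := hC _ _ _ _ _ sol supp u0 v0 Iv0 S S1 ST.
  have S0 : 0 < S by exact: lt_le_trans ltr01 S1.
  rewrite IE -/kap powRN => h.
  have h2 : S `^ kap <= C / I * eps^-1.
    rewrite -[leLHS]mulr1 -(mulfV (lt0r_neq0 (mulr_gt0 e0 I0))) mulrA.
    rewrite [leRHS](_ : _ = C / (eps * I)); last by rewrite invfM; ring.
    rewrite ler_pM2r ?invr_gt0 ?mulr_gt0// mulrC.
    by rewrite -ler_pdivlMr ?powR_gt0.
  have ki0 : 0 <= kap^-1 by rewrite invr_ge0 ltW.
  have CI0 : 0 <= C / I by rewrite divr_ge0// ltW.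
  have ei0 : 0 <= eps^-1 by rewrite invr_ge0 ltW.
  have : (S `^ kap) `^ kap^-1 <= (C / I * eps^-1) `^ kap^-1.
    by apply: ge0_ler_powR; rewrite // nnegrE ?powR_ge0// mulr_ge0.
  rewrite -powRrM mulfV ?gt_eqF// (powRr1 (ltW S0)) (powRM _ CI0 ei0) -/C1.
  by rewrite EE -(powR_inv1 (ltW e0)) -powRrM mulN1r.
have E0 : 1 <= eps `^ E.
  rewrite EE powRN invf_ge1 ?powR_gt0//.
  have : eps `^ kap^-1 <= 1 `^ kap^-1.
    by apply: ge0_ler_powR; rewrite ?nnegrE ?invr_ge0 ?(ltW kap0) ?(ltW e0).
  by rewrite powR1.
set b := Num.max 1 C1 * eps `^ E.
have b1 : 1 <= b by rewrite /b -[leLHS]mulr1 ler_pM// le_max lexx.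
have bC : C1 * eps `^ E <= b by rewrite /b ler_wpM2r ?powR_ge0// le_max lexx orbT.
rewrite leNgt; apply/negP => bT.
(* A finite time strictly between the bound and the lifespan, which may be infinite. *)
have [S bS ST] : exists2 S : R, b < S & (S%:E < T)%E.
  move: bT; case: (T) => [t| |].
  - rewrite lte_fin => bt; exists ((b + t) / 2); rewrite ?lte_fin; lra.
  - by move=> _; exists (b + 1); [rewrite ltrDl|rewrite ltry].
  - by rewrite ltNge leNye.
have := bound S (le_trans b1 (ltW bS)) ST.
by rewrite leNgt (le_lt_trans bC bS).
Qed.
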